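(* (i) Let $\Lambda,\Lambda'\subseteq\Lambda(s)$ and the bijection $\nu\mapsto\nu':\Lambda\to\Lambda'$ be as in an *equivalence situation* (defined in the context). Then $d_{\lambda\mu}=d_{\lambda'\mu'}$ and $e_{\lambda\mu}=e_{\lambda'\mu'}$ for all $\lambda,\mu\in\Lambda$. (ii) Let $\Lambda,\Lambda'\subseteq\Lambda(s)$, $\tilde\Lambda\subseteq\Lambda$, the 2-to-1 map $\nu\mapsto\nu':\tilde\Lambda\to\Lambda'$ and, for $\nu'\in\Lambda'$, its preimages $\nu^-\prec\nu^+$ be as in a *projection situation* (defined in the context). For $\lambda=\lambda^+\in\Lambda$ we have $$d_{\lambda^+\mu^+}=d_{\lambda'\mu'}\ \text{ for }\mu^+\in\Lambda,\qquad d_{\lambda^+\mu^-}=q\,d_{\lambda'\mu'}\ \text{ for }\mu^-\in\Lambda,$$ $$d_{\lambda^+\mu}=0\ \text{ for }\mu\in\Lambda\text{ not of the form }\mu^\pm.$$ For $\mu=\mu^-\in\Lambda$ we have $$e_{\lambda^-\mu^-}=e_{\lambda'\mu'}\ \text{ for }\lambda^-\in\Lambda,\qquad e_{\lambda^+\mu^-}=q\,e_{\lambda'\mu'}\ \text{ for }\lambda^+\in\Lambda,$$ $$e_{\lambda\mu^-}=0\ \text{ for }\lambda\in\Lambda\text{ not of the form }\lambda^\pm.$$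
   Context: **Groups and weights.** $p$ is a prime and $G$ is either $\mathrm{GL}_n$, or $\mathrm{Sp}_n$ with $n=2m$ and $p$ odd (over an algebraically closed field of characteristic $p$). - $\mathrm{GL}_n$: weights $X=\mathbb Z^n$, Weyl group $W=\mathrm{Sym}_n$, dominant weights $X^+$ are the weakly decreasing vectors, written uniquely as $[\lambda^1,\lambda^2]=(\lambda^1_1,\lambda^1_2,\ldots,0,\ldots,0,\ldots,-\lambda^2_2,-\lambda^2_1)$ with $\lambda^1,\lambda^2$ partitions, $l(\lambda^1)+l(\lambda^2)\le n$ ($l$ = length). $\rho=(n,n-1,\ldots,1)$. - $\mathrm{Sp}_n$: weights $X=\mathbb Z^m$, roots $\pm\varepsilon_i\pm\varepsilon_j$ ($i<j$), $\pm2\varepsilon_i$; $X^+$ is the set of partitions $\lambda$ with $l(\lambda)\le m$. $\rho=(m,m-1,\ldots,1)$. The dot action is $w\cdot x=w(x+\rho)-\rho$. For a root $\alpha$ and $l\in\mathbb Z$, $s_{\alpha,l}(x)=x-(\langle x,\alpha^\vee\rangle-lp)\alpha$. $\chi(\mu)$ is Weyl's character. **The sets $\Lambda(s)$ and the group $H$.** - $\mathrm{GL}_n$: $s=(s_1,s_2)$ with $s_1,s_2\in\{1,\ldots,\min(n,p)\}$, $s_1+s_2\le n$; $\Lambda(s)=\{\lambda\in X^+ : l(\lambda^h)\le s_h\le p-\lambda^h_1\text{ for }h=1,2\}$; $H=W_p=W\ltimes pX_0$, where $X_0=\{x\in\mathbb Z^n:\sum_i x_i=0\}$. - $\mathrm{Sp}_n$: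 $s\in\{1,\ldots,\min(m,p)\}$; $\Lambda(s)=\{\lambda\in X^+ : l(\lambda)\le s\le p-\lambda_1\}$; $H=W_p(D_s)$, generated by the $s_{\alpha,l}$ with $\alpha=\varepsilon_i\pm\varepsilon_j$, $1\le i<j\le s$, $l\in\mathbb Z$. **The order $\preceq$ on $X^+$.** $\mu\preceq\lambda$ iff there are dominant weights $\lambda=\chi_1,\ldots,\chi_t=\mu$, $t\ge1$, such that for $1\le r<t$: - $\mathrm{GL}_n$: $\chi_{r+1}=ws_{\alpha,l}\cdot\chi_r$ for some $w\in\mathrm{Sym}(\{1,\ldots,l(\chi_r^1),n-l(\chi_r^2)+1,\ldots,n\})$, $\alpha=\varepsilon_i-\varepsilon_j$ with $1\le i\le l(\chi_r^1)$, $n-l(\chi_r^2)<j\le n$, and $l\ge1$ with $\langle\chi_r+\rho,\alpha^\vee\rangle-lp\ge1$ and $\chi(s_{\alpha,l}\cdot\chi_r)\ne0$. - $\mathrm{Sp}_n$: $\chi_{r+1}=ws_{\alpha,l}\cdot\chi_r$ for some $w\in\mathrm{Sym}(\{1,\ldots,l(\chi_r)\})$, $\alpha=\varepsilon_i+\varepsilon_j$ with $1\le i<j\le l(\chi_r)$, and $l\ge1$ with $\langle\chi_r+\rho,\alpha^\vee\rangle-lp\ge1$ and all entries of $s_{\alpha,l}(\chi_r+\rho)$ distinct and strictly positive. **Arrow diagrams** of $\lambda\in\Lambda(s)$ (a weight in $\Lambda(s)$ is determined by its arrow diagram). - $\mathrm{GL}_n$: $p$ nodes on a line labelled $0,\ldots,p-1$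 from left to right, considered cyclically ($p-1$ and $0$ are neighbours). There is a wall (below the line) between the nodes with labels $\rho_{s_1}-1$ and $\rho_{s_1}$ mod $p$ ($\rho_{s_1}=n-s_1+1$), and a wall (above the line) between those with labels $s_2$ and $s_2+1$ mod $p$. Put an arrow $\wedge$ at the nodes with labels $\rho_i+\lambda^1_i$ mod $p$, $1\le i\le s_1$, and an arrow $\vee$ at the nodes with labels $j-\lambda^2_j$ mod $p$, $1\le j\le s_2$. The two walls cut the cyclic line into two segments (one empty if the walls are at the same position), called the two sides of the wall; each is read left to right (labels increasing mod $p$). - $\mathrm{Sp}_n$: $(p+1)/2$ nodes on a line; the $i$-th node from the left has bottom label $i-1$ and top label $-(i-1)$. Going around the line anti-clockwise (bottom from left to right, then top from right to left) the labels mod $p$ increase by 1. A wall is put between the labels $\rho_s-1$ and $\rho_s$ mod $p$, $\rho_s=m-s+1$ (to the right of the last node if $\rho_s\equiv(p+1)/2$); it divides the nodes into those to its left and those to its right. For each $i\le s$ put an arrow at the label congruent to $\rho_i+\lambda_i$ mod $p$: $\wedge$ if it is a bottom label, $\vee$ if it is a top label. For an arrow at the first node (the $0$-node) either choice is allowed, subject to the convention that the parity of the number of $\wedge$'s is the same for all weights in a given set $\Lambda$. A node may have no arrow ($\mathrm o$), a single arrow, or both arrows ($\times$; impossible at the $0$-node for $\mathrm{Sp}_n$). **Cap(-curl) diagram $c_\lambda$.** On each side of the wall recursively connect by a cap each pair of single arrows $\vee\wedge$ ($\vee$ to the left of $\wedge$) such that all single arrows in between are already connected, until no such pairs remain. If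 $G=\mathrm{GL}_n$ this is $c_\lambda$. If $G=\mathrm{Sp}_n$: the unconnected single arrows on each side then form a sequence $\wedge\cdots\wedge\vee\cdots\vee$; to the left of the wall connect consecutive (in this sequence) $\wedge\wedge$ pairs by a curl, starting from the left; to the right of the wall connect consecutive $\vee\vee$ pairs by a curl, starting from the right. The **codiagram $co_\mu$** is defined by reversing the roles of $\wedge$ and $\vee$: caps connect pairs $\wedge\vee$, curls to the left of the wall connect $\vee\vee$ pairs starting from the left, curls to the right of the wall connect $\wedge\wedge$ pairs starting from the right. For $\mu\preceq\lambda$ the arrow diagrams of $\lambda,\mu$ have their single arrows and their $\times$'s at the same nodes. $c_{\lambda\mu}$ is obtained by placing the caps and curls of $c_\lambda$ on the arrow diagram of $\mu$, and $co_{\mu\lambda}$ by placing the caps and curls of $co_\mu$ on the arrow diagram of $\lambda$. In these, a cap is anti-clockwise if its end nodes carry $\vee\wedge$ and clockwise if they carry $\wedge\vee$. A curl to the left of the wall is anti-clockwise if its end nodes carry $\wedge\wedge$ and clockwise if they carry $\vee\vee$; a curl to the right of the wall is anti-clockwise for $\vee\vee$ and clockwise for $\wedge\wedge$. The diagram is oriented if each of its caps and curls is clockwise or anti-clockwise. **Polynomials** (for a set $\Lambda$ which is the intersection of $\Lambda(s)$ with an $H$-orbit under the dot action). For $\lambda,\mu\in\Lambda$: $d_{\lambda\mu}=q^{c}$, with $c$ the number of clockwise caps and curls in $c_{\lambda\mu}$, if $\mu\preceq\lambda$ and $c_{\lambda\mu}$ is oriented, and $0$ otherwise; $e_{\lambda\mu}=q^{a}$,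 with $a$ the number of anti-clockwise caps and curls in $co_{\mu\lambda}$, if $\mu\preceq\lambda$ and $co_{\mu\lambda}$ is oriented, and $0$ otherwise. **Equivalence situation.** There are $\kappa,\kappa'\in\Lambda(s)$ with $\Lambda=\Lambda(s)\cap H\cdot\kappa$, $\Lambda'=\Lambda(s)\cap H\cdot\kappa'$, and a bijection $\nu\mapsto\nu':\Lambda\to\Lambda'$ with $\kappa\mapsto\kappa'$, of one of the following kinds. (E1) One end node of a cap or (for $\mathrm{Sp}_n$) curl of $co_\kappa$ is moved one step past a neighbouring node, on the same side of the wall, which is empty or carries $\times$ in the arrow diagram of $\kappa$: the arrow diagram of $\nu'$ is obtained from that of $\nu$ by interchanging the contents of these two nodes (a single arrow keeps its direction $\wedge$ or $\vee$). (E2) $G=\mathrm{Sp}_n$ and $co_\kappa$ has a curl whose left end node is the $0$-node: $\Lambda'=\Lambda$, $\nu'=\nu$, but for $\Lambda'$ the arrow at the $0$-node is replaced by its opposite in all arrow diagrams (so this curl becomes a cap). (E3) $G=\mathrm{Sp}_n$ and $co_\kappa$ has a curl (to the right of the wall) whose right end node is the last node: the arrow diagram of $\nu'$ is obtained from that of $\nu$ by replacing the arrow at the last node by its opposite. **Projection situation.** There are $\kappa,\kappa'\in\Lambda(s)$ with $\Lambda=\Lambda(s)\cap H\cdot\kappa$, $\Lambda'=\Lambda(s)\cap H\cdot\kappa'$, of one of the following kinds. (P1) $co_\kappa$ has a cap whose end nodes are two neighbouring nodes (on the same side of the wall), and the arrow diagram of $\kappa'$ is obtained from that of $\kappa$ by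 replacing the contents $\wedge\,\vee$ of these nodes by $\mathrm o\,\times$, or by $\times\,\mathrm o$ (the latter is excluded if $G=\mathrm{Sp}_n$ and the left node is the $0$-node). (P2) $G=\mathrm{Sp}_n$, $co_\kappa$ has a curl whose end nodes are the first two nodes, and the arrow diagram of $\kappa'$ is obtained from that of $\kappa$ by replacing the contents of these nodes by $\mathrm o\,\times$. In either case $\tilde\Lambda$ is the set of $\nu\in\Lambda$ for which this cap (resp. curl) is oriented when placed on the arrow diagram of $\nu$, i.e. $\nu$ has opposite (resp. equal) arrows at the two nodes; for $\nu\in\tilde\Lambda$, $\nu'\in\Lambda'$ is the weight whose arrow diagram is obtained from that of $\nu$ by replacing the contents of the two nodes by those in $\kappa'$. The map $\nu\mapsto\nu':\tilde\Lambda\to\Lambda'$ is 2-to-1 and onto, and the preimages of $\nu'\in\Lambda'$ are denoted $\nu^-\prec\nu^+$: in case (P1) $\nu^+$ has $\vee\wedge$ and $\nu^-$ has $\wedge\vee$ at the two nodes, in case (P2) $\nu^+$ has $\wedge\wedge$ and $\nu^-$ has $\vee\vee$. A weight in $\Lambda$ is ''of the form $\nu^+$'' (resp. ''$\nu^-$'') if it is the larger (resp. smaller) preimage of some element of $\Lambda'$, and ''of the form $\nu^\pm$'' if it is one of these; the notations $\lambda^\pm,\lambda'$ and $\mu^\pm,\mu'$ are used accordingly. *)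

(* Defs.v *)
From mathcomp Require Import all_boot all_order all_fingroup all_algebra.
From mathcomp Require Import boolp.
From mathcomp Require Import mpoly.

Set Implicit Arguments.
Unset Strict Implicit.
Unset Printing Implicit Defensive.

Import Order.TTheory GRing.Theory Num.Theory.
Local Open Scope ring_scope.

(* [GL n s1 s2] is GL_n with s = (s1, s2); [Sp m s] is Sp_n with n = 2m.
   The algebraic group itself enters only through its weight combinatorics. *)
Inductive group_data := GL of nat & nat & nat | Sp of nat & nat.

Definition is_Sp (G : group_data) : bool := if G is Sp _ _ then true else false.

Definition valid (p : nat) (G : group_data) : bool :=
  match G with
  | GL n s1 s2 =>
      [&& 0 < s1 <= minn n p, 0 < s2 <= minn n p & s1 + s2 <= n]%N
  | Sp m s => odd p && (0 < s <= minn m p)%N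
  end.

Definition rank (G : group_data) : nat :=
  match G with GL n _ _ => n | Sp m _ => m end.

Definition weight (G : group_data) := 'rV[int]_(rank G).

(* Entries are numbered from 0, so [ent x k] is the usual x_(k+1); it is 0
   beyond the last entry, as is customary for partitions. *)
Definition ent n (x : 'rV[int]_n) (k : nat) : int :=
  if insub k is Some i then x 0 i else 0.

Definition rho k : 'rV[int]_k := \row_(i < k) (k - i)%N%:Z.

Definition eps n (i : 'I_n) : 'rV[int]_n := delta_mx 0 i.

Definition perm_wt n (w : 'S_n) (x : 'rV[int]_n) : 'rV[int]_n :=
  \row_i x 0 ((w^-1)%g i).

(* <x, alpha^vee> for the roots alpha = eps_i +- eps_j, i != j, the only ones
   used below: there alpha^vee is alpha under the standard inner product. *)
Definition pairing n (x alpha : 'rV[int]_n) : int := \sum_i x 0 i * alpha 0 i.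

Definition refl p n (alpha : 'rV[int]_n) (l : int) (x : 'rV[int]_n) :=
  x - (pairing x alpha - l * p%:Z) *: alpha.

Definition dot n (g : 'rV[int]_n -> 'rV[int]_n) (x : 'rV[int]_n) :=
  g (x + rho n) - rho n.

Definition decreasing n (x : 'rV[int]_n) : bool :=
  [forall i : 'I_n, forall j : 'I_n, (i <= j)%N ==> (x 0 j <= x 0 i)].

Definition dominant (G : group_data) : weight G -> bool :=
  match G return weight G -> bool with
  | GL n _ _ => fun x => decreasing x
  | Sp m _ => fun x => decreasing x && [forall i : 'I_m, 0 <= x 0 i]
  end.

(* The partitions lambda^1, lambda^2 with lambda = [lambda^1, lambda^2], padded
   with zeros to n entries. *)
Definition part1 n (x : 'rV[int]_n) : 'rV[int]_n := \row_i Num.max (x 0 i) 0.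
Definition part2 n (x : 'rV[int]_n) : 'rV[int]_n :=
  \row_i Num.max (- x 0 (rev_ord i)) 0.

Definition len n (x : 'rV[int]_n) : nat := #|[set i | x 0 i != 0]|.

Definition in_Lambda (p : nat) (G : group_data) : weight G -> bool :=
  match G return weight G -> bool with
  | GL n s1 s2 => fun x =>
      [&& @dominant (GL n s1 s2) x,
          (len (part1 x) <= s1)%N, s1%:Z <= p%:Z - ent (part1 x) 0,
          (len (part2 x) <= s2)%N & s2%:Z <= p%:Z - ent (part2 x) 0]
  | Sp m s => fun x =>
      [&& @dominant (Sp m s) x, (len x <= s)%N & s%:Z <= p%:Z - ent x 0]
  end.

(* H = W |x pX_0 *)
Definition GL_orbit p n (x y : 'rV[int]_n) : Prop :=
  exists (w : 'S_n) (z : 'rV[int]_n),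
    \sum_i z 0 i = 0 /\ y = dot (fun v => perm_wt w v + p%:Z *: z) x.

Definition Ds_root m s (alpha : 'rV[int]_m) : Prop :=
  exists i j : 'I_m, (i < j < s)%N /\
    (alpha = eps i + eps j \/ alpha = eps i - eps j).

(* H is generated by the involutions s_(alpha,l), so that the orbit of x is
   what can be reached from x by applying finitely many of them. *)
Inductive Sp_orbit p m s (x : 'rV[int]_m) : 'rV[int]_m -> Prop :=
| Sp_orbit_refl : Sp_orbit p s x x
| Sp_orbit_step y alpha l :
    Sp_orbit p s x y -> Ds_root s alpha ->
    Sp_orbit p s x (dot (refl p alpha l) y).

Definition H_orbit (p : nat) (G : group_data) : weight G -> weight G -> Prop :=
  match G return weight G -> weight G -> Prop with
  | GL n _ _ => fun x y => GL_orbit p x y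
  | Sp m s => fun x y => Sp_orbit p s x y
  end.

Definition Lambda p G (kappa nu : weight G) : Prop :=
  in_Lambda p nu /\ H_orbit p kappa nu.

(* e(x) for x in Z^n, as a Laurent monomial in Frac(Z[X_0, ..., X_(n-1)]) *)
Definition expo n (x : 'rV[int]_n) : {fraction {mpoly int[n]}} :=
  \prod_(i < n) (tofrac ('X_i : {mpoly int[n]})) ^ (x 0 i).

Definition altsum n (x : 'rV[int]_n) : {fraction {mpoly int[n]}} :=
  \sum_(w : 'S_n) (-1) ^+ w * expo (perm_wt w x).

(* Weyl's character chi(mu) of GL_n, mu any weight *)
Definition weyl_char n (mu : 'rV[int]_n) : {fraction {mpoly int[n]}} :=
  altsum (mu + rho n) / altsum (rho n).

Definition GL_step p n (x y : 'rV[int]_n) : Prop :=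
  let l1 := len (part1 x) in
  let l2 := len (part2 x) in
  exists (w : 'S_n) (i j : 'I_n) (l : int),
    let alpha := eps i - eps j in
    [/\ perm_on [set k : 'I_n | (k < l1) || (n - l2 <= k)]%N w,
        (i < l1)%N && (n - l2 <= j)%N,
        1 <= l /\ 1 <= pairing (x + rho n) alpha - l * p%:Z,
        weyl_char (dot (refl p alpha l) x) != 0
      & y = dot (fun v => perm_wt w (refl p alpha l v)) x].

Definition Sp_step p m (x y : 'rV[int]_m) : Prop :=
  exists (w : 'S_m) (i j : 'I_m) (l : int),
    let alpha := eps i + eps j in
    let v := refl p alpha l (x + rho m) in
    [/\ perm_on [set k : 'I_m | k < len x]%N w,
        (i < j < len x)%N,
        1 <= l /\ 1 <= pairing (x + rho m) alpha - l * p%:Z,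
        injective (fun k => v 0 k) /\ (forall k, 0 < v 0 k)
      & y = dot (fun v => perm_wt w (refl p alpha l v)) x].

Definition step (p : nat) (G : group_data) : weight G -> weight G -> Prop :=
  match G return weight G -> weight G -> Prop with
  | GL n _ _ => fun x y => GL_step p x y
  | Sp m _ => fun x y => Sp_step p x y
  end.

Inductive chain p G (lam : weight G) : weight G -> Prop :=
| chain_refl : dominant lam -> chain p lam lam
| chain_step chi mu :
    chain p lam chi -> dominant mu -> step p chi mu -> chain p lam mu.

Definition preceq p G (mu lam : weight G) : Prop := chain p lam mu.

(* Content of a node: (is there an up arrow, is there a down arrow). *)
Definition content : Type := (bool * bool)%type.
Definition up : content := (true, false).
Definition down : content := (false, true).
Definition cross : content := (true, true).
Definition empty : content := (false, false).

Definition single (c : content) : bool := (c == up) || (c == down).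
Definition opp_arrow (c : content) : content := (c.2, c.1).

(* Nodes are numbered from left to right, starting with 0. *)
Definition diagram := nat -> content.

Definition residue (p : nat) (z : int) : nat := `|(z %% p%:Z)%Z|%N.

(* Node numbers and labels coincide for GL_n. *)
Definition GL_diagram p n s1 s2 (x : 'rV[int]_n) : diagram :=
  let ups := [seq residue p (ent (rho n + part1 x) i) | i <- iota 0 s1] in
  let downs := [seq residue p (j.+1%:Z - ent (part2 x) j) | j <- iota 0 s2] in
  fun k => (k \in ups, k \in downs).

(* Node k has bottom label k and top label p - k (0 if k = 0). For an arrow at
   node 0 the convention is recorded by [b], the common parity of the number of
   up arrows (true = odd) of the weights under consideration; [b] is irrelevant
   if there is no arrow at node 0. *)
Definition Sp_diagram p m s (b : bool) (x : 'rV[int]_m) : diagram :=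
  let labels := [seq residue p (ent (rho m + x) i) | i <- iota 0 s] in
  let u := count (fun a => 0 < a <= p./2)%N labels in
  fun k =>
    if k == 0%N then ((0%N \in labels) && (odd u != b),
                      (0%N \in labels) && (odd u == b))
    else if (k <= p./2)%N then (k \in labels, (p - k)%N \in labels)
    else empty.

Definition diag (p : nat) (G : group_data) (b : bool) : weight G -> diagram :=
  match G return weight G -> diagram with
  | GL n s1 s2 => fun x => GL_diagram p s1 s2 x
  | Sp m s => fun x => Sp_diagram p s b x
  end.

(* The two sides of the wall, each read from left to right.
   GL_n: from the wall after s2 to the wall before rho_(s1) = n - s1 + 1, and
   from there to the wall after s2; if the walls coincide the first is empty.
   Sp_n: the wall separates the labels t = rho_s - 1 = m - s and t + 1 mod p,
   i.e. on the bottom row the nodes t and t + 1, on the top row the nodes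
   p - t and p - t - 1; hence there are min(t + 1, p - t) nodes to its left. *)
Definition sides (p : nat) (G : group_data) : seq nat * seq nat :=
  match G with
  | GL n s1 s2 =>
      let l := ((n - s1 - s2) %% p)%N in
      ([seq ((s2 + 1 + t) %% p)%N | t <- iota 0 l],
       [seq ((n - s1 + 1 + t) %% p)%N | t <- iota 0 (p - l)])
  | Sp m s =>
      let t := ((m - s) %% p)%N in
      let a := minn t.+1 (p - t) in
      (iota 0 a, iota a (p.+1./2 - a))
  end.

Definition last_node (p : nat) : nat := p.+1./2.-1.

Definition neighbours p G (x y : nat) : bool :=
  let adj t := ((x, y) \in zip t (behead t)) || ((y, x) \in zip t (behead t)) in
  adj (sides p G).1 || adj (sides p G).2.

(* [match_arrows D u r]: u lists the unconnected single arrows met so far, from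
   right to left, and r those still to be read; the result consists of the caps
   and of the nodes left unconnected, both with the left end first. *)
Fixpoint match_arrows (D : diagram) (u r : seq nat) :
    seq (nat * nat) * seq nat :=
  match r with
  | [::] => ([::], rev u)
  | y :: r' =>
      match u with
      | x :: u' =>
          if (D x == down) && (D y == up) then
            let m := match_arrows D u' r' in ((x, y) :: m.1, m.2)
          else match_arrows D (y :: u) r'
      | [::] => match_arrows D [:: y] r'
      end
  end.

Definition side_match (D : diagram) (t : seq nat) :=
  match_arrows D [::] [seq k <- t | single (D k)].

Fixpoint pair_up (t : seq nat) : seq (nat * nat) :=
  if t is x :: y :: t' then (x, y) :: pair_up t' else [::].

(* Curls are distinguished according to their position relative to the wall. *)
Inductive kind := Cap | LeftCurl | RightCurl.

(* For each kind, the list of pairs (left end node, right end node). *)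
Definition cc_diagram := kind -> seq (nat * nat).

Definition curls (C : cc_diagram) : seq (nat * nat) :=
  C LeftCurl ++ C RightCurl.

Definition end_nodes (C : cc_diagram) : seq nat :=
  let E := C Cap ++ curls C in [seq e.1 | e <- E] ++ [seq e.2 | e <- E].

Definition cap_diagram p G (D : diagram) : cc_diagram :=
  let L := side_match D (sides p G).1 in
  let R := side_match D (sides p G).2 in
  fun k => match k with
  | Cap => L.1 ++ R.1
  | LeftCurl =>
      if is_Sp G then pair_up [seq k <- L.2 | D k == up] else [::]
  | RightCurl =>
      if is_Sp G then
        [seq (e.2, e.1) | e <- pair_up (rev [seq k <- R.2 | D k == down])]
      else [::]
  end.

Definition cocap_diagram p G (D : diagram) : cc_diagram :=
  cap_diagram p G (fun k => opp_arrow (D k)).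

Definition clockwise (k : kind) : content * content :=
  match k with
  | Cap => (up, down) | LeftCurl => (down, down) | RightCurl => (up, up)
  end.

Definition anticlockwise (k : kind) : content * content :=
  match k with
  | Cap => (down, up) | LeftCurl => (up, up) | RightCurl => (down, down)
  end.

Definition carries (D : diagram) (c : content * content) (e : nat * nat) :=
  (D e.1, D e.2) == c.

Definition edge_oriented (D : diagram) (k : kind) (e : nat * nat) : bool :=
  carries D (clockwise k) e || carries D (anticlockwise k) e.

Definition kinds : seq kind := [:: Cap; LeftCurl; RightCurl].

Definition oriented (C : cc_diagram) (D : diagram) : bool :=
  all (fun k => all (edge_oriented D k) (C k)) kinds.

Definition nb_clockwise (C : cc_diagram) (D : diagram) : nat :=
  (\sum_(k <- kinds) count (carries D (clockwise k)) (C k))%N.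

Definition nb_anticlockwise (C : cc_diagram) (D : diagram) : nat :=
  (\sum_(k <- kinds) count (carries D (anticlockwise k)) (C k))%N.

(* q is the variable 'X. *)
Definition dpoly p G (b : bool) (lam mu : weight G) : {poly int} :=
  let C := cap_diagram p G (diag p b lam) in
  if `[< preceq p mu lam >] && oriented C (diag p b mu)
  then 'X ^+ nb_clockwise C (diag p b mu) else 0.

Definition epoly p G (b : bool) (lam mu : weight G) : {poly int} :=
  let C := cocap_diagram p G (diag p b mu) in
  if `[< preceq p mu lam >] && oriented C (diag p b lam)
  then 'X ^+ nb_anticlockwise C (diag p b lam) else 0.

(* Below, Lambda and Lambda' are given by kappa and kappa', and b, b' are their
   parity conventions for the arrow at node 0. *)

Definition bijection_on T (A B : T -> Prop) (f : T -> T) : Prop :=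
  [/\ forall x, A x -> B (f x),
      forall x y, A x -> A y -> f x = f y -> x = y
    & forall y, B y -> exists2 x, A x & f x = y].

Definition equiv_move p G (kappa : weight G) (b b' : bool)
    (f : weight G -> weight G) : Prop :=
  exists x y : nat,
    [/\ x \in end_nodes (cocap_diagram p G (diag p b kappa)),
        neighbours p G x y,
        (diag p b kappa y == empty) || (diag p b kappa y == cross)
      & forall nu, Lambda p kappa nu ->
          let D := diag p b nu in
          diag p b' (f nu) =1 [eta D with x |-> D y, y |-> D x]].

Definition equiv_first p G (kappa : weight G) (b b' : bool)
    (f : weight G -> weight G) : Prop :=
  [/\ is_Sp G,
      exists y, (0%N, y) \in curls (cocap_diagram p G (diag p b kappa))
    & forall nu, Lambda p kappa nu ->
        let D := diag p b nu in
        f nu = nu /\ diag p b' nu =1 [eta D with 0%N |-> opp_arrow (D 0%N)]].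

Definition equiv_last p G (kappa : weight G) (b b' : bool)
    (f : weight G -> weight G) : Prop :=
  let N := last_node p in
  [/\ is_Sp G,
      exists x, (x, N) \in cocap_diagram p G (diag p b kappa) RightCurl
    & forall nu, Lambda p kappa nu ->
        let D := diag p b nu in
        diag p b' (f nu) =1 [eta D with N |-> opp_arrow (D N)]].

Definition equivalence p G (kappa kappa' : weight G) (b b' : bool)
    (f : weight G -> weight G) : Prop :=
  [/\ in_Lambda p kappa, in_Lambda p kappa',
      bijection_on (Lambda p kappa) (Lambda p kappa') f, f kappa = kappa'
    & [\/ equiv_move p kappa b b' f, equiv_first p kappa b b' f
        | equiv_last p kappa b b' f]].

Definition proj_cap p G (kappa kappa' : weight G) (b b' : bool)
    (x y : nat) : Prop :=
  [/\ (x, y) \in cocap_diagram p G (diag p b kappa) Cap,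
      neighbours p G x y
    & diag p b' kappa' =1 [eta diag p b kappa with x |-> empty, y |-> cross] \/
      (~~ (is_Sp G && (x == 0%N)) /\
       diag p b' kappa' =1 [eta diag p b kappa with x |-> cross, y |-> empty])].

Definition proj_curl p G (kappa kappa' : weight G) (b b' : bool)
    (x y : nat) : Prop :=
  [/\ is_Sp G, x = 0%N /\ y = 1%N,
      (x, y) \in curls (cocap_diagram p G (diag p b kappa))
    & diag p b' kappa' =1 [eta diag p b kappa with x |-> empty, y |-> cross]].

(* k is the kind of the distinguished edge (x, y); the curl of the second case
   lies to the left of the wall, since node 0 always does. *)
Definition projection p G (kappa kappa' : weight G) (b b' : bool)
    (k : kind) (x y : nat) : Prop :=
  [/\ in_Lambda p kappa, in_Lambda p kappa'
    & (k = Cap /\ proj_cap p kappa kappa' b b' x y) \/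
      (k = LeftCurl /\ proj_curl p kappa kappa' b b' x y)].

(* nu lies in Lambda-tilde and is sent to nu' in Lambda' *)
Definition projects p G (kappa kappa' : weight G) (b b' : bool)
    (k : kind) (x y : nat) (nu nu' : weight G) : Prop :=
  [/\ Lambda p kappa nu, Lambda p kappa' nu',
      edge_oriented (diag p b nu) k (x, y)
    & diag p b' nu' =1 [eta diag p b nu with x |-> diag p b' kappa' x,
                                             y |-> diag p b' kappa' y]].

(* nu = nu^+: of the two preimages of nu', the one on which the edge is
   anti-clockwise (a cap: down up, a curl: up up). *)
Definition plus_lift p G (kappa kappa' : weight G) (b b' : bool)
    (k : kind) (x y : nat) (nu nu' : weight G) : Prop :=
  projects p kappa kappa' b b' k x y nu nu' /\
  carries (diag p b nu) (anticlockwise k) (x, y).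

Definition minus_lift p G (kappa kappa' : weight G) (b b' : bool)
    (k : kind) (x y : nat) (nu nu' : weight G) : Prop :=
  projects p kappa kappa' b b' k x y nu nu' /\
  carries (diag p b nu) (clockwise k) (x, y).

Definition is_lift p G (kappa kappa' : weight G) (b b' : bool)
    (k : kind) (x y : nat) (nu : weight G) : Prop :=
  exists nu', plus_lift p kappa kappa' b b' k x y nu nu' \/
              minus_lift p kappa kappa' b b' k x y nu nu'.

(* Main.v *)
(* The entries of lambda + rho that carry arrows are the unique representatives
   of the arrow labels in a window of p consecutive integers attached to the
   wall.  Hence a step of the order inside Lambda(s) only reverses the two arrows
   at a pair of nodes on one side of the wall, from anti-clockwise to clockwise,
   and conversely every such reversal is a step and stays in the H-orbit.
   Going down in the order, initial parts of a side gain ups and final parts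
   lose downs, while the parity of the number of ups on each side is preserved
   (for Sp_n).
   It follows that, for mu below lambda with c_{lambda mu} oriented, the two
   weights agree at all nodes not on a cap or curl of c_lambda; conversely this
   agreement together with the orientation gives mu below lambda by reversing
   one cap or curl after the other.  So d_{lambda mu} depends on the two arrow
   diagrams only, and e_{lambda mu} is the same function of the diagrams of mu
   and lambda with all arrows reversed.
   What remains is to compare cap diagrams before and after relabelling two
   nodes (E1), reversing the outermost arrow of a side (E2, E3), or removing a
   cap or curl between neighbours (P1, P2).  If d_{lambda^+ mu} is
   nonzero, then reversing, in lambda', the remaining caps and curls at which mu
   differs from lambda gives a weight lifting to mu, so mu is of the form nu^+ or
   nu^-; dually for e. *)
Require Import Defs.
From mathcomp Require Import all_boot all_order all_fingroup all_algebra.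
From mathcomp Require Import boolp mpoly zify.
Import GRing.Theory.

Set Implicit Arguments.
Unset Strict Implicit.
Unset Printing Implicit Defensive.

(** * Cap diagrams *)

(** Steps of the order cannot leave [Lambda(s)] because the reflected weight must have distinct
    entries (non-vanishing Weyl character for GL_n, distinct positive entries for Sp_n). The entries
    of [lambda + rho] without arrows are consecutive integers filling the gap between the two
    windows, or below the only window for Sp_n, so a reflected entry cannot land among them and
    stays in a window. The agreement of two weights off the edges is a counting argument. An
    oriented cap carries one up and one down in both weights, so the inequalities for initial and
    final parts of a side pass to the unconnected nodes, where one weight is already extremal and
    they become equalities. Curls use up all but at most one of the remaining nodes; the parity of
    the ups fixes that one. The scan of a side lists the edges in an order that changes under
    reversals and removals. For these, cap diagrams are compared by the number of edges of each kind
    with an arbitrary property, not as lists. Scanning from left to right also breaks the symmetry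
    of the two ends, so that (E2) and (E3) need different arguments. *)

Lemma singleP (c : content) : reflect (c = up \/ c = down) (single c).
Proof. by apply: (iffP orP) => -[/eqP|/eqP]; auto. Qed.

Lemma single_opp (c : content) : single (opp_arrow c) = single c.
Proof. by case: c => -[] []. Qed.

Lemma opp_arrowK : involutive opp_arrow.
Proof. by case. Qed.

Lemma opp_up (c : content) : (opp_arrow c == up) = (c == down).
Proof. by case: c => -[] []. Qed.

Lemma opp_nonsingle (c : content) : ~~ single c -> opp_arrow c = c.
Proof. by case: c => -[] []. Qed.

Definition opp_diagram (D : diagram) : diagram := fun k => opp_arrow (D k).

Lemma opp_diagramK D : opp_diagram (opp_diagram D) = D.
Proof. by apply/funext => k; rewrite /opp_diagram opp_arrowK. Qed.

Definition singles (D : diagram) (t : seq nat) := [seq k <- t | single (D k)].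

(** * Matching the single arrows of one side by a stack *)

Section Matching.

Implicit Types (D E : diagram) (u r t : seq nat).

Lemma match_step D u y r :
  match_arrows D u (y :: r) =
  if u is x :: u' then
    if (D x == down) && (D y == up) then
      ((x, y) :: (match_arrows D u' r).1, (match_arrows D u' r).2)
    else match_arrows D (y :: u) r
  else match_arrows D (y :: u) r.
Proof. by case: u. Qed.

(** The stack is the whole state of the scan, so the scan of [r2] starts from the nodes that [r1]
    leaves unconnected, reversed because the stack has its last node on top. *)
Lemma match_cat D u r1 r2 :
  let m1 := match_arrows D u r1 in
  let m2 := match_arrows D (rev m1.2) r2 in
  match_arrows D u (r1 ++ r2) = (m1.1 ++ m2.1, m2.2).
Proof.
elim: r1 u => [|y r1 IH] u /=; first by rewrite revK -surjective_pairing.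
case: u => [|x u]; first exact: IH.
by case: ifP => _; rewrite IH.
Qed.

Lemma match_eq D E u r :
  {in u ++ r, D =1 E} -> match_arrows D u r = match_arrows E u r.
Proof.
elim: r u => [|y r IH] // u eqDE; rewrite !match_step.
have push : match_arrows D (y :: u) r = match_arrows E (y :: u) r.
  apply: IH => z z_in; apply: eqDE.
  by move: z_in; rewrite !(mem_cat, inE) -orbA orbCA.
case: u eqDE push => [|x u] eqDE push //.
rewrite !eqDE ?inE ?eqxx ?mem_cat ?inE ?eqxx ?orbT //.
rewrite push IH // => z; rewrite mem_cat => /orP[] z_in; apply: eqDE;
  by rewrite mem_cat !inE z_in ?orbT.
Qed.

(** Only a down on top of the stack can be closed by a cap. A part [s] whose top is not a down is
    therefore frozen for the rest of the scan. *)
Lemma match_inert D u s r :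
  (if s is x :: _ then D x != down else true) ->
  match_arrows D (u ++ s) r =
  ((match_arrows D u r).1, rev s ++ (match_arrows D u r).2).
Proof.
move=> inert; elim: r u => [|y r IH] u /=; first by rewrite rev_cat.
case: u => [|x u] /=; last by case: ifP => _; rewrite -?IH //= IH.
case: s inert IH => [|x s] inert IH; first by rewrite -surjective_pairing.
by rewrite (negbTE inert) /= (IH [:: y]).
Qed.

Definition nodes (m : seq (nat * nat)) := unzip1 m ++ unzip2 m.

(** Each node is popped into exactly one cap or left over. This is the source of the counting
    arguments below and of the fact that no node lies on two edges. *)
Lemma match_nodes D u r :
  let m := match_arrows D u r in perm_eq (nodes m.1 ++ m.2) (u ++ r).
Proof.
apply/seq.permP => a /=; elim: r u => [|y r IH] u.
  by rewrite /= cats0 count_rev.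
have push : count a (let m := match_arrows D (y :: u) r in nodes m.1 ++ m.2) =
    count a (u ++ y :: r).
  by rewrite IH !count_cat /=; lia.
rewrite match_step; case: u push => [|x u] push //; case: ifP => _ //=.
by move: (IH u); rewrite !count_cat /=; lia.
Qed.

Lemma match_cap_sub D u r e :
  e \in (match_arrows D u r).1 ->
  [/\ D e.1 = down, D e.2 = up & subseq [:: e.1; e.2] (rev u ++ r)].
Proof.
elim: r u => [|y r IH] u //; rewrite match_step.
have push : e \in (match_arrows D (y :: u) r).1 ->
    [/\ D e.1 = down, D e.2 = up & subseq [:: e.1; e.2] (rev u ++ y :: r)].
  by case/IH=> De1 De2; rewrite rev_cons cat_rcons.
case: u push => [|x u] push //; case: ifP => [/andP[/eqP Dx /eqP Dy]|_] //=.
rewrite inE => /orP[/eqP-> /=|/IH[De1 De2 sub]].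
  split=> //; rewrite rev_cons cat_rcons.
  apply: (subseq_trans _ (suffix_subseq _ _)).
  by rewrite /= !eqxx sub0seq.
split=> //; apply: (subseq_trans sub); rewrite rev_cons cat_rcons.
rewrite cat_subseq //; apply: (@subseq_trans _ (y :: r)); exact: subseq_cons.
Qed.

Lemma match_unconnected_sub D u r :
  subseq (match_arrows D u r).2 (rev u ++ r).
Proof.
elim: r u => [|y r IH] u; first by rewrite cats0.
have push : subseq (match_arrows D (y :: u) r).2 (rev u ++ y :: r).
  by have:= IH (y :: u); rewrite rev_cons cat_rcons.
rewrite match_step; case: u push => [|x u] push //; case: ifP => _ //=.
apply: (subseq_trans (IH u)); rewrite rev_cons cat_rcons.
rewrite cat_subseq //; apply: (@subseq_trans _ (y :: r)); exact: subseq_cons.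
Qed.

(** The ups left over by [r1] freeze the stack, so [r2] is scanned as if nothing preceded it. *)
Lemma match_up_down D r r1 r2 :
  r = r1 ++ r2 -> all (fun k => D k == up) (match_arrows D [::] r1).2 ->
  match_arrows D [::] r =
  ((match_arrows D [::] r1).1 ++ (match_arrows D [::] r2).1,
   (match_arrows D [::] r1).2 ++ (match_arrows D [::] r2).2).
Proof.
move=> -> ups; rewrite match_cat /= -{1}[rev _]cat0s match_inert ?revK //.
case E: (rev _) => [|x s] //.
by move: ups; rewrite -all_rev E => /= /andP[/eqP-> _].
Qed.

(** Sharper than the unconnected arrows being ups followed by downs: the side itself is cut, with no
    cap across the cut. When a node is added on the right, a down joins the second part; an up
    either caps the last unconnected down there or, if there is none, makes everything the first
    part. *)
Lemma match_split D r :
  all (fun k => single (D k)) r ->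
  exists r1 r2, [/\ r = r1 ++ r2,
    all (fun k => D k == up) (match_arrows D [::] r1).2 &
    all (fun k => D k == down) (match_arrows D [::] r2).2].
Proof.
elim/last_ind: r => [|r z IH]; first by exists [::], [::].
rewrite all_rcons => /andP[/singleP Dz /IH[r1 [r2 [Er ups downs]]]] {IH}.
case: Dz => Dz; last first.
  exists r1, (rcons r2 z); rewrite -rcons_cat -Er; split=> //.
  rewrite -cats1 match_cat match_step /=.
  case E: (rev _) => [|x s] /=; first by rewrite Dz.
  rewrite Dz andbF /= rev_cons all_rcons Dz eqxx /= all_rev.
  by rewrite -all_rev E in downs.
case E: (rev (match_arrows D [::] r2).2) => [|x s].
  exists (rcons r z), [::]; rewrite cats0; split=> //.
  rewrite -cats1 match_cat match_step /=.
  have -> : (match_arrows D [::] r).2 = (match_arrows D [::] r1).2.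
    rewrite (match_up_down Er ups) /=.
    by rewrite -(revK (match_arrows D [::] r2).2) E cats0.
  case E1: (rev _) => [|x1 s1] /=; first by rewrite Dz.
  move: ups; rewrite -all_rev E1 /= => /andP[/eqP Dx1 all_s1].
  by rewrite Dx1 /= rev_cons all_rcons Dz /= rev_cons all_rcons all_rev Dx1.
exists r1, (rcons r2 z); rewrite -rcons_cat -Er; split=> //.
rewrite -cats1 match_cat match_step /= E.
move: downs; rewrite -all_rev E /= => /andP[-> all_s].
by rewrite Dz eqxx /= all_rev.
Qed.

End Matching.

(** * Edges of a cap diagram and ways to count them *)

Section Sides.

Variables (p : nat) (G : group_data).

Definition legal (k : kind) (e : nat * nat) : bool :=
  match k with
  | Cap => subseq [:: e.1; e.2] (sides p G).1 ||
           subseq [:: e.1; e.2] (sides p G).2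
  | LeftCurl => is_Sp G && subseq [:: e.1; e.2] (sides p G).1
  | RightCurl => is_Sp G && subseq [:: e.1; e.2] (sides p G).2
  end.

Lemma pair_up_nodes t :
  exists2 t', (size t' <= 1)%N & perm_eq (nodes (pair_up t) ++ t') t.
Proof.
have [n] := ubnP (size t); elim: n t => // n IH [|x [|y t]] /=.
- by exists [::].
- by exists [:: x].
rewrite !ltnS => le_tn; have [t' le_t' perm_t'] := IH t (ltnW le_tn).
exists t' => //; apply/seq.permP => a; move/seq.permP/(_ a): perm_t'.
by rewrite /nodes !count_cat /= !count_cat /=; lia.
Qed.

Lemma pair_up_sub t e : e \in pair_up t -> subseq [:: e.1; e.2] t.
Proof.
have [n] := ubnP (size t); elim: n t => // n IH [|x [|y t]] //.
rewrite [size _]/= [pair_up _]/= !ltnS inE => le_tn /orP[/eqP-> /=|].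
  by rewrite !eqxx sub0seq.
move/(IH t (ltnW le_tn)) => sub; apply: (@subseq_trans _ t) => //.
by apply: (@subseq_trans _ (y :: t)); apply: subseq_cons.
Qed.

Lemma pair_up_all (a : pred nat) t e :
  all a t -> e \in pair_up t -> a e.1 /\ a e.2.
Proof.
move=> /allP all_a /pair_up_sub/mem_subseq sub.
by split; apply/all_a/sub; rewrite !inE eqxx ?orbT.
Qed.

(** Caps are drawn at a down followed by an up, left curls at two ups and right curls at two downs,
    so every edge is anti-clockwise on the diagram that produced it. *)
Lemma cap_diagram_edge D k e :
  e \in cap_diagram p G D k -> legal k e /\ carries D (anticlockwise k) e.
Proof.
have sub_side t x : subseq x (singles D t) -> subseq x t.
  by move/subseq_trans; apply; apply: filter_subseq.
case: k; rewrite /legal /carries /=.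
- rewrite mem_cat => /orP[] /match_cap_sub[De1 De2] /sub_side /= ->;
    by rewrite De1 De2 ?orbT.
- case: (is_Sp G) => // e_in.
  have [/eqP-> /eqP->] := pair_up_all (filter_all _ _) e_in; split=> //.
  apply: sub_side; apply: (subseq_trans _ (match_unconnected_sub D [::] _)).
  exact: (subseq_trans (pair_up_sub e_in) (filter_subseq _ _)).
- case: (is_Sp G) => // /mapP[[y x] e_in -> /=].
  have := pair_up_all _ e_in (a := fun k => D k == down).
  rewrite all_rev filter_all => /(_ isT)[/eqP-> /eqP->]; split=> //.
  apply: sub_side; apply: (subseq_trans _ (match_unconnected_sub D [::] _)).
  have := pair_up_sub e_in; rewrite -subseq_rev revK => sub.
  exact: (subseq_trans sub (filter_subseq _ _)).
Qed.

(** Two cap diagrams with equal tallies for all [a] have, for each kind, the same edges as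
    multisets; the order in which the scan lists them does not enter. *)
Definition tally (C : cc_diagram) (a : kind -> pred (nat * nat)) : nat :=
  (\sum_(k <- kinds) count (a k) (C k))%N.

Lemma tallyE C a : tally C a =
  (count (a Cap) (C Cap) + count (a LeftCurl) (C LeftCurl)
   + count (a RightCurl) (C RightCurl))%N.
Proof. by rewrite /tally /kinds !big_cons big_nil addn0 addnA. Qed.

Lemma eq_tally C a b : (forall k e, a k e = b k e) -> tally C a = tally C b.
Proof. by move=> eqab; rewrite !tallyE !(eq_count (eqab _)). Qed.

Lemma tally_gt0 C a : (0 < tally C a)%N <-> exists k e, e \in C k /\ a k e.
Proof.
rewrite tallyE !addn_gt0 -!has_count; split.
  by case/orP=> [/orP[]|] /hasP[e e_in a_e]; [exists Cap|exists LeftCurl|exists RightCurl]; exists e.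
by case=> -[] [e [e_in a_e]]; apply/orP;
  [left; apply/orP; left | left; apply/orP; right | right];
  apply/hasP; exists e.
Qed.

Lemma tally_eq0 C a : tally C a = 0%N <-> forall k e, e \in C k -> ~~ a k e.
Proof.
split=> [tally0 k e e_in|none].
  apply/negP=> a_e; suff: (0 < tally C a)%N by rewrite tally0.
  by apply/tally_gt0; exists k, e.
apply/eqP; rewrite -leqn0 leqNgt; apply/negP=> /tally_gt0[k [e [/none]]].
by move/negP.
Qed.

Lemma orientedP C D :
  oriented C D <-> forall k e, e \in C k -> edge_oriented D k e.
Proof.
rewrite /oriented /= andbT; split=> [/and3P[/allP h1 /allP h2 /allP h3] [] //|h].
by apply/and3P; split; apply/allP => e; apply: h.
Qed.

Lemma end_nodesP C k :
  k \in end_nodes C <->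
  exists i e, e \in C i /\ (e.1 == k) || (e.2 == k).
Proof.
rewrite /end_nodes mem_cat /curls; split.
  by case/orP=> /mapP[e]; rewrite !mem_cat => /or3P[] e_in ->;
     do 2!eexists; split; eauto; rewrite eqxx ?orbT.
case=> i [e [e_in]].
have {}e_in : e \in C Cap ++ C LeftCurl ++ C RightCurl.
  by rewrite !mem_cat; case: i e_in => ->; rewrite ?orbT.
by case/orP=> /eqP<-; rewrite map_f ?orbT.
Qed.

End Sides.

(** * Reversing anti-clockwise pairs, and agreement off the edges *)

Section Moves.

Variables (p : nat) (G : group_data).
Implicit Types (D E F : diagram) (e : nat * nat) (t r : seq nat).

Definition flip D e : diagram :=
  fun k => if (k == e.1) || (k == e.2) then opp_arrow (D k) else D k.

(** The effect of a step of the order on diagrams. Any two arrows on one side may be reversed, not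
    only those joined by an edge of the cap diagram. *)
Definition move D E : Prop :=
  exists k e, [/\ legal p G k e, carries D (anticlockwise k) e & E = flip D e].

Inductive reach D : diagram -> Prop :=
| reach_refl : reach D D
| reach_step E F : reach D E -> move E F -> reach D F.

Lemma flipK e : involutive (flip^~ e).
Proof.
by move=> D; apply/funext => k; rewrite /flip; case: (_ || _); rewrite ?opp_arrowK.
Qed.

Lemma opp_flip D e : opp_diagram (flip D e) = flip (opp_diagram D) e.
Proof. by apply/funext => k; rewrite /flip /opp_diagram; case: ifP. Qed.

Lemma single_flip D e k : single (flip D e k) = single (D k).
Proof. by rewrite /flip; case: ifP; rewrite ?single_opp. Qed.

Lemma carries_opp_cw D k e :
  carries (opp_diagram D) (clockwise k) e = carries D (anticlockwise k) e.
Proof.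
rewrite /carries /opp_diagram.
by case: k; case: (D e.1) => -[] []; case: (D e.2) => -[] [].
Qed.

Lemma carries_opp_acw D k e :
  carries (opp_diagram D) (anticlockwise k) e = carries D (clockwise k) e.
Proof. by rewrite -carries_opp_cw opp_diagramK. Qed.

Lemma carries_single D k e :
  carries D (anticlockwise k) e -> single (D e.1) /\ single (D e.2).
Proof. by case: k => /eqP[-> ->]. Qed.

Lemma edge_oriented_opp D k e :
  edge_oriented (opp_diagram D) k e = edge_oriented D k e.
Proof. by rewrite /edge_oriented carries_opp_cw carries_opp_acw orbC. Qed.

Lemma legal_sub k e : legal p G k e ->
  subseq [:: e.1; e.2] (sides p G).1 \/ subseq [:: e.1; e.2] (sides p G).2.
Proof. by case: k => /=; [move/orP | case/andP | case/andP]; auto. Qed.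

Definition ups D : pred nat := fun k => D k == up.
Definition downs D : pred nat := fun k => D k == down.

(** Lost and gained ups are written on opposite sides, so that no subtraction of natural numbers
    occurs. The list [r] will be an initial or final part of a side and may contain any of the two
    ends. *)
Lemma count_flip D x y r : uniq r -> x != y -> single (D x) -> single (D y) ->
  (count (ups (flip D (x, y))) r + ((x \in r) && (D x == up))
     + ((y \in r) && (D y == up)) =
   count (ups D) r + ((x \in r) && (D x == down))
     + ((y \in r) && (D y == down)))%N.
Proof.
move=> + neq_xy Dx Dy; elim: r => //= z r IH /andP[z_notin /IH{}IH].
move: (count (ups (flip _ _)) r) (count (ups D) r) IH => m n IH.
rewrite !inE /ups /flip /= !(eq_sym _ z).
case: (eqVneq z x) z_notin => [->|_] /= z_notin.
  rewrite (negbTE z_notin) (negbTE neq_xy) /= in IH *; rewrite opp_up; lia.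
case: (eqVneq z y) z_notin => [->|_] /= z_notin; last by lia.
rewrite (negbTE z_notin) /= in IH *; rewrite opp_up; lia.
Qed.

Lemma count_ups_downs D r : all (fun k => single (D k)) r ->
  (count (ups D) r + count (downs D) r = size r)%N.
Proof.
elim: r => //= z r IH /andP[Dz /IH <-].
by have [Ez|Ez] := singleP _ Dz; rewrite {1}/ups {1}/downs Ez /=; lia.
Qed.

Lemma subseq_notin_cat x t r1 r2 :
  x \notin r1 -> subseq (x :: t) (r1 ++ r2) -> subseq (x :: t) r2.
Proof.
elim: r1 => //= y r1 IH; rewrite inE negb_or => /andP[/negbTE ne_xy /IH].
by rewrite eq_sym in ne_xy; rewrite eq_sym ne_xy.
Qed.

Lemma subseq_pair_prefix x y r1 r2 : uniq (r1 ++ r2) ->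
  subseq [:: x; y] (r1 ++ r2) -> y \in r1 -> x \in r1.
Proof.
move=> uniq_r sub y_in; apply/negPn/negP=> x_notin.
have /mem_subseq/(_ y) := subseq_notin_cat x_notin sub.
rewrite !inE eqxx orbT => /(_ isT) y_in2.
by move: uniq_r; rewrite cat_uniq => /and3P[_ /hasPn/(_ y y_in2)/negP].
Qed.

(* Moving an up arrow to the left, or turning two downs into ups, enlarges the
   number of ups in every initial part of a side; dually for downs. *)
Definition prefix_le t D E := forall r1 r2, singles D t = r1 ++ r2 ->
  (count (ups D) r1 <= count (ups E) r1)%N.
Definition suffix_le t D E := forall r1 r2, singles D t = r1 ++ r2 ->
  (count (downs D) r2 <= count (downs E) r2)%N.
Definition same_parity t D E :=
  odd (count (ups D) (singles D t)) = odd (count (ups E) (singles D t)).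

Lemma count_ups_flip D k x y r : uniq r -> x != y ->
    carries D (anticlockwise k) (x, y) ->
  match k with
  | Cap => count (ups (flip D (x, y))) r + (y \in r) = count (ups D) r + (x \in r)
  | LeftCurl =>
      count (ups (flip D (x, y))) r + ((x \in r) + (y \in r)) = count (ups D) r
  | RightCurl =>
      count (ups (flip D (x, y))) r = count (ups D) r + ((x \in r) + (y \in r))
  end.
Proof.
move=> uniq_r neq_xy acw; have [/= Dx Dy] := carries_single acw.
have := count_flip uniq_r neq_xy Dx Dy.
by case: k acw => /eqP[-> ->] /=; rewrite ?andbT ?andbF ?addn0 ?addnA.
Qed.

Lemma count_downs_flip D k x y r : uniq r -> all (fun z => single (D z)) r ->
    x != y -> carries D (anticlockwise k) (x, y) ->
  match k with
  | Cap =>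
      count (downs (flip D (x, y))) r + (x \in r) = count (downs D) r + (y \in r)
  | LeftCurl => count (downs (flip D (x, y))) r =
                count (downs D) r + ((x \in r) + (y \in r))
  | RightCurl => count (downs (flip D (x, y))) r + ((x \in r) + (y \in r)) =
                 count (downs D) r
  end.
Proof.
move=> uniq_r all_r neq_xy acw; have := count_ups_flip uniq_r neq_xy acw.
have all_r' : all (fun z => single (flip D (x, y) z)) r.
  by apply: sub_all all_r => z; rewrite single_flip.
move: (count_ups_downs all_r) (count_ups_downs all_r').
move: (count _ r) (count _ r) (count (ups _) r) (count (downs _) r) (x \in r : nat)
  (y \in r : nat) (size r).
by clear; case: k; lia.
Qed.

(** An initial part containing the right end of the pair contains the left end, and dually for final
    parts. Hence reversing a cap respects both inequalities. A left curl loses two ups and spoils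
    the one for initial parts, a right curl loses two downs and spoils the one for final parts. The
    number of ups changes by 0 or 2. *)
Lemma flip_in t D k e : uniq t -> subseq [:: e.1; e.2] t ->
  carries D (anticlockwise k) e ->
  [/\ if k is LeftCurl then True else prefix_le t D (flip D e),
      if k is RightCurl then True else suffix_le t D (flip D e)
    & same_parity t D (flip D e)].
Proof.
case: e => x y uniq_t sub acw; have [Dx Dy] := carries_single acw.
have {}sub : subseq [:: x; y] (singles D t) by rewrite subseq_filter /= Dx Dy.
have uniq_r : uniq (singles D t) by rewrite filter_uniq.
have neq_xy : x != y.
  by have := subseq_uniq sub uniq_r; rewrite /= inE andbT.
have x_in : x \in singles D t by apply: (mem_subseq sub); rewrite !inE eqxx.
have y_in : y \in singles D t by apply: (mem_subseq sub); rewrite !inE eqxx orbT.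
have split_r r1 r2 : singles D t = r1 ++ r2 ->
    [/\ uniq r1, uniq r2, all (fun z => single (D z)) r2, ((y \in r1) <= (x \in r1))%N
      & ((x \in r2) <= (y \in r2))%N].
  move=> Er; have := filter_all (fun k => single (D k)) t.
  rewrite -/(singles D t) Er all_cat => /andP[_ ->].
  rewrite Er in sub uniq_r x_in y_in.
  have pre := subseq_pair_prefix uniq_r sub.
  have := uniq_r; rewrite cat_uniq => /and3P[-> /hasPn disj ->]; split=> //.
    by case: (y \in r1) pre => // ->.
  case: (boolP (x \in r2)) => // /disj /= x_r1.
  by move: y_in; rewrite mem_cat; case: (y \in r1) pre x_r1 => [->|] // _ _ /= ->.
split.
- case: k acw => // acw r1 r2 /split_r[/count_ups_flip/(_ neq_xy acw) c1 _ _ le1 _].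
    by rewrite -(leq_add2r (y \in r1)) c1 leq_add2l.
  by rewrite c1 leq_addr.
- case: k acw => // acw r1 r2 /split_r[_ u2 s2 _ le2];
    have c2 := count_downs_flip u2 s2 neq_xy acw.
    by rewrite -(leq_add2r (x \in r2)) c2 leq_add2l.
  by rewrite c2 leq_addr.
have := count_ups_flip uniq_r neq_xy acw; rewrite /same_parity x_in y_in.
case: k acw => _; first by move/addIn=> ->.
  by move <-; rewrite oddD addbF.
by move=> ->; rewrite oddD addbF.
Qed.

Lemma flip_out t D x y : x \notin t -> y \notin t -> {in t, flip D (x, y) =1 D}.

move=> xt yt z zt; rewrite /flip /=; case: eqP => [Ez|_] /=.
  by rewrite -Ez zt in xt.
by case: eqP => // Ez; rewrite -Ez zt in yt.
Qed.



Lemma oriented_counts E c : all (edge_oriented E Cap) c ->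
  count (ups E) (nodes c) = size c /\ count (downs E) (nodes c) = size c.
Proof.
elim: c => //= e c IH /andP[Ee /IH[]]; rewrite /nodes !count_cat /= => IHu IHd.
by case/orP: Ee => /eqP[E1 E2]; rewrite /ups /downs in IHu IHd *; rewrite E1 E2 /=;
   lia.
Qed.

(** Cut the side by [match_split]. The caps inside each part contribute equally many ups, and downs,
    for [D] and [E], so the inequality over the first part compares the unconnected nodes only.
    There [D] has nothing but ups, so [E] has too; likewise for the downs of the second part. The
    parity clause serves the part whose inequality is spoiled by curls. *)
Lemma side_agree t D E : (forall k, single (E k) = single (D k)) ->
  let m := side_match D t in
  all (edge_oriented E Cap) m.1 ->
  exists w1 w2, [/\ m.2 = w1 ++ w2, all (ups D) w1 /\ all (downs D) w2,
    prefix_le t D E -> all (ups E) w1, suffix_le t D E -> all (downs E) w2 &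
    same_parity t D E -> odd (count (ups E) m.2) = odd (size w1)].
Proof.
move=> singleE /=; rewrite /side_match -/(singles D t).
have [r1 [r2 [Er up1 down2]]] := match_split (filter_all (fun k => single (D k)) t).
rewrite -/(singles D t) in Er; rewrite (match_up_down Er up1) /= all_cat.
have orient r : all (edge_oriented D Cap) (match_arrows D [::] r).1.
  apply/allP => e /match_cap_sub[De1 De2 _].
  by rewrite /edge_oriented /carries De1 De2 orbT.
set w1 := (match_arrows D [::] r1).2; set w2 := (match_arrows D [::] r2).2.
case/andP=> /oriented_counts[u1 d1] /oriented_counts[u2 d2].
have [Du1 Dd1] := oriented_counts (orient r1).
have [Du2 Dd2] := oriented_counts (orient r2).
have cnt r a : count a r = (count a (nodes (match_arrows D [::] r).1)
    + count a (match_arrows D [::] r).2)%N.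
  by rewrite -count_cat (seq.permP (match_nodes D [::] r)).
exists w1, w2; split=> //.
- move/(_ _ _ Er); rewrite !(cnt r1) u1 Du1 leq_add2l all_count => le_w1.
  move: up1; rewrite all_count => /eqP up1; rewrite eqn_leq count_size /=.
  by rewrite -up1.
- move/(_ _ _ Er); rewrite !(cnt r2) d2 Dd2 leq_add2l all_count => le_w2.
  move: down2; rewrite all_count => /eqP down2; rewrite eqn_leq count_size /=.
  by rewrite -down2.
rewrite /same_parity Er !count_cat !(cnt r1) !(cnt r2) u1 u2 Du1 Du2 -/w1 -/w2.
have -> : count (ups D) w1 = size w1 by apply/eqP; rewrite -all_count.
have -> : count (ups D) w2 = 0%N.
  by apply/eqP; rewrite -leqn0 leqNgt -has_count -all_predC;
     apply: sub_all down2 => k /eqP; rewrite /ups /= => ->.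
move: (count _ w1) (count _ w2) (size w1) (size _) (size _); clear; lia.
Qed.

(** The pairs contribute evenly to the count, so its parity determines [a] at the one entry that
    [pair_up] may leave over. *)
Lemma pair_up_agree (a : pred nat) w k :
  (forall e, e \in pair_up w -> a e.1 = a e.2) ->
  odd (count a w) = odd (size w) ->
  k \in w -> k \notin nodes (pair_up w) -> a k.
Proof.
move=> eqa; have [t' le_t' perm_w] := pair_up_nodes w.
rewrite -(perm_mem perm_w) mem_cat -(seq.permP perm_w) -(perm_size perm_w).
have evn : odd (count a (nodes (pair_up w))) = false.
  elim: (pair_up w) eqa => //= e s IH eqa.
  have := IH (fun f f_in => eqa f (mem_behead (s := e :: s) f_in)).
  rewrite /nodes !count_cat /= eqa ?mem_head //.
  by move: (count _ _) (count _ _) (a _); clear; lia.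
rewrite count_cat size_cat !oddD evn /nodes size_cat size_map size_map addnn odd_double.
rewrite /= => odd_t /orP[->//|k_in] _.
by case: t' le_t' odd_t k_in {perm_w} => [|z [|]] //= _; rewrite inE addn0 => + /eqP->; case: (a z).
Qed.

Lemma prefix_le_trans t D E F : singles D t = singles E t ->
  prefix_le t D E -> prefix_le t E F -> prefix_le t D F.
Proof.
move=> eqDE leDE leEF r1 r2 Er; apply: leq_trans (leDE _ _ Er) _.
by apply: leEF; rewrite -eqDE Er.
Qed.

Lemma suffix_le_trans t D E F : singles D t = singles E t ->
  suffix_le t D E -> suffix_le t E F -> suffix_le t D F.
Proof.
move=> eqDE leDE leEF r1 r2 Er; apply: leq_trans (leDE _ _ Er) _.
by apply: (leEF r1); rewrite -eqDE Er.
Qed.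

Lemma eq_side_stats t D E : {in t, D =1 E} ->
  [/\ prefix_le t D E, suffix_le t D E & same_parity t D E].
Proof.
move=> eqDE; have eq_count r (a b : pred nat) : {subset r <= singles D t} ->
    {in t, a =1 b} -> count a r = count b r.
  move=> sub eqab; apply: eq_in_count => k /sub; rewrite mem_filter => /andP[_].
  exact: eqab.
have eqs c : {in t, (fun k => D k == c) =1 (fun k => E k == c)}.
  by move=> k /eqDE ->.
split; first 2 last.
- by congr odd; apply: eq_count (eqs up).
- move=> r1 r2 Er; rewrite (eq_count r1 _ _ _ (eqs up)) // => k k_in.
  by rewrite Er mem_cat k_in.
- move=> r1 r2 Er; rewrite (eq_count r2 _ _ _ (eqs down)) // => k k_in.
  by rewrite Er mem_cat k_in orbT.
Qed.

(** Going down, curls left of the wall turn ups into downs and curls right of it downs into ups. So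
    one inequality survives on each side, and both do for GL_n, which has no curls. *)
Lemma move_stats D E : uniq ((sides p G).1 ++ (sides p G).2) -> move D E ->
  [/\ suffix_le (sides p G).1 D E /\ prefix_le (sides p G).2 D E,
      same_parity (sides p G).1 D E /\ same_parity (sides p G).2 D E &
      ~~ is_Sp G -> prefix_le (sides p G).1 D E /\ suffix_le (sides p G).2 D E].
Proof.
rewrite cat_uniq => /and3P[uniqL disj uniqR] [k [[x y] [leg acw ->{E}]]].
have stay t : x \notin t -> y \notin t ->
    [/\ prefix_le t D (flip D (x, y)), suffix_le t D (flip D (x, y))
      & same_parity t D (flip D (x, y))].
  by move=> xt yt; apply: eq_side_stats => z /(flip_out _ xt yt) ->.
have notin t1 t2 : ~~ has (mem t1) t2 -> subseq [:: x; y] t1 ->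
    x \notin t2 /\ y \notin t2.
  move=> /hasPn dis /mem_subseq sub; split; apply/negP => /dis /negP; apply;
  by apply: sub; rewrite !inE eqxx ?orbT.
have disj' : ~~ has (mem (sides p G).2) (sides p G).1 by rewrite has_sym.
have [sub|sub] := legal_sub leg.
- have [xR yR] := notin _ _ disj sub; have [preR sufR parR] := stay _ xR yR.
  have [preL sufL parL] := flip_in uniqL sub acw.
  split; [split=> // | by [] | by case: k leg acw preL {sufL} => //= /andP[->]].
  case: k leg acw preL sufL => //= /andP[_ subR] _ _ _.
  by move: xR; rewrite (mem_subseq subR) ?inE ?eqxx.
- have [xL yL] := notin _ _ disj' sub; have [preL sufL parL] := stay _ xL yL.
  have [preR sufR parR] := flip_in uniqR sub acw.
  split; [split=> // | by [] | by case: k leg acw sufR {preR} => //= /andP[->]].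
  case: k leg acw preR sufR => //= /andP[_ subL] _ _ _.
  by move: xL; rewrite (mem_subseq subL) ?inE ?eqxx.
Qed.

Lemma move_off D E k : move D E ->
  ~~ single (D k) || (k \notin (sides p G).1 ++ (sides p G).2) -> E k = D k.
Proof.
case=> i [[x y] [leg acw ->]] off; have [/= Dx Dy] := carries_single acw.
have in_sides z : z \in [:: x; y] -> z \in (sides p G).1 ++ (sides p G).2.
  by move=> z_in; rewrite mem_cat; case: (legal_sub leg) => /mem_subseq -> //;
     rewrite orbT.
rewrite /flip /=; case: eqP off => [->|_] /=; first by rewrite Dx in_sides // inE eqxx.
by case: eqP => // ->; rewrite Dy in_sides // !inE eqxx orbT.
Qed.

Lemma reach_stats D E : uniq ((sides p G).1 ++ (sides p G).2) -> reach D E ->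
  [/\ forall k, single (E k) = single (D k),
      forall k, ~~ single (D k) || (k \notin (sides p G).1 ++ (sides p G).2) ->
        E k = D k,
      suffix_le (sides p G).1 D E /\ prefix_le (sides p G).2 D E,
      same_parity (sides p G).1 D E /\ same_parity (sides p G).2 D E &
      ~~ is_Sp G -> prefix_le (sides p G).1 D E /\ suffix_le (sides p G).2 D E].
Proof.
move=> uniq_sides; elim=> [|{}E F _ [sE offE [sufL preR] [parL parR] GL] moveEF].
  by split=> //; have [? ? ?] := @eq_side_stats (sides p G).1 D D (fun _ _ => erefl);
     have [? ? ?] := @eq_side_stats (sides p G).2 D D (fun _ _ => erefl).
have [[sufL' preR'] [parL' parR'] GL'] := move_stats uniq_sides moveEF.
have eqs t : singles D t = singles E t by apply: eq_filter => k; rewrite sE.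
split.
- by move=> k; rewrite -sE; case: moveEF => i [e [_ _ ->]]; rewrite single_flip.
- by move=> k off; rewrite (move_off moveEF) ?offE // sE.
- by split; [apply: suffix_le_trans sufL' | apply: prefix_le_trans preR'].
- by rewrite /same_parity !eqs in parL parR *; rewrite parL parR.
- move=> /[dup] /GL[preL sufR] /GL'[preL' sufR'].
  by split; [apply: prefix_le_trans preL' | apply: suffix_le_trans sufR'].
Qed.

Lemma reach_agree D E k : uniq ((sides p G).1 ++ (sides p G).2) ->
  reach D E -> oriented (cap_diagram p G D) E ->
  k \notin end_nodes (cap_diagram p G D) -> E k = D k.
Proof.
move=> uniq_sides /(reach_stats uniq_sides).
case=> [sE off [sufL preR] [parL parR] GL] /orientedP orient k_end.
have [Dk|] := boolP (single (D k)); last by move=> Dk; rewrite off ?Dk.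
have [k_in|k_out] := boolP (k \in (sides p G).1 ++ (sides p G).2); last first.
  by rewrite off // k_out orbT.
have EvD w (c : content) : all (fun k => D k == c) w -> all (fun k => E k == c) w ->
    k \in w -> E k = D k.
  by move=> /allP Dw /allP Ew kw; rewrite (eqP (Dw _ kw)) (eqP (Ew _ kw)).
have no_edge i e : e \in cap_diagram p G D i -> k != e.1 /\ k != e.2.
  move=> e_in; split; apply: contra k_end => /eqP Ek; apply/end_nodesP;
  by exists i, e; rewrite -Ek eqxx ?orbT.
have no_node s : {subset s <= cap_diagram p G D Cap} -> k \notin nodes s.
  move=> sub; rewrite mem_cat; apply/norP; split; apply/mapP => -[e /sub e_in Ek];
  by have := no_edge _ _ e_in; rewrite -Ek eqxx; case.
have in_match t : k \in t -> {subset (side_match D t).1 <= cap_diagram p G D Cap} ->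
    k \in (side_match D t).2.
  move=> kt sub; have := perm_mem (match_nodes D [::] (singles D t)) k.
  by rewrite mem_cat (negbTE (no_node _ sub)) /= mem_filter Dk kt.
have subL : {subset (side_match D (sides p G).1).1 <= cap_diagram p G D Cap}.
  by move=> e e_in; rewrite /= mem_cat e_in.
have subR : {subset (side_match D (sides p G).2).1 <= cap_diagram p G D Cap}.
  by move=> e e_in; rewrite /= mem_cat e_in orbT.
have caps t : {subset (side_match D t).1 <= cap_diagram p G D Cap} ->
    all (edge_oriented E Cap) (side_match D t).1.
  by move=> sub; apply/allP => e /sub /orient.
move: k_in; rewrite mem_cat => /orP[] k_in.
- have := in_match _ k_in subL.
  have [w1 [w2 [Em [Dw1 Dw2] prew sufw parw]]] := side_agree sE (caps _ subL).
  rewrite {1}Em mem_cat => /orP[kw1|kw2]; last exact: (EvD w2 down _ (sufw sufL)).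
  have [Sp|notSp] := boolP (is_Sp G); last first.
    by apply: (EvD w1 up) => //; apply: prew; case: (GL notSp).
  (* For Sp_n the inequality for [w1] is missing. But the left curls pair up exactly the nodes of
     [w1], and parity decides about the last one. *)
  have EL : [seq k <- (side_match D (sides p G).1).2 | D k == up] = w1.
    rewrite Em filter_cat (eq_in_filter (a2 := predT)) ?filter_predT.
      rewrite (eq_in_filter (s := w2) (a2 := pred0)) ?filter_pred0 ?cats0 //.
      by move=> z /(allP Dw2) /eqP ->.
    by move=> z /(allP Dw1).
  have curl : cap_diagram p G D LeftCurl = pair_up w1 by rewrite /= Sp EL.
  rewrite (eqP (allP Dw1 _ kw1)); apply/eqP.
  apply: (@pair_up_agree (ups E) w1) => //.
  + move=> e; rewrite -curl => /orient.
    by case/orP=> /eqP[]; rewrite /ups => -> ->.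
  + rewrite -(parw parL) Em count_cat.
    suff -> : count (ups E) w2 = 0%N by rewrite addn0.
    apply/eqP; rewrite -leqn0 leqNgt -has_count -all_predC.
    by apply: sub_all (sufw sufL) => z; rewrite /ups /downs /= => /eqP ->.
  + rewrite mem_cat; apply/norP; split; apply/mapP => -[e]; rewrite -curl => /no_edge[];
    by move=> + + Ek; rewrite -Ek eqxx.
- have := in_match _ k_in subR.
  have [w1 [w2 [Em [Dw1 Dw2] prew sufw parw]]] := side_agree sE (caps _ subR).
  rewrite {1}Em mem_cat => /orP[kw1|kw2]; first exact: (EvD w1 up _ (prew preR)).
  have [Sp|notSp] := boolP (is_Sp G); last first.
    by apply: (EvD w2 down) => //; apply: sufw; case: (GL notSp).
  have ER : [seq k <- (side_match D (sides p G).2).2 | D k == down] = w2.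
    rewrite Em filter_cat (eq_in_filter (s := w1) (a2 := pred0)) ?filter_pred0.
      rewrite (eq_in_filter (a2 := predT)) ?filter_predT //.
      by move=> z /(allP Dw2).
    by move=> z /(allP Dw1) /eqP ->.
  have curl : cap_diagram p G D RightCurl = [seq (e.2, e.1) | e <- pair_up (rev w2)].
    by rewrite /= Sp ER.
  have curl_in e : e \in pair_up (rev w2) -> (e.2, e.1) \in cap_diagram p G D RightCurl.
    by rewrite curl; apply: map_f.
  rewrite (eqP (allP Dw2 _ kw2)); apply/eqP.
  apply: (@pair_up_agree (downs E) (rev w2)) => //; rewrite ?mem_rev //.
  + move=> e /curl_in /orient.
    by case/orP=> /eqP[]; rewrite /downs => -> ->.
  (* The known parity concerns ups. As [w1] consists of ups in [E], it yields the parity of the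
     downs in [w2]. *)
  + have w2_single : all (fun z => single (E z)) w2.
      by apply: sub_all Dw2 => z; rewrite sE /downs => /eqP ->.
    have := parw parR; rewrite Em count_cat.
    have -> : count (ups E) w1 = size w1.
      by apply/eqP; rewrite -all_count; apply: prew.
    rewrite count_rev size_rev -(count_ups_downs w2_single).
    by move: (size _) (count _ _) (count _ _); clear; lia.
  + rewrite mem_cat; apply/norP; split; apply/mapP => -[e] /curl_in /no_edge[];
    by move=> + + Ek; rewrite -Ek eqxx.
Qed.

End Moves.

(** * Coefficients of pairs of diagrams and a criterion for their equality *)

Section Transfer.

Local Open Scope ring_scope.

Variables (p : nat) (G : group_data).
Implicit Types (D E F : diagram) (e : nat * nat) (t r : seq nat).
Let cap D := cap_diagram p G D.

Hypothesis uniq_sides : uniq ((sides p G).1 ++ (sides p G).2).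

(** This replaces the order: it will turn out equivalent to [mu] being below [lambda] with an
    oriented diagram, and it refers to the two diagrams alone. *)
Definition compat D E : Prop :=
  (forall k, k \notin end_nodes (cap D) -> E k = D k) /\ oriented (cap D) E.

Definition dcoef D E : {poly int} :=
  if `[< compat D E >] then 'X ^+ nb_clockwise (cap D) E else 0.

Lemma eq_in_tally (C : cc_diagram) (a b : kind -> pred (nat * nat)) :
  (forall k e, e \in C k -> a k e = b k e) -> tally C a = tally C b.
Proof. by move=> eqab; rewrite !tallyE; congr (_ + _ + _)%N; apply: eq_in_count => e; apply: eqab. Qed.

Lemma end_nodes_tally (C : cc_diagram) k :
  k \notin end_nodes C <-> tally C (fun _ e => (e.1 == k) || (e.2 == k)) = 0%N.
Proof.
rewrite tally_eq0; split=> [k_end i e e_in|none].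
  by apply: contra k_end => k_e; apply/end_nodesP; exists i, e.
by apply/negP=> /end_nodesP[i [e [e_in]]]; apply/negP/(none i).
Qed.

Lemma oriented_tally (C : cc_diagram) E :
  oriented C E <-> tally C (fun k e => ~~ edge_oriented E k e) = 0%N.
Proof.
rewrite orientedP tally_eq0; split=> h k e /h; first by rewrite negbK.
by move/negPn.
Qed.

(** Only the directions of the edges and the agreement off them enter [dcoef]. Here [g] renames
    nodes, as in moving an end node, and [f] changes the kind of an edge, as in reversing an
    outermost arrow. *)
Lemma dcoef_transfer D D' E E' (g : nat -> nat) (f : kind -> nat * nat -> kind) :
    involutive g ->
    (forall a, tally (cap D') a =
       tally (cap D) (fun k e => a (f k e) (g e.1, g e.2))) ->
    (forall k e, e \in cap D k ->
       carries E' (clockwise (f k e)) (g e.1, g e.2) = carries E (clockwise k) e /\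
       edge_oriented E' (f k e) (g e.1, g e.2) = edge_oriented E k e) ->
    (forall k, k \notin end_nodes (cap D) ->
       (E' (g k) = D' (g k)) <-> (E k = D k)) ->
  dcoef D' E' = dcoef D E.
Proof.
move=> gK tallyD' carriesE' offE'.
have end_D' k : (k \notin end_nodes (cap D')) <-> (g k \notin end_nodes (cap D)).
  rewrite !end_nodes_tally tallyD'.
  under eq_tally => i e do rewrite /= !(inv_eq gK).
  by [].
have or_D' : oriented (cap D') E' <-> oriented (cap D) E.
  rewrite !oriented_tally tallyD'.
  by under eq_in_tally => i e /carriesE'[_ ->] do over.
have compatD' : compat D' E' <-> compat D E.
  rewrite /compat or_D'; split=> -[off orE]; split=> // k k_end.
    by apply/(offE' _ k_end)/off; apply/end_D'; rewrite gK.
  by rewrite -(gK k); move/end_D': k_end => k_end; apply/(offE' _ k_end)/off.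
rewrite /dcoef (asbool_equiv_eq compatD'); case: asboolP => // _; congr ('X ^+ _).
have cwE : tally (cap D') (fun k => carries E' (clockwise k)) =
    tally (cap D) (fun k => carries E (clockwise k)).
  by rewrite tallyD'; apply: eq_in_tally => i e /carriesE'[].
exact: cwE.
Qed.

End Transfer.

(** * Exchanging two neighbouring nodes (E1) *)

Section Relabel.

Local Open Scope ring_scope.

Variables (p : nat) (G : group_data).
Implicit Types (D E F : diagram) (e : nat * nat) (t r : seq nat).
Local Notation cap D := (cap_diagram p G D).

Definition swap (x y z : nat) : nat :=
  if z == x then y else if z == y then x else z.

Lemma swapK x y : involutive (swap x y).
Proof.
move=> z; rewrite /swap; have [->|zx] := eqVneq z x.
  by case: eqP => [->|_] //; rewrite eqxx.
have [->|zy] := eqVneq z y; first by rewrite eqxx.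
by rewrite (negbTE zx) (negbTE zy).
Qed.

Definition map_edge (g : nat -> nat) e := (g e.1, g e.2).

Lemma match_relabel g D u r : involutive g ->
  match_arrows (D \o g) (map g u) (map g r) =
  (map (map_edge g) (match_arrows D u r).1, map g (match_arrows D u r).2).
Proof.
move=> gK; elim: r u => [|y r IH] u; first by rewrite /= map_rev.
rewrite map_cons !match_step; case: u => [|x u] /=; first exact: (IH [:: y]).
by rewrite !gK; case: ifP => _; rewrite -?map_cons IH.
Qed.

Lemma pair_up_map g t : pair_up (map g t) = map (map_edge g) (pair_up t).
Proof.
have [n] := ubnP (size t); elim: n t => // n IH [|x [|y t]] //=.
by rewrite !ltnS => le_tn; rewrite IH // ltnW.
Qed.

(** The scan looks at the sequence of single arrows and never at node numbers, so a renaming that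
    carries this sequence over carries the cap diagram over. *)
Lemma cap_diagram_relabel g D k : involutive g ->
  singles (D \o g) (sides p G).1 = map g (singles D (sides p G).1) ->
  singles (D \o g) (sides p G).2 = map g (singles D (sides p G).2) ->
  cap (D \o g) k = map (map_edge g) (cap D k).
Proof.
move=> gK EL ER; have filterE c s :
    [seq k <- map g s | D (g k) == c] = map g [seq k <- s | D k == c].
  by rewrite filter_map; congr map; apply: eq_filter => z /=; rewrite gK.
have matchE t : singles (D \o g) t = map g (singles D t) ->
    side_match (D \o g) t =
    (map (map_edge g) (side_match D t).1, map g (side_match D t).2).
  by move=> Et; rewrite /side_match -/(singles (D \o g) t) Et -(match_relabel _ [::]).
case: k => /=; rewrite !matchE //=.
- by rewrite map_cat.
- by case: (is_Sp G) => //; rewrite filterE pair_up_map.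
- case: (is_Sp G) => //; rewrite filterE -map_rev pair_up_map -!map_comp.
  exact: eq_map.
Qed.

(** The filter drops the node without a single arrow, so exchanging it with its neighbour keeps the
    order of the arrows. *)
Lemma singles_swap_in D x y t t1 t2 : uniq t -> single (D x) -> ~~ single (D y) ->
  t = t1 ++ [:: x; y] ++ t2 \/ t = t1 ++ [:: y; x] ++ t2 ->
  singles (D \o swap x y) t = map (swap x y) (singles D t).
Proof.
move=> uniq_t Dx Dy Et.
have neq_xy : x == y = false by apply: contraNF Dy => /eqP <-.
have out s : {subset s <= t1 ++ t2} ->
    singles (D \o swap x y) s = map (swap x y) (singles D s).
  move=> sub; have fix_s z : z \in s -> swap x y z = z.
    move/sub; rewrite mem_cat /swap => z_in.
    have : z \notin [:: x; y].
      apply/negP; rewrite !inE => z_xy; have := uniq_t.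
      rewrite -(perm_uniq (s1 := [:: x; y] ++ (t1 ++ t2))); last first.
        by apply/seq.permP => a; case: Et => ->; rewrite !count_cat /=; clear; lia.
      case/and3P; rewrite !inE !mem_cat => + + _.
      by case/orP: z_xy z_in => /eqP-> ->; rewrite ?orbT.
    by rewrite !inE negb_or => /andP[/negbTE-> /negbTE->].
  rewrite map_id_in.
    by apply: eq_in_filter => z /fix_s /= ->.
  by move=> z; rewrite mem_filter => /andP[_ /fix_s].
have [out1 out2] : singles (D \o swap x y) t1 = map (swap x y) (singles D t1) /\
    singles (D \o swap x y) t2 = map (swap x y) (singles D t2).
  by split; apply: out => z z_in; rewrite mem_cat z_in ?orbT.
case: Et => ->; rewrite /singles !filter_cat !map_cat -!/(singles _ _) out1 out2;
  by congr (_ ++ _ ++ _); rewrite /= /swap eqxx (eq_sym y) neq_xy eqxx Dx (negbTE Dy) /=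
    ?eqxx ?neq_xy ?(eq_sym y) ?neq_xy.
Qed.

Lemma singles_swap_out D x y t : x \notin t -> y \notin t ->
  singles (D \o swap x y) t = map (swap x y) (singles D t).
Proof.
move=> xt yt; have fix_t z : z \in t -> swap x y z = z.
  rewrite /swap => zt; case: eqP => [zx|_]; first by rewrite -zx zt in xt.
  by case: eqP => // zy; rewrite -zy zt in yt.
rewrite map_id_in.
  by apply: eq_in_filter => z /fix_t /= ->.
by move=> z; rewrite mem_filter => /andP[_ /fix_t].
Qed.

Lemma adjacent_split x y t : (x, y) \in zip t (behead t) ->
  exists t1 t2, t = t1 ++ [:: x; y] ++ t2.
Proof.
elim: t => [|z [|w t] IH] //=; rewrite inE => /orP[/eqP[-> ->]|/IH[t1 [t2 /= ->]]].
  by exists [::], t.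
by exists (z :: t1), t2.
Qed.

Hypothesis uniq_sides : uniq ((sides p G).1 ++ (sides p G).2).

Lemma dcoef_swap D E x y : neighbours p G x y ->
  single (D x) -> ~~ single (D y) ->
  dcoef p G (D \o swap x y) (E \o swap x y) = dcoef p G D E.
Proof.
move=> nb Dx Dy; have sK := swapK x y.
have [uniqL uniqR disj] : [/\ uniq (sides p G).1, uniq (sides p G).2
    & ~~ has (mem (sides p G).1) (sides p G).2].
  by move: uniq_sides; rewrite cat_uniq => /and3P[].
have capE k : cap (D \o swap x y) k = map (map_edge (swap x y)) (cap D k).
  have adj t : ((x, y) \in zip t (behead t)) || ((y, x) \in zip t (behead t)) ->
    exists t1 t2, t = t1 ++ [:: x; y] ++ t2 \/ t = t1 ++ [:: y; x] ++ t2.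
    by case/orP=> /adjacent_split[t1 [t2 Et]]; exists t1, t2; auto.
  apply: cap_diagram_relabel => //; case/orP: nb => /adj[t1 [t2 Et]].
  - exact: (singles_swap_in uniqL Dx Dy Et).
  - have [xR yR] : x \in (sides p G).2 /\ y \in (sides p G).2.
      by case: Et => ->; rewrite !mem_cat !inE !eqxx ?orbT.
    by move/hasPn: disj => disj; apply: singles_swap_out; apply: disj.
  - have [xL yL] : x \in (sides p G).1 /\ y \in (sides p G).1.
      by case: Et => ->; rewrite !mem_cat !inE !eqxx ?orbT.
    by apply: singles_swap_out; apply: contra disj => zR; apply/hasP;
       [exists x | exists y].
  - exact: (singles_swap_in uniqR Dx Dy Et).
apply: (@dcoef_transfer p G D _ E _ (swap x y) (fun k _ => k)) => //.
- by move=> a; rewrite !tallyE !capE !count_map.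
- by move=> k e _; rewrite /edge_oriented /carries /= !sK.
- by move=> k _ /=; rewrite sK.
Qed.

End Relabel.

(** * Cap diagrams after reversing the outermost arrow of a side *)

Section EndNodes.

Local Open Scope ring_scope.

Variables (p : nat) (G : group_data).
Implicit Types (D E F : diagram) (e : nat * nat) (t r : seq nat).
Local Notation cap D := (cap_diagram p G D).

Definition reverse_at z D : diagram := fun k => if k == z then opp_arrow (D k) else D k.

Lemma reverse_atK z : involutive (reverse_at z).
Proof.
by move=> D; apply/funext => k; rewrite /reverse_at; case: eqP => // _; rewrite opp_arrowK.
Qed.

(** A down put below the whole stack is reached only when all downs above it have been closed. The
    next up [y] then takes it, which without [z] would be the first unconnected node; if no such up
    occurs, [z] stays unconnected. The stack [u] is general for the sake of the induction. *)
Lemma match_bottom D D' z u r :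
    all (fun k => single (D k)) r -> all (downs D) u ->
    {in u ++ r, D' =1 D} -> D' z = down ->
  let m := match_arrows D u r in let m' := match_arrows D' (rcons u z) r in
  (all (downs D) m.2 /\ m' = (m.1, z :: m.2)) \/
  exists y w, [/\ m.2 = y :: w, D y = up, perm_eq m'.1 ((z, y) :: m.1) & m'.2 = w].
Proof.
elim: r u => [|y r IH] u /=.
  by left; rewrite all_rev rev_rcons.
case/andP=> Dy all_r down_u eqD D'z.
have eqDy : D' y = D y by rewrite eqD // mem_cat mem_head orbT.
have eqDr u' : {subset u' <= u ++ [:: y]} -> {in u' ++ r, D' =1 D}.
  move=> sub k; rewrite mem_cat => /orP[/sub k_in|k_in]; apply: eqD.
    by move: k_in; rewrite !mem_cat !inE => /orP[] ->; rewrite ?orbT.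
  by rewrite mem_cat inE k_in !orbT.
case: u down_u eqD eqDr => [|x u] down_u eqD eqDr /=; last first.
  case/andP: down_u => /eqP Dx down_u.
  have eqDx : D' x = D x by rewrite eqD ?mem_head.
  rewrite eqDx eqDy Dx /=; case: eqP => Dy'.
    have sub : {subset u <= (x :: u) ++ [:: y]}.
      by move=> k k_in; rewrite mem_cat inE k_in orbT.
    have [[dn ->]|[y' [w [E1 Dy1 perm_m E2]]]] := IH u all_r down_u (eqDr _ sub) D'z.
      by left.
    right; exists y', w; split=> //=.
    apply: (@perm_trans _ ((x, y) :: (z, y') :: (match_arrows D u r).1)).
      by rewrite perm_cons.
    by apply/seq.permP => a /=; rewrite addnCA.
  have sub : {subset [:: y, x & u] <= (x :: u) ++ [:: y]}.
    by move=> k; rewrite !(mem_cat, inE); case: (k == x); case: (k == y); case: (k \in u).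
  apply: (IH [:: y, x & u]) => //; last exact: eqDr.
  by have [//|Dy1] := singleP _ Dy; apply/and3P; split; first exact/eqP; first exact/eqP.
have [Dy1|Dy1] := singleP _ Dy; rewrite D'z eqDy Dy1 /=.
  right; exists y, (match_arrows D [::] r).2.
  have -> : match_arrows D [:: y] r =
      ((match_arrows D [::] r).1, y :: (match_arrows D [::] r).2).
    by rewrite (@match_inert D [::] [:: y] r) // Dy1.
  have -> : match_arrows D' [::] r = match_arrows D [::] r.
    by apply: match_eq; apply: (eqDr [::]).
  by [].
by apply: (IH [:: y]) => //; rewrite /= /downs Dy1.
Qed.

Hypothesis uniq_sides : uniq ((sides p G).1 ++ (sides p G).2).

Definition swap_kind (k0 k : kind) : kind :=
  match k0, k with
  | LeftCurl, LeftCurl | RightCurl, RightCurl => Cap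
  | LeftCurl, Cap => LeftCurl
  | RightCurl, Cap => RightCurl
  | _, _ => k
  end.

Lemma singles_in t D E : {in t, D =1 E} -> singles D t = singles E t.
Proof. by move=> eqDE; apply: eq_in_filter => k /eqDE ->. Qed.

Lemma side_match_in t D E : {in t, D =1 E} -> side_match D t = side_match E t.
Proof.
move=> eqDE; rewrite /side_match -/(singles D t) -/(singles E t) (singles_in eqDE).
by apply: match_eq => k; rewrite mem_filter => /andP[_ /eqDE].
Qed.

Lemma side_match_subset D t :
  {subset (side_match D t).2 <= t} /\
  forall e, e \in (side_match D t).1 -> e.1 \in t /\ e.2 \in t.
Proof.
split=> [k /(mem_subseq (match_unconnected_sub D [::] _))|e /match_cap_sub[_ _]].
  by rewrite mem_filter => /andP[].
by move/mem_subseq => sub; split; move: (sub e.1) (sub e.2); rewrite !inE !eqxx ?orbT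
   !mem_filter => /(_ isT)/andP[_ ?] /(_ isT)/andP[].
Qed.

(* Reversing the arrow at the outermost node of a side turns the curl ending
   there into a cap and conversely. *)
Lemma tally_first D z t : is_Sp G -> (sides p G).1 = z :: t -> D z = up ->
  forall a, tally (cap (reverse_at z D)) a =
            tally (cap D) (fun k e => a (if e.1 == z then swap_kind LeftCurl k else k) e).
Proof.
move=> Sp EL Dz a; rewrite !tallyE /= Sp EL.
have := uniq_sides; rewrite EL /= mem_cat negb_or => /andP[/andP[zt zR] uniq_tR].
have eqR : {in (sides p G).2, reverse_at z D =1 D}.
  by move=> k kR; rewrite /reverse_at; case: eqP => // kz; rewrite -kz kR in zR.
rewrite (side_match_in eqR).
have filterR s : {subset s <= (sides p G).2} ->
    [seq k <- s | reverse_at z D k == down] = [seq k <- s | D k == down].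
  by move=> sub; apply: eq_in_filter => k /sub /eqR ->.
rewrite filterR; last exact: (side_match_subset D _).1.
set D' := reverse_at z D; have D'z : D' z = down by rewrite /D' /reverse_at eqxx Dz.
have eqt : {in t, D' =1 D}.
  by move=> k kt; rewrite /D' /reverse_at; case: eqP => // kz; rewrite -kz kt in zt.
rewrite /side_match /= Dz D'z /= -!/(singles _ _) (singles_in eqt).
(* An up at [z] lies frozen at the bottom of the stack; a down there is the situation of
   [match_bottom]. *)
rewrite (@match_inert D [::] [:: z]) ?Dz //.
have sub_t : {subset singles D t <= t} by move=> k; rewrite mem_filter => /andP[].
have eqr : {in [::] ++ singles D t, D' =1 D} by move=> k /sub_t /eqt.
have caps_t e : e \in (match_arrows D [::] (singles D t)).1 -> (e.1 == z) = false.
  move=> e_in; apply/negP => /eqP ez.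
  by have [/=] := (side_match_subset D t).2 _ e_in; rewrite ez (negbTE zt).
have eqC b : count (b Cap) (match_arrows D [::] (singles D t)).1 =
  count (fun e => b (if e.1 == z then LeftCurl else Cap) e)
    (match_arrows D [::] (singles D t)).1.
  by apply: eq_in_count => e /caps_t ->.
have eqR1 b : count (b Cap) (side_match D (sides p G).2).1 =
  count (fun e => b (if e.1 == z then LeftCurl else Cap) e)
    (side_match D (sides p G).2).1.
  apply: eq_in_count => e /(side_match_subset _ _).2[e1 _].
  by case: eqP => // ez; rewrite -ez e1 in zR.
have eqRC b s : count (b RightCurl) s =
    count (fun e => b (if e.1 == z then RightCurl else RightCurl) e) s.
  by apply: eq_count => e; case: ifP.
set m := match_arrows D [::] _ in caps_t eqC *.
have all_r := filter_all (fun k => single (D k)) t.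
have up_t : {in m.2, forall k, (D' k == up) = (D k == up)}.
  by move=> k /((side_match_subset D t).1) /eqt ->.
(* Either no up after [z] is unconnected, and [z] lies on no edge of either diagram, or the first
   such up [y] forms the first curl with [z] in [D] and the cap with [z] in [D']. *)
have [[dn E']|[y [w [E2 Dy perm_m' E2']]]] :=
  @match_bottom D D' z [::] _ all_r isT eqr D'z.
- rewrite -/m /= in dn E'; rewrite E' /= D'z Dz /= (eq_in_filter (a2 := pred0)); last first.
    by move=> k km; rewrite up_t // (eqP (allP dn _ km)).
  rewrite (eq_in_filter (a1 := fun k => D k == up) (a2 := pred0)); last first.
    by move=> k km; rewrite (eqP (allP dn _ km)).
  by rewrite !filter_pred0 /= !count_cat -eqC -eqR1 -eqRC.
- rewrite -/m /= in E2 perm_m' E2'; rewrite E2' E2 /= Dz Dy /= !count_cat /=.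
  rewrite (seq.permP perm_m') /= eqxx -eqC -eqR1 -eqRC.
  have -> : [seq k <- w | D' k == up] = [seq k <- w | D k == up].
    by apply: eq_in_filter => k kw; rewrite up_t // E2 inE kw orbT.
  have -> : count (fun e => a (if e.1 == z then Cap else LeftCurl) e)
      (pair_up [seq k <- w | D k == up]) =
      count (a LeftCurl) (pair_up [seq k <- w | D k == up]).
    apply: eq_in_count => e /pair_up_sub/mem_subseq/(_ e.1); rewrite mem_head => /(_ isT).
    rewrite mem_filter => /andP[_ e1]; case: eqP => // ez.
    by have := (side_match_subset D t).1 e.1; rewrite -/m E2 inE e1 orbT ez (negbTE zt) => /(_ isT).
  by move: (count _ _) (count _ _) (count _ _) (count _ _) (a _ _); clear; lia.
Qed.

Lemma match_last D u z :
  match_arrows D u [:: z] =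
  if u is x :: s then
    if (D x == down) && (D z == up) then ([:: (x, z)], rev s) else ([::], rcons (rev u) z)
  else ([::], [:: z]).
Proof. by case: u => [|x s] //=; case: ifP => _; rewrite //= !rev_cons. Qed.

(** As [z] is read last, only the final step of the scan changes: a down at [z] stays unconnected
    and belongs to the first right curl, an up closes a cap. Its partner is in both cases the last
    unconnected down of [t]. *)
Lemma tally_last D z t : is_Sp G -> (sides p G).2 = rcons t z -> D z = down ->
  forall a, tally (cap (reverse_at z D)) a =
            tally (cap D) (fun k e => a (if e.2 == z then swap_kind RightCurl k else k) e).
Proof.
move=> Sp ER Dz a; rewrite !tallyE /= Sp ER.
have [zt zL] : z \notin t /\ z \notin (sides p G).1.
  have := uniq_sides; rewrite ER cat_uniq rcons_uniq => /and3P[_ /hasPn disj /andP[zt _]].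
  by split=> //; apply: disj; rewrite mem_rcons mem_head.
set D' := reverse_at z D; have D'z : D' z = up by rewrite /D' /reverse_at eqxx Dz.
have eqL : {in (sides p G).1, D' =1 D}.
  by move=> k kL; rewrite /D' /reverse_at; case: eqP => // kz; rewrite -kz kL in zL.
have eqt : {in t, D' =1 D}.
  by move=> k kt; rewrite /D' /reverse_at; case: eqP => // kz; rewrite -kz kt in zt.
rewrite (side_match_in eqL).
have -> : [seq k <- (side_match D (sides p G).1).2 | D' k == up] =
    [seq k <- (side_match D (sides p G).1).2 | D k == up].
  by apply: eq_in_filter => k /((side_match_subset D _).1) /eqL ->.
have matchE F : F z = up \/ F z = down -> {in t, F =1 D} ->
    side_match F (rcons t z) =
    ((side_match D t).1 ++ (match_arrows F (rev (side_match D t).2) [:: z]).1,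
     (match_arrows F (rev (side_match D t).2) [:: z]).2).
  move=> Fz eqF; rewrite -(side_match_in eqF) /side_match filter_rcons.
  have -> : single (F z) by apply/singleP.
  by rewrite -cats1 match_cat.
rewrite !matchE //; [|by right|by left]; rewrite !match_last Dz D'z.
have caps_t e : e \in (side_match D t).1 -> (e.2 == z) = false.
  move=> e_in; apply/negP => /eqP ez.
  by have [/= _] := (side_match_subset D t).2 _ e_in; rewrite ez (negbTE zt).
have caps_L e : e \in (side_match D (sides p G).1).1 -> (e.2 == z) = false.
  move=> e_in; apply/negP => /eqP ez.
  by have [/= _] := (side_match_subset D _).2 _ e_in; rewrite ez (negbTE zL).
have eqC b s : (forall e, e \in s -> (e.2 == z) = false) -> count (b Cap) s =
  count (fun e => b (if e.2 == z then RightCurl else Cap) e) s.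
  by move=> s_z; apply: eq_in_count => e /s_z ->.
have eqLC b s : count (b LeftCurl) s =
    count (fun e => b (if e.2 == z then LeftCurl else LeftCurl) e) s.
  by apply: eq_count => e; case: ifP.
have {}eqC := (eqC a _ caps_t, eqC a _ caps_L).
have sub_m := (side_match_subset D t).1.
have all_r := filter_all (fun k => single (D k)) t.
have eq_down s : {subset s <= (side_match D t).2} ->
    [seq k <- s | D' k == down] = [seq k <- s | D k == down].
  by move=> sub; apply: eq_in_filter => k /sub/sub_m/eqt ->.
have [r1 [r2 [Er up1 down2]]] := match_split all_r.
have Em : (side_match D t).2 =
    (match_arrows D [::] r1).2 ++ (match_arrows D [::] r2).2.
  by rewrite /side_match Er (match_up_down erefl up1).
have downs_nil s : all (fun k => D k == up) s -> [seq k <- s | D k == down] = [::].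
  by elim: s => //= k s IH /andP[/eqP-> /IH].
(* Without an unconnected down in [t] the node [z] has no partner in either diagram; otherwise the
   partner is [x]. *)
case: (lastP (match_arrows D [::] r2).2) down2 Em => [|w x] down2 Em.
  rewrite cats0 in Em; have up_m : all (fun k => D k == up) (side_match D t).2 by rewrite Em.
  have -> : (if rev (side_match D t).2 is x :: s then
      if (D x == down) && (down == up) then ([:: (x, z)], rev s)
      else ([::], rcons (rev (rev (side_match D t).2)) z)
      else ([::], [:: z])) = ([::], rcons (side_match D t).2 z).
    by case E: (rev _) => [|x s]; rewrite ?andbF -?E ?revK // -(revK (_.2)) E.
  have -> : (if rev (side_match D t).2 is x :: s then
      if (D' x == down) && (up == up) then ([:: (x, z)], rev s)
      else ([::], rcons (rev (rev (side_match D t).2)) z)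
      else ([::], [:: z])) = ([::], rcons (side_match D t).2 z).
    case E: (rev _) => [|x s]; first by rewrite -(revK (_.2)) E.
    have xm : x \in (side_match D t).2 by rewrite -mem_rev E mem_head.
    by rewrite eqt ?sub_m // (eqP (allP up_m _ xm)) -E revK.
  rewrite /= !filter_rcons D'z Dz /= eq_down // downs_nil //=.
  by rewrite !cats0 !count_cat -!eqC -eqLC.
rewrite -rcons_cat in Em; rewrite Em rev_rcons /=.
have xm : x \in (side_match D t).2 by rewrite Em mem_rcons mem_head.
have Dx : D x = down.
  by apply/eqP; apply: (allP down2); rewrite mem_rcons mem_head.
rewrite eqt ?sub_m // Dx /= revK rev_cons revK.
rewrite !filter_rcons Dz Dx /= !cats0 !rev_rcons /= !count_cat /= eqxx -!eqC -eqLC.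
rewrite eq_down; last by move=> k k_in; rewrite Em mem_rcons inE k_in orbT.
set w' := _ ++ w in Em *.
have zw k : k \in w' -> (k == z) = false.
  move=> kw; apply/negP => /eqP kz; have := sub_m k.
  by rewrite Em mem_rcons inE kw orbT kz (negbTE zt) => /(_ isT).
have <- : count (a RightCurl)
    [seq (e.2, e.1) | e <- pair_up (rev [seq k <- w' | D k == down])] =
  count (fun e => a (if e.2 == z then Cap else RightCurl) e)
    [seq (e.2, e.1) | e <- pair_up (rev [seq k <- w' | D k == down])].
  apply: eq_in_count => e /mapP[f /pair_up_sub/mem_subseq/(_ f.1) + ->] /=.
  by rewrite mem_head => /(_ isT); rewrite mem_rev mem_filter => /andP[_ /zw ->].
by move: (count _ _) (count _ _) (count _ _) (count _ _) (a _ _); clear; lia.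
Qed.

End EndNodes.

(** * Coefficients under (E2) and (E3), and removal of an edge between neighbours (P1, P2) *)

Section Removal.

Local Open Scope ring_scope.

Variables (p : nat) (G : group_data).
Implicit Types (D E F : diagram) (e : nat * nat) (t r : seq nat).
Local Notation cap D := (cap_diagram p G D).

Hypothesis uniq_sides : uniq ((sides p G).1 ++ (sides p G).2).

Lemma side_edge_mem k e : legal p G k e ->
  e.1 != e.2 /\ (e.1 \in (sides p G).1 /\ e.2 \in (sides p G).1 \/
                 e.1 \in (sides p G).2 /\ e.2 \in (sides p G).2).
Proof.
move=> /legal_sub sub; have := uniq_sides; rewrite cat_uniq => /and3P[uL _ uR].
have main t : uniq t -> subseq [:: e.1; e.2] t ->
    e.1 != e.2 /\ (e.1 \in t /\ e.2 \in t).
  move=> ut st; split; first by have := subseq_uniq st ut; rewrite /= inE andbT.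
  by split; apply: (mem_subseq st); rewrite !inE eqxx ?orbT.
by case: sub => /main[] // ? [? ?]; split=> //; [left|right].
Qed.

Lemma not_both_sides z : z \in (sides p G).1 -> z \in (sides p G).2 -> False.
Proof.
move=> zL zR; have := uniq_sides; rewrite cat_uniq => /and3P[_ /hasPn/(_ z zR) + _].
by rewrite /= zL.
Qed.

(** Being leftmost, [z] can only be the left end of an edge, and reversing a left end exchanges cap
    and left curl without changing clockwise or anti-clockwise. The case of a down at [z] follows
    since the reversal is an involution. *)
Lemma dcoef_first D E z t : is_Sp G -> (sides p G).1 = z :: t -> single (D z) ->
  dcoef p G (reverse_at z D) (reverse_at z E) = dcoef p G D E.
Proof.
move=> Sp EL; have main D0 E0 : D0 z = up ->
    dcoef p G (reverse_at z D0) (reverse_at z E0) = dcoef p G D0 E0.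
  move=> Dz; apply: (@dcoef_transfer p G D0 _ E0 _ id
      (fun k e => if e.1 == z then swap_kind LeftCurl k else k)) => //.
  - move=> a; rewrite (tally_first uniq_sides Sp EL Dz).
    by apply: eq_tally => k [].
  - move=> k [v w] /cap_diagram_edge[leg _] /=.
    have [/= neq_vw vw_in] := side_edge_mem leg.
    have zw : w == z = false.
      apply/negP => /eqP wz; have := uniq_sides.
      case: vw_in => -[]; last first.
        by move=> _ wR _; apply: (@not_both_sides z); [rewrite EL mem_head|rewrite -wz].
      move: leg neq_vw; rewrite wz EL => leg neq_vw v_in _.
      have sub : subseq [:: v; z] (z :: t).
        have [|sub] := legal_sub leg; rewrite ?EL //=.
        by case: (@not_both_sides z);
          rewrite ?EL ?mem_head // (mem_subseq sub) // !inE eqxx orbT.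
      have := sub; rewrite /= (negbTE neq_vw) => sub1 /andP[/negP[]].
      by rewrite mem_cat (mem_subseq sub1) // !inE eqxx orbT.
    have vR : v == z -> k <> RightCurl.
      move/eqP=> vz kR; move: leg; rewrite kR /= => /andP[_ /mem_subseq/(_ v)].
      rewrite mem_head vz => /(_ isT); apply: not_both_sides.
      by rewrite EL mem_head.
    rewrite /edge_oriented /carries /= {1 3 5}/reverse_at /reverse_at zw.
    case: (v == z) vR => [/(_ isT)|_]; last by [].
    by case: k {leg} => // _; case: (E0 v) => -[] []; case: (E0 w) => -[] [].
  - move=> k _; rewrite /reverse_at; case: ifP => // _.
    by split=> [/(inv_inj opp_arrowK)|->].
move=> Dz; have [/main//|Dz'] := singleP _ Dz.
rewrite -{2}(reverse_atK z D) -{2}(reverse_atK z E) [RHS]main //.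
by rewrite /reverse_at eqxx Dz'.
Qed.

Lemma dcoef_last D E z t : is_Sp G -> (sides p G).2 = rcons t z -> single (D z) ->
  dcoef p G (reverse_at z D) (reverse_at z E) = dcoef p G D E.
Proof.
move=> Sp ER; have zR : z \in (sides p G).2 by rewrite ER mem_rcons mem_head.
have zt : z \notin t.
  have := uniq_sides; rewrite ER cat_uniq rcons_uniq.
  by case/and3P=> _ _ /andP[].
have main D0 E0 : D0 z = down ->
    dcoef p G (reverse_at z D0) (reverse_at z E0) = dcoef p G D0 E0.
  move=> Dz; apply: (@dcoef_transfer p G D0 _ E0 _ id
      (fun k e => if e.2 == z then swap_kind RightCurl k else k)) => //.
  - move=> a; rewrite (tally_last uniq_sides Sp ER Dz).
    by apply: eq_tally => k [].
  - move=> k [v w] /cap_diagram_edge[leg _] /=.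
    have [/= neq_vw vw_in] := side_edge_mem leg.
    have zv : v == z = false.
      apply/negP => /eqP vz.
      have [sub|sub] := legal_sub leg; have /= v_in := mem_subseq sub (mem_head _ _).
        by apply: (@not_both_sides z); rewrite // -vz.
      move: sub; rewrite /= ER vz -cats1 => /(subseq_notin_cat zt) /=.
      by rewrite eqxx.
    have wL : w == z -> k <> LeftCurl.
      move/eqP=> wz kL; move: leg; rewrite kL /= => /andP[_ /mem_subseq/(_ w)].
      rewrite !inE eqxx orbT wz => /(_ isT) wL; exact: (not_both_sides wL).
    rewrite /edge_oriented /carries /= {1 3 5}/reverse_at /reverse_at zv.
    case: (w == z) wL => [/(_ isT)|_]; last by [].
    by case: k {leg} => // _; case: (E0 v) => -[] []; case: (E0 w) => -[] [].
  - move=> k _; rewrite /reverse_at; case: ifP => // _.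
    by split=> [/(inv_inj opp_arrowK)|->].
move=> Dz; have [Dz'|/main//] := singleP _ Dz.
rewrite -{2}(reverse_atK z D) -{2}(reverse_atK z E) [RHS]main //.
by rewrite /reverse_at eqxx Dz'.
Qed.

Definition replace2 x y (c1 c2 : content) D : diagram :=
  fun k => if k == x then c1 else if k == y then c2 else D k.

(** An adjacent down and up are connected as soon as the up is read, whatever the stack below, and
    the scan goes on as if both nodes were absent. *)
Lemma side_match_remove D t t1 t2 x y c1 c2 : uniq t -> t = t1 ++ [:: x; y] ++ t2 ->
    D x = down -> D y = up -> ~~ single c1 -> ~~ single c2 ->
  let D' := replace2 x y c1 c2 D in
  perm_eq (side_match D t).1 ((x, y) :: (side_match D' t).1) /\
  (side_match D t).2 = (side_match D' t).2.
Proof.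
move=> ut Et Dx Dy c1n c2n /=; move: ut; rewrite {t}Et cat_uniq /= negb_or => /and3P[_].
rewrite !inE negb_or negb_or => /andP[x1 /andP[y1 disj]] /andP[/andP[neq_xy x2] /andP[y2 _]].
set D' := replace2 x y c1 c2 D.
have eqD (s : seq nat) : x \notin s -> y \notin s -> {in s, D' =1 D}.
  move=> xs ys k ks; rewrite /D' /replace2; case: eqP => [kx|_].
    by rewrite -kx ks in xs.
  by case: eqP => // ky; rewrite -ky ks in ys.
rewrite /side_match -!/(singles _ _) /singles !filter_cat /= Dx Dy /=.
have -> : D' x = c1 by rewrite /D' /replace2 eqxx.
have -> : D' y = c2 by rewrite /D' /replace2 eq_sym (negbTE neq_xy) eqxx.
rewrite (negbTE c1n) (negbTE c2n) -!/(singles _ _).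
rewrite (singles_in (eqD t1 x1 y1)) (singles_in (eqD t2 x2 y2)).
have eqm : {in [::] ++ (singles D t1 ++ singles D t2), D' =1 D}.
  move=> k; rewrite cat0s mem_cat /singles !mem_filter => /orP[]/andP[_];
  [exact: (eqD t1 x1 y1)|exact: (eqD t2 x2 y2)].
have insert u r : match_arrows D u [:: x, y & r] =
    ((x, y) :: (match_arrows D u r).1, (match_arrows D u r).2).
  by case: u => [|z u] /=; rewrite ?Dx ?Dy ?andbF /= ?Dx.
rewrite (match_eq eqm) !match_cat insert; split=> //.
by rewrite -cat1s perm_catCA.
Qed.

(** Two ups at the beginning of a side are frozen at the bottom of the stack, so they are the first
    two unconnected nodes, the ends of the first left curl. *)
Lemma side_match_remove_curl D t t2 x y c1 c2 : uniq t -> t = [:: x; y] ++ t2 ->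
    D x = up -> D y = up -> ~~ single c1 -> ~~ single c2 ->
  let D' := replace2 x y c1 c2 D in
  side_match D t = ((side_match D' t).1, [:: x, y & (side_match D' t).2]).
Proof.
move=> ut Et Dx Dy c1n c2n /=; move: ut; rewrite {t}Et /= inE negb_or.
case/and3P=> /andP[neq_xy x2] y2 _.
set D' := replace2 x y c1 c2 D.
have eqD : {in t2, D' =1 D}.
  move=> k ks; rewrite /D' /replace2; case: eqP => [kx|_].
    by rewrite -kx ks in x2.
  by case: eqP => // ky; rewrite -ky ks in y2.
have Em : side_match D' [:: x, y & t2] = side_match D t2.
  rewrite -(side_match_in eqD) /side_match /=.
  have -> : D' x = c1 by rewrite /D' /replace2 eqxx.
  have -> : D' y = c2 by rewrite /D' /replace2 eq_sym (negbTE neq_xy) eqxx.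
  by rewrite (negbTE c1n) (negbTE c2n).
rewrite Em /side_match /= Dx Dy /= Dx /=.
by rewrite (@match_inert D [::] [:: y; x]) // Dy.
Qed.

Definition adjacent_edge k x y : Prop :=
  match k with
  | Cap => exists t1 t2, (sides p G).1 = t1 ++ [:: x; y] ++ t2 \/
                         (sides p G).2 = t1 ++ [:: x; y] ++ t2
  | LeftCurl => is_Sp G /\ exists t2, (sides p G).1 = [:: x; y] ++ t2
  | RightCurl => False
  end.

Lemma tally_remove D k x y c1 c2 : adjacent_edge k x y ->
    carries D (anticlockwise k) (x, y) -> ~~ single c1 -> ~~ single c2 ->
  forall a, tally (cap D) a =
            (a k (x, y) + tally (cap (replace2 x y c1 c2 D)) a)%N.
Proof.
move=> adj acw c1n c2n a; rewrite !tallyE /=.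
set D' := replace2 x y c1 c2 D.
have [uL uR disj] : [/\ uniq (sides p G).1, uniq (sides p G).2
    & ~~ has (mem (sides p G).1) (sides p G).2].
  by move: uniq_sides; rewrite cat_uniq => /and3P[].
have filterD (s : seq nat) c : x \notin s -> y \notin s ->
    [seq i <- s | D' i == c] = [seq i <- s | D i == c].
  move=> xs ys; apply: eq_in_filter => i is_; suff -> : D' i = D i by [].
  rewrite /D' /replace2; case: eqP => [ix|_]; first by rewrite -ix is_ in xs.
  by case: eqP => // iy; rewrite -iy is_ in ys.
have off (t : seq nat) : x \notin t -> y \notin t -> side_match D' t = side_match D t.
  move=> xt yt; apply: side_match_in => i it.
  rewrite /D' /replace2; case: eqP => [ix|_]; first by rewrite -ix it in xt.
  by case: eqP => // iy; rewrite -iy it in yt.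
have out (t : seq nat) : x \notin t -> y \notin t ->
    x \notin (side_match D t).2 /\ y \notin (side_match D t).2.
  by move=> xt yt; split; apply/negP => /((side_match_subset D t).1);
     apply/negP.
have out' (t : seq nat) : ~~ single (D' x) -> ~~ single (D' y) ->
    x \notin (side_match D' t).2 /\ y \notin (side_match D' t).2.
  move=> xn yn; split; apply/negP => /(mem_subseq (match_unconnected_sub D' [::] _));
    by rewrite mem_filter => /andP[+ _]; apply/negP.
have {out'} [ox oy] : (forall t, x \notin (side_match D' t).2) /\
    (forall t, y \notin (side_match D' t).2).
  have D'x : D' x = c1 by rewrite /D' /replace2 eqxx.
  have D'y : ~~ single (D' y) by rewrite /D' /replace2 eqxx; case: ifP.
  by split=> t; case: (out' t); rewrite ?D'x.
case: k adj acw => [[t1 [t2 E]]|[Sp [t2 E]]|//] /eqP[/= Dx Dy].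
- have perm_eqs : perm_eq ((side_match D (sides p G).1).1 ++ (side_match D (sides p G).2).1)
      ((x, y) :: (side_match D' (sides p G).1).1 ++ (side_match D' (sides p G).2).1) /\
    (side_match D (sides p G).1).2 = (side_match D' (sides p G).1).2 /\
    (side_match D (sides p G).2).2 = (side_match D' (sides p G).2).2.
    case: E => E.
      have [xR yR] : x \notin (sides p G).2 /\ y \notin (sides p G).2.
        by split; apply/negP => zR; apply: (not_both_sides _ zR);
           rewrite E !mem_cat !inE eqxx ?orbT.
      have [perm_m ->] := side_match_remove uL E Dx Dy c1n c2n.
      rewrite (off _ xR yR); split=> //.
      by rewrite -cat_cons perm_cat2r.
    have [xL yL] : x \notin (sides p G).1 /\ y \notin (sides p G).1.
      by split; apply/negP => zL; apply: (not_both_sides zL);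
         rewrite E !mem_cat !inE eqxx ?orbT.
    have [perm_m ->] := side_match_remove uR E Dx Dy c1n c2n.
    rewrite (off _ xL yL); split=> //.
    by rewrite -cat1s perm_sym perm_catCA perm_sym perm_cat2l.
  have [perm_m [-> ->]] := perm_eqs; rewrite (seq.permP perm_m) /=.
  by rewrite !filterD // !addnA.
- have [xR yR] : x \notin (sides p G).2 /\ y \notin (sides p G).2.
    by split; apply/negP => zR; apply: (not_both_sides _ zR);
       rewrite E !mem_cat !inE eqxx ?orbT.
  rewrite (off _ xR yR) (side_match_remove_curl uL E Dx Dy c1n c2n) /= Sp Dx Dy /=.
  rewrite -/D' !filterD //; try by [case: (out _ xR yR)].
  by move: (count _ _) (count _ _) (count _ _) (a _ _); clear; lia.
Qed.

(** The new contents of [x] and [y] are not single, so no remaining edge ends there, and being the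
    same in both diagrams they agree off the edges. The removed edge contributes its own orientation
    condition and, if clockwise, a factor ['X]. *)
Lemma dcoef_remove D E k x y c1 c2 : adjacent_edge k x y ->
    carries D (anticlockwise k) (x, y) -> ~~ single c1 -> ~~ single c2 ->
  dcoef p G D E =
  if edge_oriented E k (x, y) then
    'X ^+ carries E (clockwise k) (x, y)
      * dcoef p G (replace2 x y c1 c2 D) (replace2 x y c1 c2 E)
  else 0.
Proof.
move=> adj acw c1n c2n; have tallyD := tally_remove adj acw c1n c2n.
set D' := replace2 x y c1 c2 D in tallyD *; set E' := replace2 x y c1 c2 E.
have D'x : ~~ single (D' x) by rewrite /D' /replace2 eqxx.
have D'y : ~~ single (D' y) by rewrite /D' /replace2 eqxx; case: ifP.
have edgeE i e : e \in cap D' i -> E' e.1 = E e.1 /\ E' e.2 = E e.2.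
  case/cap_diagram_edge=> _ /carries_single[e1 e2].
  by split; rewrite /E' /replace2; (case: eqP => [ez|_]; [
    rewrite ?ez in e1 e2; by rewrite ?e1 ?e2 in D'x |
    case: eqP => // ez; rewrite ?ez in e1 e2; by rewrite ?e1 ?e2 in D'y]).
have orE : oriented (cap D) E <->
    edge_oriented E k (x, y) /\ oriented (cap D') E'.
  have -> : oriented (cap D') E' = oriented (cap D') E.
    apply/idP/idP => /orientedP h; apply/orientedP => i e e_in;
    by move: (h i e e_in); rewrite /edge_oriented /carries;
       have [-> ->] := edgeE _ _ e_in.
  rewrite !oriented_tally tallyD; case: (edge_oriented E k (x, y)) => /=.
    by rewrite add0n; split=> [|[]].
  by split=> [|[]].
have offE : (forall z, z \notin end_nodes (cap D) -> E z = D z) <->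
    (forall z, z \notin end_nodes (cap D') -> E' z = D' z).
  split=> off z z_end.
    rewrite /E' /D' /replace2; case: eqP => // zx; case: eqP => // zy.
    apply: off; apply/end_nodes_tally; rewrite tallyD.
    move/end_nodes_tally: z_end => ->; rewrite addn0 /=.
    by rewrite !(eq_sym _ z); move/eqP/negbTE: zx => ->; move/eqP/negbTE: zy => ->.
  move/end_nodes_tally: z_end; rewrite tallyD /= => /eqP.
  rewrite addn_eq0 eqb0 negb_or => /andP[/andP[xz yz] /eqP/end_nodes_tally/off].
  by rewrite /E' /D' /replace2 !(eq_sym z) (negbTE xz) (negbTE yz).
have compatE : compat p G D E <-> edge_oriented E k (x, y) /\ compat p G D' E'.
  by rewrite /compat orE offE; clear; tauto.
rewrite /dcoef (asbool_equiv_eq compatE) asbool_and asboolb.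
case: (edge_oriented E k (x, y)) => //=; case: asboolP => _; last by rewrite mulr0.
rewrite -exprD; congr ('X ^+ _).
have -> : nb_clockwise (cap D) E = tally (cap D) (fun i => carries E (clockwise i)) by [].
rewrite tallyD; congr (_ + _)%N; apply: eq_in_tally => i e e_in.
by rewrite /carries; have [-> ->] := edgeE _ _ e_in.
Qed.

End Removal.

(** * Arrow diagrams of weights *)

Section Sorting.

Local Open Scope ring_scope.
Import Order.TTheory Num.Theory.

Variable n : nat.
Implicit Types (v x : 'rV[int]_n) (w : 'S_n) (i j : 'I_n).

Definition sdec v : Prop := forall i j, (i < j)%N -> v 0 j < v 0 i.

Lemma sdec_gap v i j : sdec v -> (i <= j)%N -> v 0 j + (j - i)%N%:Z <= v 0 i.
Proof.
move=> dec; have [d] := ubnP (j - i)%N; elim: d j => // d IH j lt_d le_ij.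
have [<-|ne_ij] := eqVneq i j; first by rewrite subnn addr0.
have lt_ij : (i < j)%N by rewrite ltn_neqAle ne_ij.
have j1 : (j.-1 < n)%N by rewrite (leq_ltn_trans (leq_pred _)).
have := IH (Ordinal j1); rewrite /=.
have := dec (Ordinal j1) j; rewrite /=.
move: (v 0 j) (v 0 _) (v 0 i) lt_d lt_ij => a b c; clear; lia.
Qed.

Lemma sdec_le v i j : sdec v -> (v 0 i <= v 0 j) = (j <= i)%N.
Proof.
move=> dec; case: (ltngtP i j) => [/dec|/dec/ltW|/val_inj ->]; last by rewrite lexx.
  by rewrite ltNge => /negbTE.
by [].
Qed.

Lemma sdec_inj v : sdec v -> injective (v 0).
Proof.
by move=> dec i j Ev; apply/val_inj/eqP; rewrite eqn_leq -!(sdec_le _ _ dec) Ev lexx.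
Qed.

(** A strictly decreasing integer vector drops by at least [j - i] between the places [i] and [j],
    which is exactly the drop of [rho]. *)
Lemma decreasingP x : reflect (sdec (x + rho n)) (decreasing x).
Proof.
apply: (iffP idP) => [/forallP dec i j lt_ij|dec].
  have /forallP/(_ j)/implyP/(_ (ltnW lt_ij)) := dec i.
  by rewrite !mxE; have := ltn_ord j; move: (x 0 i) (x 0 j) lt_ij => a b; clear; lia.
apply/forallP => i; apply/forallP => j; apply/implyP => le_ij.
have := sdec_gap dec le_ij; rewrite !mxE; have := ltn_ord j.
by move: (x 0 i) (x 0 j) le_ij => a b; clear; lia.
Qed.

(** The place of entry [i] after sorting. *)
Definition rank_of v i : nat := #|[set j | v 0 i < v 0 j]|.

Lemma rank_of_lt v i : (rank_of v i < n)%N.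
Proof.
rewrite -[X in (_ < X)%N]card_ord -cardsT; apply: proper_card.
by apply/properP; split; [exact: subsetT | exists i; rewrite !inE ?ltxx].
Qed.

Lemma rank_of_mono v i j : v 0 i < v 0 j -> (rank_of v j < rank_of v i)%N.
Proof.
move=> lt_ij; apply: proper_card; apply/properP; split.
  by apply/subsetP => k; rewrite !inE; apply: lt_trans.
by exists j; rewrite !inE ?ltxx.
Qed.

Lemma rank_of_inj v : injective (v 0) -> injective (fun i => Ordinal (rank_of_lt v i)).
Proof.
move=> inj_v i j [Er]; apply: inj_v.
by case: (ltgtP (v 0 i) (v 0 j)) => // /rank_of_mono; rewrite Er ltnn.
Qed.

Lemma perm_wtE w v i : perm_wt w v 0 (w i) = v 0 i.
Proof. by rewrite mxE permK. Qed.

Lemma rank_of_perm w v i : sdec (perm_wt w v) -> rank_of v i = w i.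
Proof.
move=> dec; rewrite /rank_of; transitivity #|[set k : 'I_n | (k < w i)%N]|.
  rewrite -[RHS](card_imset _ (@perm_inj _ w^-1)); apply: eq_card => j.
  rewrite !inE; apply/idP/imsetP => [|[k]].
    rewrite -!(perm_wtE w v) => lt_ij; exists (w j); rewrite ?permK // inE.
    by rewrite ltnNge -(sdec_le _ _ dec) -ltNge.
  rewrite inE => lt_k ->; rewrite -!(perm_wtE w v) permKV.
  by rewrite ltNge (sdec_le _ _ dec) -ltnNge.
rewrite -sum1_card (eq_bigl (fun k : 'I_n => (k < w i)%N)); last by move=> k; rewrite inE.
by rewrite (big_ord_narrow (ltnW (ltn_ord (w i)))) sum1_card card_ord.
Qed.

Lemma card_ord_lt k : (k <= n)%N -> #|[set j : 'I_n | (j < k)%N]| = k.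
Proof.
move=> le_kn; rewrite -sum1_card (eq_bigl (fun j : 'I_n => (j < k)%N)); last first.
  by move=> j; rewrite inE.
by rewrite (big_ord_narrow le_kn) sum1_card card_ord.
Qed.

Lemma sort_exists v : injective (v 0) -> exists w, sdec (perm_wt w v).
Proof.
move=> inj_v; exists (perm (rank_of_inj inj_v)) => i j lt_ij.
set w := perm _; rewrite -(permKV w i) -(permKV w j) in lt_ij *.
move: (w^-1 i)%g (w^-1 j)%g lt_ij => a b; rewrite !perm_wtE !permE /= => lt_ab.
case: (ltgtP (v 0 b) (v 0 a)) => // [/rank_of_mono|/inj_v Eab].
  by move/(ltn_trans lt_ab); rewrite ltnn.
by rewrite Eab ltnn in lt_ab.
Qed.

(* The first s1 entries lie above the entries of rho in the middle block, which
   are untouched, and the last s2 entries below them. *)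
Definition block s1 s2 v : Prop :=
  [/\ forall i, (i < s1)%N -> (n - s1)%N%:Z < v 0 i,
      forall i, (s1 <= i < n - s2)%N -> v 0 i = (n - i)%N%:Z
    & forall i, (n - s2 <= i)%N -> v 0 i <= s2%:Z].

(** Values of the first block exceed those of the middle one, and these exceed those of the last.
    Sorting thus fixes the middle places and moves the others only within their block, which yields
    the condition on [w] in the steps of the order. *)
Lemma block_rank s1 s2 v i : (s1 + s2 <= n)%N -> block s1 s2 v ->
  [/\ (rank_of v i < s1)%N = (i < s1)%N,
      (n - s2 <= rank_of v i)%N = (n - s2 <= i)%N
    & (s1 <= i < n - s2)%N -> rank_of v i = i].
Proof.
move=> le_n [top mid bot].
have rank_top : (i < s1)%N -> (rank_of v i < s1)%N.
  move=> lt_i; rewrite -[X in (_ < X)%N](@card_ord_lt s1); last by lia.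
  apply: proper_card; apply/properP; split; last by exists i; rewrite !inE ?ltxx.
  apply/subsetP => j; rewrite !inE => lt_v; rewrite ltnNge; apply/negP => le_j.
  have := top i lt_i; have [lt_j|le_j2] := ltnP j (n - s2).
    by have := mid j; rewrite le_j lt_j => /(_ isT); move: lt_v; lia.
  by have := bot j le_j2; move: lt_v; lia.
have rank_bot : (n - s2 <= i)%N -> (n - s2 <= rank_of v i)%N.
  move=> le_i; rewrite -[X in (X <= _)%N](@card_ord_lt (n - s2)) ?leq_subr //.
  apply: subset_leq_card; apply/subsetP => j; rewrite !inE => lt_j.
  have := bot i le_i; have [lt_j1|le_j1] := ltnP j s1.
    by have := top j lt_j1; lia.
  by have := mid j; rewrite le_j1 lt_j => /(_ isT); lia.
have rank_mid : (s1 <= i < n - s2)%N -> rank_of v i = i.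
  move=> i_mid; rewrite -[RHS](@card_ord_lt i) ?(ltnW (ltn_ord i)) //.
  apply: eq_card => j; rewrite !inE (mid i i_mid).
  have [lt_j1|le_j1] := ltnP j s1; first by have := top j lt_j1; lia.
  have [lt_j|le_j] := ltnP j (n - s2); last by have := bot j le_j; lia.
  by have := mid j; rewrite le_j1 lt_j => /(_ isT); have := ltn_ord j; lia.
split=> //.
- apply/idP/idP => [lt_r|//]; first rewrite ltnNge; apply/negP => le_i.
  have [lt_i|/rank_bot] := ltnP i (n - s2); last by lia.
  by have := rank_mid; rewrite le_i lt_i => /(_ isT); lia.
- apply/idP/idP => [le_r|//]; rewrite leqNgt; apply/negP => lt_i.
  have [/rank_top|le_i] := ltnP i s1; first by lia.
  by have := rank_mid; rewrite le_i lt_i => /(_ isT); lia.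
Qed.

End Sorting.

(** * Weights of [Lambda(s)] and their diagrams in terms of [lambda + rho] *)

Section WeightDiagrams.

Local Open Scope ring_scope.
Import Order.TTheory Num.Theory.

Lemma entE n (x : 'rV[int]_n) (i : 'I_n) : ent x i = x 0 i.
Proof. by rewrite /ent valK. Qed.

(** Lengths of partitions are defined by counting nonzero entries; this turns them into thresholds
    for the index. *)
Lemma downset_card n (A : {set 'I_n}) :
  (forall i j : 'I_n, (i <= j)%N -> j \in A -> i \in A) ->
  forall i : 'I_n, (i \in A) = (i < #|A|)%N.
Proof.
move=> down i; apply/idP/idP => [iA|].
  rewrite -[X in (X <= _)%N](card_ord_lt (ltn_ord i)); apply: subset_leq_card.
  by apply/subsetP => j; rewrite inE ltnS => le_ji; apply: down iA.
apply: contraTT => iA; rewrite -leqNgt -[X in (_ <= X)%N](card_ord_lt (ltnW (ltn_ord i))).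
apply: subset_leq_card; apply/subsetP => j jA; rewrite inE ltnNge.
by apply: contra iA => /down; apply.
Qed.

Lemma decreasing_le n (x : 'rV[int]_n) (i j : 'I_n) :
  decreasing x -> (i <= j)%N -> x 0 j <= x 0 i.
Proof. by move=> /forallP/(_ i)/forallP/(_ j)/implyP. Qed.

Lemma len_part1 n (x : 'rV[int]_n) (i : 'I_n) :
  decreasing x -> (0 < x 0 i) = (i < len (part1 x))%N.
Proof.
move=> dec; have inA j : (j \in [set k | part1 x 0 k != 0]) = (0 < x 0 j).
  by rewrite !inE mxE; lia.
rewrite /len -downset_card ?inA // => j k le_jk; rewrite !inA.
by have := decreasing_le dec le_jk; lia.
Qed.

Lemma len_part2 n (x : 'rV[int]_n) (i : 'I_n) :
  decreasing x -> (x 0 i < 0) = (n - len (part2 x) <= i)%N.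
Proof.
move=> dec; have inA j : (j \in [set k | part2 x 0 k != 0]) = (x 0 (rev_ord j) < 0).
  by rewrite !inE mxE; lia.
have := @downset_card n [set k | part2 x 0 k != 0] _ (rev_ord i).
rewrite inA rev_ordK -/(len (part2 x)) /= => -> //.
  by have := ltn_ord i; lia.
move=> j k le_jk; rewrite !inA.
have le_rev : (rev_ord k <= rev_ord j)%N by rewrite /=; lia.
by have := decreasing_le dec le_rev; lia.
Qed.

Lemma len_nonneg n (x : 'rV[int]_n) : (forall i, 0 <= x 0 i) -> len (part1 x) = len x.
Proof.
by move=> x_ge0; apply: eq_card => i; rewrite !inE mxE; have := x_ge0 i; lia.
Qed.

Variable p : nat.
Hypothesis p_gt0 : (0 < p)%N.

(** The bounds [s_h <= p - lambda^h_1] read on [lambda + rho]. Each block with arrows lies in a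
    window of [p] consecutive integers, so distinct entries of a block have distinct residues. The
    case [s2 = 0] is that of Sp_n. *)
Definition windowed n s1 s2 (v : 'rV[int]_n) : Prop :=
  [/\ block s1 s2 v, forall i : 'I_n, (i < s1)%N -> v 0 i <= (n - s1 + p)%N%:Z
    & forall i : 'I_n, (n - s2 <= i)%N -> s2%:Z - p%:Z < v 0 i].

Lemma rhoE n (x : 'rV[int]_n) (i : 'I_n) : (x + rho n) 0 i = x 0 i + (n - i)%N%:Z.
Proof. by rewrite !mxE. Qed.

Lemma GL_in_LambdaP n s1 s2 (x : 'rV[int]_n) : valid p (GL n s1 s2) ->
  @in_Lambda p (GL n s1 s2) x <-> sdec (x + rho n) /\ windowed s1 s2 (x + rho n).
Proof.
case/and3P => s1_bd s2_bd le_n; have n_gt0 : (0 < n)%N by lia.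
have o1 : (n.-1 < n)%N by lia.
pose i0 := Ordinal n_gt0; pose i1 := Ordinal o1.
have e1 : ent (part1 x) 0 = Num.max (x 0 i0) 0 by rewrite (entE _ i0) mxE.
have e2 : ent (part2 x) 0 = Num.max (- x 0 i1) 0.
  by rewrite (entE _ i0) mxE; congr (Num.max (- x 0 _) 0); apply/val_inj => /=; lia.
rewrite /in_Lambda /dominant /= e1 e2; split.
- case/and4P=> dec len1 x0 /andP[len2 x1].
  have dec' := decreasingP _ dec; split=> //.
  have pos (i : 'I_n) := len_part1 i dec; have neg (i : 'I_n) := len_part2 i dec.
  have x_le (i : 'I_n) := decreasing_le dec (leq0n i : (i0 <= i)%N).
  have x_ge (i : 'I_n) : x 0 i1 <= x 0 i.
    by apply: decreasing_le => //=; have := ltn_ord i; lia.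
  split; first split.
  + by move=> i lt_i; rewrite rhoE; have := neg i; have := ltn_ord i; lia.
  + by move=> i i_mid; rewrite rhoE; have := neg i; have := pos i; have := ltn_ord i; lia.
  + by move=> i le_i; rewrite rhoE; have := pos i; have := ltn_ord i; lia.
  + by move=> i lt_i; rewrite rhoE; have := x_le i; have := ltn_ord i; lia.
  + by move=> i le_i; rewrite rhoE; have := x_ge i; have := ltn_ord i; lia.
- case=> /decreasingP dec [[top mid bot] top2 bot2].
  have pos (i : 'I_n) := len_part1 i dec; have neg (i : 'I_n) := len_part2 i dec.
  have len1 : (len (part1 x) <= s1)%N.
    rewrite leqNgt; apply/negP => lt_s1.
    have lt_n : (s1 < n)%N by lia.
    have := pos (Ordinal lt_n); rewrite /= lt_s1.
    have [lt_s2|le_s2] := ltnP s1 (n - s2).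
      by have := mid (Ordinal lt_n); rewrite rhoE /= leqnn lt_s2 => /(_ isT); lia.
    by have := bot (Ordinal lt_n) le_s2; rewrite rhoE /=; lia.
  have len2 : (len (part2 x) <= s2)%N.
    rewrite leqNgt; apply/negP => lt_s2.
    have lt_n : (n - s2.+1 < n)%N by lia.
    have := neg (Ordinal lt_n); rewrite /= (_ : (_ <= _)%N = true); last by lia.
    have [lt_s1|le_s1] := ltnP (n - s2.+1) s1.
      by have := top (Ordinal lt_n) lt_s1; rewrite rhoE /=; lia.
    have := mid (Ordinal lt_n); rewrite rhoE /= le_s1 /= => h.
    by have := h (_ : (n - s2.+1 < n - s2)%N); lia.
  rewrite dec len1 len2 /=; apply/andP; split.
    by have := top2 i0; rewrite rhoE /=; lia.
  by have := bot2 i1; rewrite rhoE /=; lia.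
Qed.

Lemma Sp_in_LambdaP m s (x : 'rV[int]_m) : valid p (Sp m s) ->
  @in_Lambda p (Sp m s) x <-> sdec (x + rho m) /\ windowed s 0 (x + rho m).
Proof.
case/andP => _ s_bd; have m_gt0 : (0 < m)%N by lia.
have o1 : (m.-1 < m)%N by lia.
pose i0 := Ordinal m_gt0; pose i1 := Ordinal o1.
have e1 : ent x 0 = x 0 i0 by rewrite (entE _ i0).
rewrite /in_Lambda /dominant /= e1; split.
- case/and3P=> /andP[dec /forallP x_ge0] lenx x0.
  have dec' := decreasingP _ dec; split=> //.
  have pos (i : 'I_m) := len_part1 i dec; rewrite (len_nonneg x_ge0) in pos.
  have x_le (i : 'I_m) := decreasing_le dec (leq0n i : (i0 <= i)%N).
  split; first split.
  + by move=> i lt_i; rewrite rhoE; have := x_ge0 i; have := ltn_ord i; lia.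
  + by move=> i i_mid; rewrite rhoE; have := x_ge0 i; have := pos i; have := ltn_ord i; lia.
  + by move=> i; rewrite subn0 leqNgt ltn_ord.
  + by move=> i lt_i; rewrite rhoE; have := x_le i; have := ltn_ord i; lia.
  + by move=> i; rewrite subn0 leqNgt ltn_ord.
- case=> /decreasingP dec [[top mid _] top2 _].
  have x_ge0 i : 0 <= x 0 i.
    have [lt_i|le_i] := ltnP i s.
      have lt_s1 : (s.-1 < m)%N by lia.
      have le_i : (i <= Ordinal lt_s1)%N by rewrite /=; lia.
      apply: le_trans (decreasing_le dec le_i).
      by have := top (Ordinal lt_s1); rewrite rhoE /=; lia.
    by have := mid i; rewrite rhoE subn0 le_i ltn_ord => /(_ isT); lia.
  have pos (i : 'I_m) := len_part1 i dec; rewrite (len_nonneg x_ge0) in pos.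
  have lenx : (len x <= s)%N.
    rewrite leqNgt; apply/negP => lt_s.
    have lt_m : (s < m)%N.
      by rewrite (leq_trans lt_s) // -[X in (_ <= X)%N]card_ord max_card.
    have := pos (Ordinal lt_m); rewrite /= lt_s.
    by have := mid (Ordinal lt_m); rewrite rhoE /= subn0 leqnn lt_m => /(_ isT); lia.
  rewrite dec lenx /=; apply/andP; split; first by apply/forallP.
  by have := top2 i0; rewrite rhoE /=; lia.
Qed.

(** Since [j - lambda^2_j] is the [j]-th entry of [lambda + rho] from the end, both kinds of arrows
    are read off this vector. The vector need not be sorted, as reflected vectors are treated before
    sorting. *)
Definition GL_dia n s1 s2 (v : 'rV[int]_n) : diagram := fun k =>
  ([exists i : 'I_n, (i < s1)%N && (residue p (v 0 i) == k)],
   [exists i : 'I_n, (n - s2 <= i)%N && (residue p (v 0 i) == k)]).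

Lemma GL_diagramE n s1 s2 (x : 'rV[int]_n) : valid p (GL n s1 s2) ->
  @in_Lambda p (GL n s1 s2) x ->
  GL_diagram p s1 s2 x = GL_dia s1 s2 (x + rho n).
Proof.
move=> val xL; have [s1_bd s2_bd le_n] := and3P val.
have /and4P[dec len1 _ /andP[len2 _]] := xL; rewrite /dominant /= in dec len1 len2.
have pos (i : 'I_n) := len_part1 i dec; have neg (i : 'I_n) := len_part2 i dec.
apply/funext => k; rewrite /GL_diagram /GL_dia; congr (_, _).
- have top (i : 'I_n) : (i < s1)%N -> ent (rho n + part1 x) i = (x + rho n) 0 i.
    move=> lt_i; rewrite entE !mxE; have neg_i := neg i; have lt_n := ltn_ord i.
    have x_ge0 : 0 <= x 0 i by rewrite leNgt neg_i; move: lt_i len2 le_n; clear; lia.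
    by rewrite (max_l x_ge0) addrC.
  apply/mapP/existsP => [[i]|[i /andP[lt_i /eqP <-]]].
    rewrite mem_iota /= add0n => lt_i ->.
    have lt_n : (i < n)%N by lia.
    by exists (Ordinal lt_n); rewrite /= lt_i /= (top (Ordinal lt_n)).
  by exists (i : nat); rewrite ?mem_iota ?top.
- have bot (i : 'I_n) : (n - s2 <= i)%N ->
      (rev_ord i).+1%:Z - ent (part2 x) (rev_ord i) = (x + rho n) 0 i.
    move=> le_i; rewrite entE !mxE rev_ordK; have pos_i := pos i; have lt_n := ltn_ord i.
    have -> : ((rev_ord i).+1 = n - i)%N by rewrite /=; have := ltn_ord i; lia.
    have x_le0 : 0 <= - x 0 i by rewrite oppr_ge0 leNgt pos_i; move: le_i len1 le_n; clear; lia.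
    by rewrite (max_l x_le0) opprK addrC.
  apply/mapP/existsP => [[j]|[i /andP[le_i /eqP <-]]].
    rewrite mem_iota /= add0n => lt_j ->.
    have lt_n : (j < n)%N by lia.
    have le_j : (n - s2 <= rev_ord (Ordinal lt_n))%N by rewrite /=; lia.
    by exists (rev_ord (Ordinal lt_n)); rewrite le_j -(bot _ le_j) rev_ordK /=.
  exists (rev_ord i : nat); last by rewrite bot.
  by rewrite mem_iota /=; have := ltn_ord i; lia.
Qed.

(* Node k > 0 has the labels k and p - k; the number of ups among the nodes
   k > 0 determines the arrow at node 0. *)
Definition Sp_dia m s b (v : 'rV[int]_m) : diagram := fun k =>
  let lab r := [exists i : 'I_m, (i < s)%N && (residue p (v 0 i) == r)] in
  let u := #|[set i : 'I_m | (i < s)%N && (0 < residue p (v 0%R i) <= p./2)%N]| in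
  if k == 0%N then (lab 0%N && (odd u != b), lab 0%N && (odd u == b))
  else if (k <= p./2)%N then (lab k, lab (p - k)%N) else empty.

Lemma Sp_diagramE m s b (x : 'rV[int]_m) : (s <= m)%N ->
  Sp_diagram p s b x = Sp_dia s b (x + rho m).
Proof.
move=> le_sm; have labE r :
    (r \in [seq residue p (ent (rho m + x) i) | i <- iota 0 s]) =
    [exists i : 'I_m, (i < s)%N && (residue p ((x + rho m) 0 i) == r)].
  rewrite addrC; apply/mapP/existsP => [[i]|[i /andP[lt_i /eqP <-]]].
    rewrite mem_iota /= add0n => lt_i ->.
    have lt_m : (i < m)%N by lia.
    by exists (Ordinal lt_m); rewrite /= lt_i (entE _ (Ordinal lt_m)) /=.
  by exists (i : nat); rewrite ?mem_iota ?entE.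
have countE : count (fun a => 0 < a <= p./2)%N
      [seq residue p (ent (rho m + x) i) | i <- iota 0 s] =
    #|[set i : 'I_m | (i < s)%N && (0 < residue p ((x + rho m)%R 0%R i) <= p./2)%N]|.
  rewrite addrC count_map -sum1_count -sum1_card.
  rewrite (eq_bigl (fun i : 'I_m =>
      (fun i : nat => 0 < residue p (ent (x + rho m)%R i) <= p./2)%N i && (i < s)%N));
    last by move=> i; rewrite inE andbC entE.
  rewrite (big_ord_narrow_cond le_sm) -(big_mkord (fun i : nat =>
    0 < residue p (ent (x + rho m)%R i) <= p./2)%N (fun=> 1%N)).
  by rewrite /index_iota subn0.
by apply/funext => k; rewrite /Sp_diagram /Sp_dia !labE countE.
Qed.

End WeightDiagrams.

(** * Representatives of residues in a window; a diagram determines its weight *)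

Section Realization.

Local Open Scope ring_scope.
Import Order.TTheory Num.Theory.

Variable p : nat.
Hypothesis p_gt0 : (0 < p)%N.

Lemma residue_lt z : (residue p z < p)%N.
Proof. by rewrite /residue; have := modz_ge0 z (_ : p%:Z != 0); have := ltz_pmod z (_ : 0 < p%:Z); lia. Qed.

Lemma residueE z : exists q : int, z = q * p%:Z + (residue p z)%:Z.
Proof.
exists (divz z p%:Z); rewrite /residue {1}(divz_eq z p%:Z).
by have := modz_ge0 z (_ : p%:Z != 0); lia.
Qed.

Lemma residue_mulD (q : int) (r : nat) : (r < p)%N -> residue p (q * p%:Z + r%:Z) = r.
Proof. by move=> lt_rp; rewrite /residue modzMDl modz_nat modn_small. Qed.

Lemma residue_addM (z q : int) : residue p (z + q * p%:Z) = residue p z.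
Proof. by rewrite /residue addrC modzMDl. Qed.

Lemma residue_eq z1 z2 : residue p z1 = residue p z2 -> exists q : int, z1 = z2 + q * p%:Z.
Proof.
move=> eq_r; have [q1 E1] := residueE z1; have [q2 E2] := residueE z2.
by exists (q1 - q2); rewrite {1}E1 {1}E2 eq_r; lia.
Qed.

Lemma residue_window (A z1 z2 : int) : A < z1 <= A + p%:Z -> A < z2 <= A + p%:Z ->
  residue p z1 = residue p z2 -> z1 = z2.
Proof.
move=> w1 w2 /residue_eq[q E].
have : q = 0 by nia.
by move=> q0; rewrite E q0; lia.
Qed.

Variables n s1 s2 : nat.
Implicit Types (v x y : 'rV[int]_n) (w : 'S_n) (i j : 'I_n).
Hypothesis le_n : (s1 + s2 <= n)%N.

Definition zone_perm w : Prop := forall i,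
  ((w i < s1)%N = (i < s1)%N) * ((n - s2 <= w i)%N = (n - s2 <= i)%N).

Lemma block_sort v w : block s1 s2 v -> sdec (perm_wt w v) ->
  zone_perm w /\ forall i, (s1 <= i < n - s2)%N -> w i = i.
Proof.
move=> bl dec; split=> [i|i i_mid]; have [t b m] := block_rank i le_n bl.
  by rewrite -!(rank_of_perm i dec) t b.
by apply/val_inj; rewrite /= -(rank_of_perm i dec) m.
Qed.

Lemma block_sort_on v w : block s1 s2 v -> sdec (perm_wt w v) ->
  perm_on [set k : 'I_n | (k < s1) || (n - s2 <= k)]%N w.
Proof.
move=> bl /(block_sort bl)[_ fix_mid]; apply/subsetP => i; rewrite !inE => w_i.
by apply: contraNT w_i => i_mid; rewrite fix_mid //; move: i_mid; clear; lia.
Qed.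

Lemma windowed_sort v w : windowed p s1 s2 v -> sdec (perm_wt w v) ->
  windowed p s1 s2 (perm_wt w v).
Proof.
case=> bl top2 bot2 dec; have [zw fix_mid] := block_sort bl dec.
have [top mid bot] := bl.
have wE i : exists2 j, i = w j & perm_wt w v 0 i = v 0 j.
  by exists (w^-1 i)%g; rewrite ?permKV ?mxE.
split; first split; move=> i; have [j Ei ->] := wE i; rewrite Ei ?zw //.
- exact: top.
- have [z1 z2] := zw j => j_mid.
  have {}j_mid : (s1 <= j < n - s2)%N by move: z1 z2 j_mid; clear; lia.
  by rewrite fix_mid ?mid.
- exact: bot.
- exact: top2.
- exact: bot2.
Qed.

Lemma GL_dia_perm v w : zone_perm w -> GL_dia p s1 s2 (perm_wt w v) = GL_dia p s1 s2 v.
Proof.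
move=> zw; apply/funext => k; congr (_, _); apply/existsP/existsP => -[i].
- by move=> H; exists (w^-1 i)%g; move: H; rewrite mxE -{1}(permKV w i) zw.
- by move=> H; exists (w i); rewrite perm_wtE zw.
- by move=> H; exists (w^-1 i)%g; move: H; rewrite mxE -{1}(permKV w i) zw.
- by move=> H; exists (w i); rewrite perm_wtE zw.
Qed.

Lemma Sp_dia_perm b v w : zone_perm w -> Sp_dia p s1 b (perm_wt w v) = Sp_dia p s1 b v.
Proof.
move=> zw; have labE r :
    [exists i : 'I_n, (i < s1)%N && (residue p (perm_wt w v 0 i) == r)] =
    [exists i : 'I_n, (i < s1)%N && (residue p (v 0 i) == r)].
  apply/existsP/existsP => -[i].
    by move=> H; exists (w^-1 i)%g; move: H; rewrite mxE -{1}(permKV w i) zw.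
  by move=> H; exists (w i); rewrite perm_wtE zw.
have -> : Sp_dia p s1 b (perm_wt w v) = fun k =>
  let lab r := [exists i : 'I_n, (i < s1)%N && (residue p (v 0 i) == r)] in
  let u := #|[set i : 'I_n | (i < s1)%N && (0 < residue p (v 0%R i) <= p./2)%N]| in
  if k == 0%N then (lab 0%N && (odd u != b), lab 0%N && (odd u == b))
  else if (k <= p./2)%N then (lab k, lab (p - k)%N) else empty; last by [].
apply/funext => k; rewrite /Sp_dia !labE.
suff -> : #|[set i : 'I_n | (i < s1)%N && (0 < residue p (perm_wt w v 0%R i) <= p./2)%N]| =
  #|[set i : 'I_n | (i < s1)%N && (0 < residue p (v 0%R i) <= p./2)%N]| by [].
rewrite -[RHS](card_imset _ (@perm_inj _ w)); apply: eq_card => i.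
rewrite inE; apply/idP/imsetP => [H|[j H ->]].
  exists (w^-1 i)%g; rewrite ?permKV // inE; move: H.
  by rewrite mxE -{1}(permKV w i) zw.
by move: H; rewrite inE perm_wtE zw.
Qed.

Lemma sdec_values v1 v2 : sdec v1 -> sdec v2 ->
  (forall i, exists j, v1 0 i = v2 0 j) -> v1 = v2.
Proof.
move=> dec1 dec2 /choice[f Ef].
have inj_f : injective f.
  by move=> i j Eij; apply: (sdec_inj dec1); rewrite (Ef i) (Ef j) Eij.
pose w := perm inj_f; have E2 : perm_wt w v1 = v2.
  apply/rowP => i; have := perm_wtE w v1 (w^-1 i)%g; rewrite permKV => ->.
  by rewrite (Ef _) -(permE inj_f) permKV.
have E1 : perm_wt 1%g v1 = v1 by apply/rowP => i; rewrite mxE invg1 perm1.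
apply/rowP => i; rewrite Ef; congr (v2 0 _); apply/val_inj.
rewrite /= -(permE inj_f) -/w -(@rank_of_perm _ w v1) ?E2 //.
by rewrite (@rank_of_perm _ 1%g v1) ?perm1 ?E1.
Qed.

(** An arrow gives the residue of an entry and the window then gives the entry, while the middle
    block is that of [rho]. So the values of one vector occur in the other, and sorted vectors with
    this property coincide. *)
Lemma GL_dia_inj v1 v2 : sdec v1 -> sdec v2 ->
  windowed p s1 s2 v1 -> windowed p s1 s2 v2 ->
  (forall k, (k < p)%N -> GL_dia p s1 s2 v1 k = GL_dia p s1 s2 v2 k) -> v1 = v2.
Proof.
move=> dec1 dec2 [[top1 mid1 bot1] top1' bot1'] [[top2 mid2 bot2] top2' bot2'] eqD.
apply: sdec_values => // i.
have /(congr1 fst) /= E1 := eqD _ (residue_lt (v1 0 i)).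
have /(congr1 snd) /= E2 := eqD _ (residue_lt (v1 0 i)).
have [lt_i|le_i] := ltnP i s1.
  have : [exists j : 'I_n, (j < s1)%N && (residue p (v1 0 j) == residue p (v1 0 i))].
    by apply/existsP; exists i; rewrite lt_i eqxx.
  rewrite E1 => /existsP[j /andP[lt_j /eqP Ej]]; exists j.
  apply: (@residue_window (n - s1)%N%:Z); last by rewrite Ej.
    by have := top1 i lt_i; have := top1' i lt_i; move=> *; lia.
  by have := top2 j lt_j; have := top2' j lt_j; move=> *; lia.
have [lt_i|le_i2] := ltnP i (n - s2).
  by exists i; rewrite mid1 ?mid2 ?le_i.
have : [exists j : 'I_n, (n - s2 <= j)%N && (residue p (v1 0 j) == residue p (v1 0 i))].
  by apply/existsP; exists i; rewrite le_i2 eqxx.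
rewrite E2 => /existsP[j /andP[le_j /eqP Ej]]; exists j.
apply: (@residue_window (s2%:Z - p%:Z)); last by rewrite Ej.
  by have := bot1 i le_i2; have := bot1' i le_i2; move=> *; lia.
by have := bot2 j le_j; have := bot2' j le_j; move=> *; lia.
Qed.

End Realization.

(** * Steps of the order for the general linear group *)

Section GLSteps.

Local Open Scope ring_scope.
Import Order.TTheory Num.Theory.

Lemma subseq2_nth (x y : nat) (s : seq nat) : subseq [:: x; y] s <->
  exists i j, [/\ (i < j < size s)%N, nth 0%N s i = x & nth 0%N s j = y].
Proof.
elim: s => [|z s IH] /=.
  by split=> // -[i [j [/andP[_]]]]; rewrite ltn0.
split.
  case: eqP => [<-|_].
    rewrite sub1seq => y_in; exists 0%N, (index y s).+1.
    by rewrite /= ltnS index_mem nth_index.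
  by case/IH=> i [j [lt_ij Ei Ej]]; exists i.+1, j.+1.
case=> -[|i] [[|j]] [//= lt_j Ei Ej].
  by rewrite Ei eqxx sub1seq -Ej mem_nth.
have sub : subseq [:: x; y] s by apply/IH; exists i, j.
case: eqP => // _; rewrite sub1seq; apply: (mem_subseq sub).
by rewrite !inE eqxx orbT.
Qed.

Lemma subseq2_map_iota (x y k : nat) (f : nat -> nat) :
  subseq [:: x; y] [seq f t | t <- iota 0 k] <->
  exists i j, [/\ (i < j < k)%N, f i = x & f j = y].
Proof.
rewrite subseq2_nth size_map size_iota; split=> -[i [j [lt_ij Ei Ej]]];
  exists i, j; split=> //; move: Ei Ej; rewrite !(nth_map 0%N) ?size_iota ?nth_iota //;
  by move: lt_ij; clear; lia.
Qed.

Definition upd2 n (v : 'rV[int]_n) (i : 'I_n) a (j : 'I_n) c : 'rV[int]_n :=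
  \row_k if k == i then a else if k == j then c else v 0 k.

Variables p n s1 s2 : nat.
Hypothesis p_gt0 : (0 < p)%N.
Hypothesis GLvalid : valid p (GL n s1 s2).
Implicit Types (v : 'rV[int]_n) (w : 'S_n) (i j : 'I_n).

Let le_n : (s1 + s2 <= n)%N. Proof. by case/and3P: GLvalid. Qed.
Let s1_bd : (0 < s1 <= minn n p)%N. Proof. by case/and3P: GLvalid. Qed.
Let s2_bd : (0 < s2 <= minn n p)%N. Proof. by case/and3P: GLvalid. Qed.

Definition in_top (a : int) : Prop := (n - s1)%N%:Z < a <= (n - s1)%N%:Z + p%:Z.
Definition in_bot (a : int) : Prop := s2%:Z - p%:Z < a <= s2%:Z.

Lemma residue_in_top a1 a2 : in_top a1 -> in_top a2 -> residue p a1 = residue p a2 -> a1 = a2.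
Proof. exact: residue_window. Qed.

Lemma residue_in_bot a1 a2 : in_bot a1 -> in_bot a2 -> residue p a1 = residue p a2 -> a1 = a2.
Proof.
by move=> b1 b2; apply: (@residue_window p _ (s2%:Z - p%:Z)); rewrite ?subrK.
Qed.

(** The two walls stand right before the first labels of the two windows. The nodes [x], [y] lie on
    one side in this order iff the [d] steps from [x] to [y] cross no wall, that is, stay inside
    both windows. *)
Lemma GL_legalP (x y : nat) : reflect
  (exists a c d : int, [/\ 0 < d, in_top a /\ in_top (a + d), in_bot c /\ in_bot (c + d),
     residue p a = x /\ residue p (a + d) = y & residue p c = x /\ residue p (c + d) = y])
  (legal p (GL n s1 s2) Cap (x, y)).
Proof.
rewrite /legal /sides /= /in_top /in_bot.
(* The top window starts [Q.+1] periods and [l] integers after the bottom one, and [l] is the size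
   of the first side. *)
pose l := ((n - s1 - s2) %% p)%N; pose Q := ((n - s1 - s2) %/ p)%N.
have EQ : (n - s1 - s2 = Q * p + l)%N := divn_eq _ _.
have lt_lp : (l < p)%N by rewrite ltn_pmod.
have A_B : (n - s1)%N%:Z = (s2%:Z - p%:Z) + Q.+1%:Z * p%:Z + l%:Z by lia.
have resn (m : nat) (z q : int) : z = m%:Z + q * p%:Z -> residue p z = (m %% p)%N.
  by move=> ->; rewrite residue_addM /residue modz_nat.
rewrite -/l; apply: (iffP idP).
  case/orP=> /subseq2_map_iota[t1 [t2 [/andP[lt_t lt_l] <- <-]]].
    exists (s2%:Z + 1 + t1%:Z + Q.+1%:Z * p%:Z), (s2%:Z - p%:Z + 1 + t1%:Z), (t2%:Z - t1%:Z).
    split; last split.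
    - by lia.
    - by split; lia.
    - by split; lia.
    - split; [apply: (resn (s2 + 1 + t1)%N _ Q.+1%:Z) | apply: (resn (s2 + 1 + t2)%N _ Q.+1%:Z)].
        by lia.
      by lia.
    - by apply: (resn (s2 + 1 + t1)%N _ (-1)); lia.
    - by apply: (resn (s2 + 1 + t2)%N _ (-1)); lia.
  exists ((n - s1)%N%:Z + 1 + t1%:Z), (s2%:Z - p%:Z + 1 + t1%:Z + l%:Z), (t2%:Z - t1%:Z).
  split; last split.
  - by lia.
  - by split; lia.
  - by split; lia.
  - split; [apply: (resn (n - s1 + 1 + t1)%N _ 0) | apply: (resn (n - s1 + 1 + t2)%N _ 0)].
      by lia.
    by lia.
  - by apply: (resn (n - s1 + 1 + t1)%N _ (- Q.+1%:Z)); lia.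
  - by apply: (resn (n - s1 + 1 + t2)%N _ (- Q.+1%:Z)); lia.
case=> a [c [d [d_gt0 [a1 a2] [c1 c2] [Ea Ea'] [Ec Ec']]]].
have [t Et] : exists t : nat, c = s2%:Z - p%:Z + 1 + t%:Z.
  by exists (absz (c - (s2%:Z - p%:Z + 1))%R); lia.
have [d' Ed] : exists d' : nat, d = d'%:Z by exists (absz d); lia.
have lt_td : (t + d' < p)%N by lia.
have Et1 : residue p c = ((s2 + 1 + t) %% p)%N by apply: (resn _ _ (-1)); lia.
have Et2 : residue p (c + d) = ((s2 + 1 + (t + d')) %% p)%N by apply: (resn _ _ (-1)); lia.
(* The position [t] of [c] in the bottom window tells the side. On the first side the bound on
   [a + d] keeps [y] before the next wall, on the second side the bound on [c + d] does. *)
have [lt_tl|le_lt] := ltnP t l.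
  have Ea1 : a = s2%:Z + 1 + t%:Z + Q.+1%:Z * p%:Z.
    apply: (@residue_window p _ (n - s1)%N%:Z) => //; first by lia.
    by rewrite Ea -Ec Et1; apply/esym/resn.
  apply/orP; left; apply/subseq2_map_iota; exists t, (t + d')%N; split.
  - by lia.
  - by rewrite -Et1.
  - by rewrite -Et2.
apply/orP; right; apply/subseq2_map_iota; exists (t - l)%N, (t - l + d')%N; split.
- by lia.
- by rewrite -Ec; apply/esym/(resn _ _ (- Q.+1%:Z)); lia.
- by rewrite -Ec'; apply/esym/(resn _ _ (- Q.+1%:Z)); lia.
Qed.

End GLSteps.

(** * Exchanging the arrows of two nodes for GL_n *)

Section GLExchange.

Local Open Scope ring_scope.
Import Order.TTheory Num.Theory.

Lemma flip_sym D x y : flip D (x, y) = flip D (y, x).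
Proof. by apply/funext => k; rewrite /flip /= orbC. Qed.

Section Windows.

Variables p n s1 s2 : nat.
Implicit Types (v : 'rV[int]_n) (i : 'I_n).

Lemma windowed_top v i : windowed p s1 s2 v -> (i < s1)%N -> in_top p n s1 (v 0 i).
Proof.
by case=> [[top _ _] top2 _] lt_i; have := top i lt_i; have := top2 i lt_i;
   rewrite /in_top; lia.
Qed.

Lemma windowed_bot v i : windowed p s1 s2 v -> (n - s2 <= i)%N -> in_bot p s2 (v 0 i).
Proof.
by case=> [[_ _ bot] _ bot2] le_i; have := bot i le_i; have := bot2 i le_i;
   rewrite /in_bot; lia.
Qed.

Lemma windowed_mid v i : windowed p s1 s2 v -> (s1 <= i < n - s2)%N ->
  v 0 i = (n - i)%N%:Z.
Proof. by case=> [[_ mid _] _ _]; apply: mid. Qed.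

End Windows.

Variables p n s1 s2 : nat.
Hypothesis p_gt0 : (0 < p)%N.
Hypothesis GLvalid : valid p (GL n s1 s2).
Implicit Types (v : 'rV[int]_n) (w : 'S_n) (i j : 'I_n).

Local Notation in_top := (in_top p n s1).
Local Notation in_bot := (in_bot p s2).
Let le_n : (s1 + s2 <= n)%N. Proof. by case/and3P: GLvalid. Qed.

(** The top entry takes the residue of the bottom one and conversely, so an up and a down change
    places. As both nodes carry single arrows, this amounts to reversing both, and no value is
    repeated. *)
Lemma GL_exchange v i a j c : injective (v 0) -> windowed p s1 s2 v ->
    (i < s1)%N -> (n - s2 <= j)%N -> in_top a -> in_bot c ->
    residue p a = residue p (v 0 j) -> residue p c = residue p (v 0 i) ->
    (forall t : 'I_n, (t < s1)%N -> residue p (v 0 t) <> residue p (v 0 j)) ->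
    (forall t : 'I_n, (n - s2 <= t)%N -> residue p (v 0 t) <> residue p (v 0 i)) ->
  [/\ injective (upd2 v i a j c 0), windowed p s1 s2 (upd2 v i a j c)
    & GL_dia p s1 s2 (upd2 v i a j c) =
      flip (GL_dia p s1 s2 v) (residue p (v 0 j), residue p (v 0 i))].
Proof.
move=> inj_v win lt_i le_j top_a bot_c Ea Ec no_top no_bot.
have neq_ji : (j == i) = false by apply/eqP => Eji; move: lt_i le_j le_n; rewrite Eji; clear; lia.
set v' := upd2 v i a j c.
have v'i : v' 0 i = a by rewrite mxE eqxx.
have v'j : v' 0 j = c by rewrite mxE neq_ji eqxx.
have v'k (k : 'I_n) : k != i -> k != j -> v' 0 k = v 0 k.
  by move=> /negbTE ki /negbTE kj; rewrite mxE ki kj.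
have top' (k : 'I_n) : (k < s1)%N -> in_top (v' 0 k).
  move=> lt_k; have [->|ki] := eqVneq k i; first by rewrite v'i.
  rewrite v'k //; first exact: (windowed_top win).
  by apply/eqP => kj; move: lt_k le_j le_n; rewrite kj; clear; lia.
have bot' (k : 'I_n) : (n - s2 <= k)%N -> in_bot (v' 0 k).
  move=> le_k; have [->|kj] := eqVneq k j; first by rewrite v'j.
  rewrite v'k //; first exact: (windowed_bot win).
  by apply/eqP => ki; move: lt_i le_k le_n; rewrite ki; clear; lia.
have mid' (k : 'I_n) : (s1 <= k < n - s2)%N -> v' 0 k = (n - k)%N%:Z.
  move=> k_mid; rewrite v'k ?(windowed_mid win) //; apply/eqP => Ek.
    by move: k_mid lt_i; rewrite Ek; clear; lia.
  by move: k_mid le_j; rewrite Ek; clear; lia.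
split.
- have notin_a (k : 'I_n) : k != i -> v' 0 k <> a.
    move=> ki; have [lt_k|le_k] := ltnP k s1.
      rewrite v'k //; first by move=> Ek; apply: (no_top k lt_k); rewrite Ek.
      by apply/eqP => kj; move: lt_k le_j le_n; rewrite kj; clear; lia.
    have [lt_k2|/bot'] := ltnP k (n - s2); last first.
      by move: top_a le_n; rewrite /in_top /in_bot; clear; lia.
    rewrite mid' ?le_k //; move: top_a le_k le_n; rewrite /in_top; clear; lia.
  have notin_c (k : 'I_n) : k != j -> v' 0 k <> c.
    move=> kj; have [lt_k|le_k] := ltnP k (n - s2); last first.
      rewrite v'k //; first by move=> Ek; apply: (no_bot k le_k); rewrite Ek.
      by apply/eqP => ki; move: lt_i le_k le_n; rewrite ki; clear; lia.
    have [/top'|le_k2] := ltnP k s1.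
      by move: bot_c le_n; rewrite /in_top /in_bot; clear; lia.
    rewrite mid' ?lt_k ?le_k2 //; move: bot_c lt_k le_n; rewrite /in_bot; clear; lia.
  move=> k1 k2; have [->|k1i] := eqVneq k1 i.
    rewrite v'i; have [->//|/notin_a + E] := eqVneq k2 i; by case.
  have [->|k2i] := eqVneq k2 i; first by rewrite v'i => /notin_a; case.
  have [->|k1j] := eqVneq k1 j.
    rewrite v'j; have [->//|/notin_c + E] := eqVneq k2 j; by case.
  have [->|k2j] := eqVneq k2 j; first by rewrite v'j => /notin_c; case.
  by rewrite !v'k // => /inj_v.
- split; first split=> //.
  + by move=> k /top'/andP[].
  + by move=> k /bot'/andP[].
  + by move=> k /top'/andP[_]; rewrite PoszD.
  + by move=> k /bot'/andP[].
apply/funext => k; rewrite /flip /= /GL_dia.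
have neq_res : residue p (v 0 i) != residue p (v 0 j) by apply/eqP/no_top.
have at_j : [exists t : 'I_n, (t < s1)%N && (residue p (v 0 t) == residue p (v 0 j))] = false.
  by apply/existsP => -[t /andP[lt_t /eqP]]; apply: no_top.
have at_i : [exists t : 'I_n, (n - s2 <= t)%N && (residue p (v 0 t) == residue p (v 0 i))] = false.
  by apply/existsP => -[t /andP[le_t /eqP]]; apply: no_bot.
have topE : [exists t : 'I_n, (t < s1)%N && (residue p (v' 0 t) == k)] =
    if k == residue p (v 0 i) then false else if k == residue p (v 0 j) then true
    else [exists t : 'I_n, (t < s1)%N && (residue p (v 0 t) == k)].
  case: eqP => [->|ki]; last case: eqP => [->|kj].
  - apply/existsP => -[t /andP[lt_t]]; have [->|ti] := eqVneq t i.
      by rewrite v'i Ea eq_sym (negbTE neq_res).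
    have tj : t != j by apply/eqP => tj; move: lt_t le_j le_n; rewrite tj; clear; lia.
    rewrite v'k // => /eqP/(residue_in_top p_gt0 (windowed_top win lt_t) (windowed_top win lt_i)).
    by move/inj_v/eqP; rewrite (negbTE ti).
  - by apply/existsP; exists i; rewrite lt_i v'i Ea eqxx.
  apply: eq_existsb => t; case: (ltnP t s1) => //= lt_t.
  have [->|ti] := eqVneq t i.
    by rewrite v'i Ea; apply/eqP/eqP => E; [case: kj | case: ki].
  by rewrite v'k //; apply/eqP => tj; move: lt_t le_j le_n; rewrite tj; clear; lia.
have botE : [exists t : 'I_n, (n - s2 <= t)%N && (residue p (v' 0 t) == k)] =
    if k == residue p (v 0 i) then true else if k == residue p (v 0 j) then false
    else [exists t : 'I_n, (n - s2 <= t)%N && (residue p (v 0 t) == k)].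
  case: eqP => [->|ki]; last case: eqP => [->|kj].
  - by apply/existsP; exists j; rewrite le_j v'j Ec eqxx.
  - apply/existsP => -[t /andP[le_t]]; have [->|tj] := eqVneq t j.
      by rewrite v'j Ec (negbTE neq_res).
    have ti : t != i by apply/eqP => ti; move: lt_i le_t le_n; rewrite ti; clear; lia.
    rewrite v'k // => /eqP/(residue_in_bot p_gt0 (windowed_bot win le_t) (windowed_bot win le_j)).
    by move/inj_v/eqP; rewrite (negbTE tj).
  apply: eq_existsb => t; case: (leqP (n - s2) t) => //= le_t.
  have [->|tj] := eqVneq t j.
    by rewrite v'j Ec; apply/eqP/eqP => E; [case: ki | case: kj].
  by rewrite v'k //; apply/eqP => ti; move: lt_i le_t le_n; rewrite ti; clear; lia.
rewrite topE botE; have [->|ki] := eqVneq k (residue p (v 0 i)).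
  rewrite orbT /opp_arrow /= at_i.
  by congr (_, _); apply/esym/existsP; exists i; rewrite lt_i eqxx.
case: eqP => [->|kj] //=; rewrite /opp_arrow /= at_j.
by congr (_, _); apply/esym/existsP; exists j; rewrite le_j eqxx.
Qed.

End GLExchange.

(** * Non-vanishing of Weyl characters *)

Section WeylCharacters.

Local Open Scope ring_scope.
Import Order.TTheory Num.Theory.

Variable n : nat.
Implicit Types (x v : 'rV[int]_n).

Lemma altsum_det x :
  altsum x = \det (\matrix_(i < n, j < n) (tofrac ('X_i : {mpoly int[n]})) ^ (x 0 j)).
Proof.
rewrite /altsum /determinant (reindex_inj invg_inj) /=; apply: eq_bigr => w _.
rewrite odd_permV /expo; congr (_ * _); apply: eq_bigr => i _.
by rewrite !mxE invgK.
Qed.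

Lemma altsum_eq0 x : ~ injective (x 0) -> altsum x = 0.
Proof.
move=> not_inj; have [i [j [neq_ij Eij]]] : exists i j, i != j /\ x 0 i = x 0 j.
  apply: contrapT => none; apply: not_inj => i j Eij.
  by have [//|neq_ij] := eqVneq i j; case: none; exists i, j.
rewrite altsum_det -det_tr; apply: (determinant_alternate neq_ij) => k.
by rewrite !mxE Eij.
Qed.

Lemma mpolyX_fracU (i : 'I_n) :
  (tofrac ('X_i : {mpoly int[n]})) \is a GRing.unit.
Proof.
rewrite unitfE tofrac_eq0; apply/eqP => /(congr1 (fun q => q@_U_(i)%MM)).
by rewrite mcoeffXU eqxx mcoeff0.
Qed.

(** A generalized Vandermonde determinant. Multiplying row [i] by [X_i^N] makes all exponents
    natural numbers; as these are distinct, the monomials for different permutations are distinct,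
    and the one of the identity survives with coefficient 1. *)
Lemma altsum_neq0 x : injective (x 0) -> altsum x != 0.
Proof.
move=> inj_x.
have [N xN] : exists N : nat, forall i, 0 <= x 0 i + N%:Z.
  exists (\sum_i absz (x 0%R i))%N => i; rewrite (bigD1 i) //= PoszD.
  by move: (\sum_(_ | _) _)%N => M; lia.
pose e i : nat := absz (x 0 i + N%:Z).
have eE i : x 0 i + N%:Z = (e i)%:Z by rewrite /e; have := xN i; lia.
have inj_e : injective e.
  by move=> i j Eij; apply: inj_x; have := eE i; rewrite Eij -eE => /addIr.
pose A := \matrix_(i < n, j < n) (tofrac ('X_i : {mpoly int[n]})) ^ (x 0 j).
pose P : 'M[{mpoly int[n]}]_n := \matrix_(i < n, j < n) 'X_i ^+ e j.
have detP : tofrac (\det P) = \det (diag_mx (\row_i tofrac ('X_i : {mpoly int[n]}) ^+ N)) * \det A.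
  rewrite -det_mulmx -det_map_mx; congr (\det _); apply/matrixP => i j.
  rewrite mul_diag_mx !mxE rmorphXn /= !exprnP -expfzDr -?unitfE ?mpolyX_fracU //.
  by rewrite addrC eE.
rewrite altsum_det -/A; suff : \det P != 0.
  by rewrite -tofrac_eq0 detP mulf_eq0 negb_or => /andP[].
pose m (w : 'S_n) := [multinom e (w i) | i < n].
have -> : \det P = \sum_(w : 'S_n) (-1) ^+ w *: 'X_[m w].
  apply: eq_bigr => w _.
  have -> : \prod_i P i (w i) = 'X_[m w].
    by rewrite mpolyXE_id; apply: eq_bigr => i _; rewrite mxE mnmE.
  by rewrite mulr_sign scaler_sign.
apply/eqP => /(congr1 (fun q => q@_(m 1%g))).
rewrite raddf_sum /= mcoeff0 (bigD1 1%g) //= big1 => [|w neq_w1].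
  by rewrite mcoeffZ mcoeffX eqxx odd_perm1.
rewrite mcoeffZ mcoeffX; case: eqP => [Em|]; last by rewrite mulr0.
case/eqP: neq_w1; apply/permP => i; rewrite perm1; apply: inj_e.
by have /mnmP/(_ i) := Em; rewrite !mnmE perm1.
Qed.

(** The denominator is the alternating sum of [rho], whose entries are distinct, hence it is
    nonzero. In this form the condition on characters enters the analysis of steps. *)
Lemma weyl_char_neq0P x : weyl_char (x - rho n) != 0 <-> injective (x 0).
Proof.
have inj_rho : injective (rho n 0).
  move=> i j; rewrite !mxE => -[E]; apply/val_inj; move: E => /=.
  by have := ltn_ord i; have := ltn_ord j; lia.
rewrite /weyl_char subrK; split=> [|inj_x].
  by apply: contra_neqP => /altsum_eq0 ->; rewrite mul0r.
by rewrite mulf_neq0 ?invr_neq0 ?altsum_neq0.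
Qed.

End WeylCharacters.

(** * Steps for GL_n are reversals of pairs *)

Section GLMoves.

Local Open Scope ring_scope.
Import Order.TTheory Num.Theory.

Lemma sum_delta n (F : 'I_n -> int) (i : 'I_n) : \sum_k F k * (k == i)%:R = F i.
Proof.
rewrite (bigD1 i) //= eqxx mulr1 big1 ?addr0 // => k /negbTE ->; exact: mulr0.
Qed.

Lemma pairing_sub n (v : 'rV[int]_n) i j : pairing v (eps i - eps j) = v 0 i - v 0 j.
Proof.
rewrite /pairing -(sum_delta (fun k => v 0 k) i) -(sum_delta (fun k => v 0 k) j) -sumrB.
by apply: eq_bigr => k _; rewrite !mxE eqxx /= mulrBr.
Qed.

Lemma pairing_add n (v : 'rV[int]_n) i j : pairing v (eps i + eps j) = v 0 i + v 0 j.
Proof.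
rewrite /pairing -(sum_delta (fun k => v 0 k) i) -(sum_delta (fun k => v 0 k) j) -big_split.
by apply: eq_bigr => k _; rewrite !mxE eqxx /= mulrDr.
Qed.

Lemma refl_sub p n (v : 'rV[int]_n) i j l : i != j ->
  refl p (eps i - eps j) l v = upd2 v i (v 0 j + l * p%:Z) j (v 0 i - l * p%:Z).
Proof.
move=> neq_ij; apply/rowP => k; rewrite /refl pairing_sub !mxE eqxx /=.
have [->|ki] := eqVneq k i; first by rewrite (negbTE neq_ij); lia.
by have [->|kj] := eqVneq k j; lia.
Qed.

Lemma refl_add p n (v : 'rV[int]_n) i j l : i != j ->
  refl p (eps i + eps j) l v = upd2 v i (l * p%:Z - v 0 j) j (l * p%:Z - v 0 i).
Proof.
move=> neq_ij; apply/rowP => k; rewrite /refl pairing_add !mxE eqxx /=.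
have [->|ki] := eqVneq k i; first by rewrite (negbTE neq_ij); lia.
by have [->|kj] := eqVneq k j; lia.
Qed.

Variables p n s1 s2 : nat.
Hypothesis p_gt0 : (0 < p)%N.
Hypothesis GLvalid : valid p (GL n s1 s2).
Implicit Types (x y v : 'rV[int]_n) (w : 'S_n) (i j : 'I_n).

Local Notation in_top := (in_top p n s1).
Local Notation in_bot := (in_bot p s2).
Local Notation inL x := (@in_Lambda p (GL n s1 s2) x).
Local Notation dia x := (GL_diagram p s1 s2 x).
Let le_n : (s1 + s2 <= n)%N. Proof. by case/and3P: GLvalid. Qed.
Let s1_bd : (0 < s1 <= minn n p)%N. Proof. by case/and3P: GLvalid. Qed.
Let s2_bd : (0 < s2 <= minn n p)%N. Proof. by case/and3P: GLvalid. Qed.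

Lemma GL_diagram_inj x y : inL x -> inL y -> dia x = dia y -> x = y.
Proof.
move=> xL yL; rewrite !GL_diagramE // => eqD.
have [dx wx] := (GL_in_LambdaP p_gt0 x GLvalid).1 xL.
have [dy wy] := (GL_in_LambdaP p_gt0 y GLvalid).1 yL.
apply: (addIr (rho n)) => /=.
by apply: (GL_dia_inj p_gt0 le_n dx dy wx wy) => k _; rewrite eqD.
Qed.

(** The sorting permutation [w] is a parameter, so that it can come from a given step or from
    [sort_exists]. Injectivity is stated before it since the latter choice depends on it. *)
Lemma GL_place x i j (l : int) w : let v := x + rho n in
    let v' := upd2 v i (v 0 j + l * p%:Z) j (v 0 i - l * p%:Z) in
    inL x -> (i < s1)%N -> (n - s2 <= j)%N ->
    in_top (v 0 j + l * p%:Z) -> in_bot (v 0 i - l * p%:Z) ->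
    (forall t : 'I_n, (t < s1)%N -> residue p (v 0 t) <> residue p (v 0 j)) ->
    (forall t : 'I_n, (n - s2 <= t)%N -> residue p (v 0 t) <> residue p (v 0 i)) ->
  injective (v' 0) /\ (sdec (perm_wt w v') ->
  [/\ inL (perm_wt w v' - rho n), GL_orbit p x (perm_wt w v' - rho n) &
      dia (perm_wt w v' - rho n) = flip (dia x) (residue p (v 0 j), residue p (v 0 i))]).
Proof.
move=> v v' xL lt_i le_j top_a bot_c no_top no_bot.
have [dec win] := (GL_in_LambdaP p_gt0 x GLvalid).1 xL.
have Ea : residue p (v 0 j + l * p%:Z) = residue p (v 0 j) by apply: residue_addM.
have Ec : residue p (v 0 i - l * p%:Z) = residue p (v 0 i).
  by rewrite -mulNr; apply: residue_addM.
have [inj_v' win' dia'] := GL_exchange p_gt0 GLvalid (sdec_inj dec) win lt_i le_j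
   top_a bot_c Ea Ec no_top no_bot.
have neq_ij : i != j.
  by apply/eqP => Eij; move: lt_i le_j le_n; rewrite Eij; clear; lia.
split=> // dec'; have win'' := windowed_sort le_n win' dec'.
have [bl' _ _] := win'; have [zw _] := block_sort le_n bl' dec'.
have yL : inL (perm_wt w v' - rho n).
  by apply/(GL_in_LambdaP p_gt0 _ GLvalid); rewrite subrK.
split=> //; last first.
  by rewrite !GL_diagramE // subrK GL_dia_perm.
(* The reflection exchanges the entries [i], [j] and adds [p] times [l (eps_i - eps_j)], whose
   entries sum to zero as the group [H] requires. *)
have Ev' : v' = perm_wt (tperm i j) v + p%:Z *: \row_k (if k == i then l else if k == j then - l else 0).
  apply/rowP => k; rewrite !mxE tpermV; have [->|ki] := eqVneq k i.
    by rewrite tpermL mulrC; lia.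
  have [->|kj] := eqVneq k j; first by rewrite tpermR; lia.
  by rewrite tpermD 1?eq_sym // mulr0 addr0.
exists (tperm i j * w)%g, (perm_wt w (\row_k (if k == i then l else if k == j then - l else 0))).
split.
  rewrite (reindex_inj (@perm_inj _ w)) /=.
  under eq_bigr => k _ do rewrite perm_wtE mxE.
  rewrite (bigD1 i) //= eqxx (bigD1 j) 1?eq_sym //= eqxx.
  rewrite (negbTE neq_ij) big1 ?addr0 ?subrr // => k /andP[/negbTE -> /negbTE ->].
  by [].
rewrite /dot; congr (_ - _); rewrite Ev'; apply/rowP => k; rewrite !mxE.
by rewrite invMg permM.
Qed.

(** A step refers to the actual lengths of the partitions and not to [s1], [s2], so the block
    structure is needed for these too. *)
Lemma GL_block_parts x : decreasing x -> block (len (part1 x)) (len (part2 x)) (x + rho n).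
Proof.
move=> dec; split=> i; rewrite rhoE; have := len_part1 i dec; have := len_part2 i dec;
  have := ltn_ord i; move: (x 0 i) (len _) (len _); clear; lia.
Qed.

Lemma GL_step_move x y : inL x -> decreasing y -> GL_step p x y ->
  inL y /\ move p (GL n s1 s2) (dia x) (dia y).
Proof.
move=> xL dec_y [w [i [j [l]]]] /= [_ /andP[lt_i le_j] [l_ge1]].
have [dec win] := (GL_in_LambdaP p_gt0 x GLvalid).1 xL.
have /and4P[dec_x len1 _ /andP[len2 _]] := xL; rewrite /= in len1 len2 dec_x.
set v := x + rho n in dec win *.
have lt_i1 : (i < s1)%N by apply: leq_trans lt_i len1.
have le_j1 : (n - s2 <= j)%N by apply: leq_trans le_j; rewrite leq_sub2l.
have neq_ij : i != j.
  by apply/eqP => Eij; move: lt_i1 le_j1 le_n; rewrite Eij; clear; lia.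
rewrite pairing_sub => gap; rewrite {1}/dot -/v => /weyl_char_neq0P + Ey.
rewrite refl_sub // in Ey *.
set v' := upd2 _ _ _ _ _ in Ey * => inj_v'.
have [bl _ _] := win; have [top _ bot] := bl.
have [top1 mid1 bot1] := GL_block_parts dec_x; rewrite -/v in top1 mid1 bot1.
have wi := windowed_top win lt_i1; have wj := windowed_bot win le_j1.
have lp_gt0 : p%:Z <= l * p%:Z by rewrite ler_peMl.
have v'i : v' 0 i = v 0 j + l * p%:Z by rewrite mxE eqxx.
have v'j : v' 0 j = v 0 i - l * p%:Z by rewrite mxE eq_sym (negbTE neq_ij) eqxx.
have v'k (k : 'I_n) : k != i -> k != j -> v' 0 k = v 0 k.
  by move=> /negbTE ki /negbTE kj; rewrite mxE ki kj.
(* The middle entries occupy the values l2 + 1, ..., n - l1, so by injectivity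
   the two new values must avoid this interval. *)
have not_mid (k : 'I_n) (a : int) : a = v' 0 k -> k = i \/ k = j ->
    ~ (len (part2 x))%:Z < a <= (n - len (part1 x))%N%:Z.
  move=> Ea Ek a_mid; have [m Em] : exists m : nat, a = m%:Z by exists (absz a); lia.
  have lt_m : (n - m < n)%N by lia.
  have m_mid : (len (part1 x) <= Ordinal lt_m < n - len (part2 x))%N by rewrite /=; lia.
  have mi : Ordinal lt_m != i by apply/eqP => E; move: m_mid lt_i; rewrite E; clear; lia.
  have mj : Ordinal lt_m != j by apply/eqP => E; move: m_mid le_j; rewrite E; clear; lia.
  have : v' 0 (Ordinal lt_m) = v' 0 k.
    by rewrite v'k // mid1 // -Ea Em /=; lia.
  by move/inj_v' => E; case: Ek mi mj => <-; rewrite E eqxx.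
(* A bottom entry plus at least [p] exceeds [s2]; as middle values are excluded it lies above the
   middle, and the gap keeps it below [v 0 i]. Dually for the other new value. *)
have top_a : in_top (v 0 j + l * p%:Z).
  have := not_mid i _ (esym v'i) (or_introl erefl).
  move: wi wj lp_gt0 gap len1 len2 le_n; rewrite /in_top /in_bot.
  by move: (v 0 i) (v 0 j) (l * p%:Z) (len _) (len _); clear; lia.
have bot_c : in_bot (v 0 i - l * p%:Z).
  have := not_mid j _ (esym v'j) (or_intror erefl).
  move: wi wj lp_gt0 gap len1 len2 le_n; rewrite /in_top /in_bot.
  by move: (v 0 i) (v 0 j) (l * p%:Z) (len _) (len _); clear; lia.
have Ea : residue p (v 0 j + l * p%:Z) = residue p (v 0 j) by apply: residue_addM.
have Ec : residue p (v 0 i - l * p%:Z) = residue p (v 0 i).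
  by rewrite -mulNr; apply: residue_addM.
have no_top (t : 'I_n) : (t < s1)%N -> residue p (v 0 t) <> residue p (v 0 j).
  move=> lt_t; rewrite -Ea => /(residue_in_top p_gt0 (windowed_top win lt_t) top_a) Et.
  have [ti|ti] := eqVneq t i; first by move: Et gap; rewrite ti; move: (v 0 i) (v 0 j) (l * _); clear; lia.
  have tj : t != j by apply/eqP => tj; move: lt_t le_j1 le_n; rewrite tj; clear; lia.
  by move: Et; rewrite -v'i -(v'k t) // => /inj_v'/eqP; rewrite (negbTE ti).
have no_bot (t : 'I_n) : (n - s2 <= t)%N -> residue p (v 0 t) <> residue p (v 0 i).
  move=> le_t; rewrite -Ec => /(residue_in_bot p_gt0 (windowed_bot win le_t) bot_c) Et.
  have [tj|tj] := eqVneq t j; first by move: Et gap; rewrite tj; move: (v 0 i) (v 0 j) (l * _); clear; lia.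
  have ti : t != i by apply/eqP => ti; move: lt_i1 le_t le_n; rewrite ti; clear; lia.
  by move: Et; rewrite -v'j -(v'k t) // => /inj_v'/eqP; rewrite (negbTE tj).
have [_] := GL_place w xL lt_i1 le_j1 top_a bot_c no_top no_bot.
rewrite -/v -/v'; have {}Ey : y = perm_wt w v' - rho n by rewrite Ey /dot -/v refl_sub.
have dec' : sdec (perm_wt w v') by rewrite -[perm_wt _ _](subrK (rho n)) -Ey; apply/decreasingP.
move=> /(_ dec'); rewrite -Ey => -[yL _ Edia]; split=> //.
exists Cap, (residue p (v 0 j), residue p (v 0 i)); split=> //.
- apply/(GL_legalP p_gt0 GLvalid).
  (* Old and new value differ by the gap in both windows; this is the common distance [d] of the two
     nodes. *)
  have E1 : v 0 j + l * p%:Z + (v 0 i - v 0 j - l * p%:Z) = v 0 i by lia.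
  have E2 : v 0 j + (v 0 i - v 0 j - l * p%:Z) = v 0 i - l * p%:Z by lia.
  exists (v 0 j + l * p%:Z), (v 0 j), (v 0 i - v 0 j - l * p%:Z); rewrite E1 E2.
  by split=> //; move: gap; move: (v 0 i) (v 0 j) (l * _); clear; lia.
rewrite GL_diagramE // /carries /GL_dia /= -/v; apply/eqP; congr (_, _).
- congr (_, _); first by apply/existsP => -[t /andP[lt_t /eqP]]; apply: no_top.
  by apply/existsP; exists j; rewrite le_j1 eqxx.
- congr (_, _); last by apply/existsP => -[t /andP[le_t /eqP]]; apply: no_bot.
  by apply/existsP; exists i; rewrite lt_i1 eqxx.
Qed.

End GLMoves.

(** * Reversals of pairs are realized by weights of GL_n *)

Section GLFlips.

Local Open Scope ring_scope.
Import Order.TTheory Num.Theory.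

Variables p n s1 s2 : nat.
Hypothesis p_gt0 : (0 < p)%N.
Hypothesis GLvalid : valid p (GL n s1 s2).
Implicit Types (x y v : 'rV[int]_n) (w : 'S_n) (i j : 'I_n) (e : nat * nat).

Local Notation in_top := (in_top p n s1).
Local Notation in_bot := (in_bot p s2).
Local Notation inL x := (@in_Lambda p (GL n s1 s2) x).
Local Notation dia x := (GL_diagram p s1 s2 x).
Let le_n : (s1 + s2 <= n)%N. Proof. by case/and3P: GLvalid. Qed.

Lemma carriesP D c e : carries D c e -> D e.1 = c.1 /\ D e.2 = c.2.
Proof. by rewrite /carries; move: (D e.1) (D e.2) => d1 d2 /eqP <-. Qed.

Lemma GL_dia_up v k : GL_dia p s1 s2 v k = up ->
  (exists2 i : 'I_n, (i < s1)%N & residue p (v 0 i) = k) /\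
  forall i : 'I_n, (n - s2 <= i)%N -> residue p (v 0 i) <> k.
Proof.
case=> /existsP[i /andP[lt_i /eqP Ei]] /existsP none; split; first by exists i.
by move=> j le_j Ej; case: none; exists j; rewrite le_j Ej eqxx.
Qed.

Lemma GL_dia_down v k : GL_dia p s1 s2 v k = down ->
  (exists2 j : 'I_n, (n - s2 <= j)%N & residue p (v 0 j) = k) /\
  forall i : 'I_n, (i < s1)%N -> residue p (v 0 i) <> k.
Proof.
case=> /existsP none /existsP[j /andP[le_j /eqP Ej]]; split; first by exists j.
by move=> i lt_i Ei; case: none; exists i; rewrite lt_i Ei eqxx.
Qed.

Lemma GL_up x e : inL x -> legal p (GL n s1 s2) Cap e ->
  carries (dia x) (clockwise Cap) e ->
  exists y, [/\ inL y, GL_orbit p x y & dia y = flip (dia x) e].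
Proof.
case: e => x0 y0 xL /(GL_legalP p_gt0 GLvalid)[a [c [d [d_gt0 [a1 a2] [c1 c2] [Ea Ea'] [Ec Ec']]]]].
have [_ win] := (GL_in_LambdaP p_gt0 x GLvalid).1 xL.
move=> /carriesP[/= Dx Dy]; rewrite GL_diagramE // in Dx Dy.
have [[i lt_i Ei] no_bot] : (exists2 i : 'I_n, (i < s1)%N & residue p ((x + rho n) 0 i) = x0) /\
  forall i : 'I_n, (n - s2 <= i)%N -> residue p ((x + rho n) 0 i) <> x0 by apply: GL_dia_up.
have [[j le_j Ej] no_top] : (exists2 j : 'I_n, (n - s2 <= j)%N & residue p ((x + rho n) 0 j) = y0) /\
  forall i : 'I_n, (i < s1)%N -> residue p ((x + rho n) 0 i) <> y0 by apply: GL_dia_down.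
have [q Eq] : exists q : int, a = c + q * p%:Z by apply: residue_eq; rewrite // Ea Ec.
have vi : (x + rho n) 0 i = a.
  by apply: (residue_in_top p_gt0 (windowed_top win lt_i) a1); rewrite Ei Ea.
have vj : (x + rho n) 0 j = c + d.
  by apply: (residue_in_bot p_gt0 (windowed_bot win le_j) c2); rewrite Ej Ec'.
have E1 : (x + rho n) 0 j + q * p%:Z = a + d by rewrite vj Eq; lia.
have E2 : (x + rho n) 0 i - q * p%:Z = c by rewrite vi Eq; lia.
have place w := @GL_place p n s1 s2 p_gt0 GLvalid x i j q w xL lt_i le_j.
rewrite /= Ei Ej E1 E2 in place.
have [w dec] := sort_exists (place 1%g a2 c1 no_top no_bot).1.
have [yL orb Ey] := (place w a2 c1 no_top no_bot).2 dec.
by exists (perm_wt w (upd2 (x + rho n) i (a + d) j c) - rho n); rewrite flip_sym; split.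
Qed.

(** Legality provides [a = c + q p]. The top entry is [a + d] and the bottom one [c], and the
    reflection with [l = q] replaces them by [a] and [c + d]. For a step, the indices and the
    permutation must moreover respect the actual lengths, which may be smaller than [s1] and
    [s2]. *)
Lemma GL_down x e : inL x -> legal p (GL n s1 s2) Cap e ->
  carries (dia x) (anticlockwise Cap) e ->
  exists y, [/\ inL y, GL_orbit p x y, GL_step p x y & dia y = flip (dia x) e].
Proof.
case: e => x0 y0 xL /(GL_legalP p_gt0 GLvalid)[a [c [d [d_gt0 [a1 a2] [c1 c2] [Ea Ea'] [Ec Ec']]]]].
have [dec_v win] := (GL_in_LambdaP p_gt0 x GLvalid).1 xL.
move=> /carriesP[/= Dx Dy]; rewrite GL_diagramE // in Dx Dy.
have [[i lt_i Ei] no_bot] : (exists2 i : 'I_n, (i < s1)%N & residue p ((x + rho n) 0 i) = y0) /\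
  forall i : 'I_n, (n - s2 <= i)%N -> residue p ((x + rho n) 0 i) <> y0 by apply: GL_dia_up.
have [[j le_j Ej] no_top] : (exists2 j : 'I_n, (n - s2 <= j)%N & residue p ((x + rho n) 0 j) = x0) /\
  forall i : 'I_n, (i < s1)%N -> residue p ((x + rho n) 0 i) <> x0 by apply: GL_dia_down.
have [q Eq] : exists q : int, a = c + q * p%:Z by apply: residue_eq; rewrite // Ea Ec.
have vi : (x + rho n) 0 i = a + d.
  by apply: (residue_in_top p_gt0 (windowed_top win lt_i) a2); rewrite Ei Ea'.
have vj : (x + rho n) 0 j = c.
  by apply: (residue_in_bot p_gt0 (windowed_bot win le_j) c1); rewrite Ej Ec.
have E1 : (x + rho n) 0 j + q * p%:Z = a by rewrite vj Eq.
have E2 : (x + rho n) 0 i - q * p%:Z = c + d by rewrite vi Eq; lia.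
have place w := @GL_place p n s1 s2 p_gt0 GLvalid x i j q w xL lt_i le_j.
rewrite /= Ei Ej E1 E2 in place.
have inj_v' := (place 1%g a1 c2 no_top no_bot).1.
have [w dec] := sort_exists inj_v'.
have [yL orb Ey] := (place w a1 c2 no_top no_bot).2 dec.
set v' := upd2 _ _ _ _ _ in inj_v' dec yL orb Ey.
exists (perm_wt w v' - rho n); split=> //.
have /and4P[dec_x len1 _ /andP[len2 _]] := xL; rewrite /= in len1 len2 dec_x.
have neq_ij : i != j.
  by apply/eqP => Eij; move: lt_i le_j le_n; rewrite Eij; clear; lia.
have x_top (t : 'I_n) : (t < s1)%N -> (len (part1 x) <= t)%N -> (x + rho n) 0 t = (n - t)%N%:Z.
  move=> lt_t le_t; rewrite rhoE.
  have := len_part1 t dec_x; have := len_part2 t dec_x; move: le_t lt_t len2 le_n.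
  by move: (x 0 t) (len _) (len _); clear; lia.
have x_bot (t : 'I_n) : (n - s2 <= t)%N -> (t < n - len (part2 x))%N ->
    (x + rho n) 0 t = (n - t)%N%:Z.
  move=> le_t lt_t; rewrite rhoE.
  have := len_part1 t dec_x; have := len_part2 t dec_x; move: le_t lt_t len1 le_n.
  by move: (x 0 t) (len _) (len _); clear; lia.
have n_gt0 : (0 < n)%N by apply: leq_ltn_trans (ltn_ord i).
have a_top (t : 'I_n) : (t < s1)%N -> (x + rho n) 0 t <> a.
  by move=> lt_t Et; apply: (no_top t lt_t); rewrite Et Ea.
have c_bot (t : 'I_n) : (n - s2 <= t)%N -> (x + rho n) 0 t <> c + d.
  by move=> le_t Et; apply: (no_bot t le_t); rewrite Et Ec'.
(* Otherwise [a] is the entry of [rho] at a place from [len (part1 x)] up to [s1 - 1], where [x]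
   vanishes, and the node of [a] would already carry an up. Dually for [c + d]. *)
have a_gt : (n - len (part1 x))%N%:Z < a.
  rewrite ltNge; apply/negP => le_a.
  have [m Em] : exists m : nat, a = m%:Z.
    by exists (absz a); move: a1; rewrite /in_top; move: (a); clear; lia.
  have lt_m : (n - m < n)%N by move: a1 n_gt0; rewrite Em /in_top; clear; lia.
  apply: (a_top (Ordinal lt_m)); rewrite ?x_top /=; rewrite ?Em;
    by move: a1 le_a len1 le_n; rewrite Em /in_top; move: (len _); clear; lia.
have c_le : c + d <= (len (part2 x))%:Z.
  rewrite leNgt; apply/negP => lt_c.
  have [m Em] : exists m : nat, c + d = m%:Z.
    by exists (absz (c + d)%R); move: lt_c; move: (c + d) (len _); clear; lia.
  have lt_m : (n - m < n)%N by move: lt_c n_gt0 c2; rewrite Em /in_bot; move: (len _); clear; lia.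
  apply: (c_bot (Ordinal lt_m)); rewrite ?x_bot /=; rewrite ?Em;
    by move: c2 lt_c len2 le_n; rewrite Em /in_bot; move: (len _); clear; lia.
have lt_i1 : (i < len (part1 x))%N.
  rewrite ltnNge; apply/negP => le_i; have := x_top i lt_i le_i; rewrite vi => Ei'.
  move: a_gt le_i d_gt0 Ei'; move: (len _) => ln; have := ltn_ord i; move: (a) (d) => a' d'.
  by clear; lia.
have le_j1 : (n - len (part2 x) <= j)%N.
  rewrite leqNgt; apply/negP => lt_j; have := x_bot j le_j lt_j; rewrite vj => Ej'.
  move: c_le lt_j d_gt0 Ej'; move: (len _) => ln; have := ltn_ord j; move: (c) (d) => c' d'.
  by clear; lia.
have refl_v : refl p (eps i - eps j) q (x + rho n) = v' by rewrite refl_sub // E1 E2.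
have len12 : (len (part1 x) + len (part2 x) <= n)%N by rewrite (leq_trans (leq_add len1 len2)).
exists w, i, j, q => /=; rewrite /dot refl_v; split=> //.
- apply: (block_sort_on len12 _ dec); have [top mid bot] := GL_block_parts dec_x.
  have v'k (k : 'I_n) : k != i -> k != j -> v' 0 k = (x + rho n) 0 k.
    by move=> /negbTE ki /negbTE kj; rewrite mxE ki kj.
  have v'i : v' 0 i = a by rewrite mxE eqxx.
  have v'j : v' 0 j = c + d by rewrite mxE eq_sym (negbTE neq_ij) eqxx.
  split=> k.
  + have [->|ki] := eqVneq k i; first by rewrite v'i.
    move=> lt_k; rewrite v'k ?top //; apply/eqP => kj; move: lt_k le_j1 len12.
    by rewrite kj; move: (len _) (len _); clear; lia.
  + move=> k_mid; rewrite v'k ?mid //; apply/eqP => Ek; move: k_mid lt_i1 le_j1; rewrite Ek;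
      by move: (len _) (len _); clear; lia.
  + have [->|kj] := eqVneq k j; first by rewrite v'j.
    move=> le_k; rewrite v'k ?bot //; apply/eqP => ki; move: le_k lt_i1 len12.
    by rewrite ki; move: (len _) (len _); clear; lia.
- by rewrite lt_i1.
- rewrite pairing_sub; split.
    (* Here [q p = a - c] is positive because the top window lies above the bottom one:
       [s2 <= n - s1]. *)
    rewrite -gtz0_ge1 -(pmulr_lgt0 _ (_ : 0 < p%:Z)) //.
    by move: a1 c1 le_n Eq; rewrite /in_top /in_bot; move: (q * _); clear; lia.
  by move: E1 vi d_gt0; move: ((x + rho n) 0 i) ((x + rho n) 0 j) (q * _); clear; lia.
by apply/weyl_char_neq0P.
Qed.

End GLFlips.

(** * Steps of the order for the symplectic group *)

Section SpCoordinates.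

Local Open Scope ring_scope.
Import Order.TTheory Num.Theory.

Variables p m s : nat.
Hypothesis Spvalid : valid p (Sp m s).

Let p_odd : odd p. Proof. by case/andP: Spvalid. Qed.
Let s_bd : (0 < s <= minn m p)%N. Proof. by case/andP: Spvalid. Qed.
Let p_gt0 : (0 < p)%N. Proof. by case: p p_odd. Qed.
Let p_half : p = (p./2 + p./2).+1. Proof. by rewrite -[LHS]odd_double_half p_odd addnn. Qed.

Definition wall : nat := let t := ((m - s) %% p)%N in minn t.+1 (p - t).

(** Write [m - s = q p + t] with [t < p]; the window starts after this integer. The labels of a node
    [k] left of the wall are represented by [(q + 1) p + k] and [(q + 1) p - k]. Right of the wall
    they are represented by [base_right + k] and [base_right + p - k], where [base_right] is [q p]
    if [t <= p./2] and [(q + 1) p] otherwise. *)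
Definition base_left : int := ((m - s) %/ p)%N.+1%:Z * p%:Z.
Definition base_right : int :=
  (if ((m - s) %% p)%N < p./2.+1 then (m - s) %/ p else ((m - s) %/ p).+1)%N%:Z * p%:Z.

(* The unique representatives of the two labels of node k in the window that
   contains the first s entries of lambda + rho. *)
Definition up_value (k : nat) : int :=
  if (k < wall)%N then base_left + k%:Z else base_right + k%:Z.
Definition down_value (k : nat) : int :=
  if (k < wall)%N then base_left - k%:Z else base_right + p%:Z - k%:Z.
(** The reflection for [eps_i + eps_j] turns entries [a], [c] into [l p - c], [l p - a]. To reverse
    the arrows at two nodes, [l p] must be the sum of the two representatives at each of them; this
    sum depends on the side only. *)
Definition mirror_sum (k : nat) : int :=
  if (k < wall)%N then base_left *+ 2 else base_right *+ 2 + p%:Z.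

Lemma up_down_value k : up_value k + down_value k = mirror_sum k.
Proof. by rewrite /up_value /down_value /mirror_sum; case: ifP => _; clear; lia. Qed.

Lemma mirror_mulP k : exists l : int, mirror_sum k = l * p%:Z.
Proof.
rewrite /mirror_sum /base_left /base_right; case: ifP => _.
  by exists (((m - s) %/ p)%N.+1%:Z *+ 2); clear; lia.
by move: (if _ then _ else _) => q; exists (q%:Z *+ 2 + 1); clear; lia.
Qed.

Lemma wall_gt0 : (0 < wall)%N.
Proof. by rewrite /wall leq_min /= subn_gt0 ltn_pmod. Qed.

Lemma value_node0 : up_value 0 = down_value 0.
Proof. by rewrite /up_value /down_value wall_gt0; lia. Qed.

Lemma value_window k : (k <= p./2)%N ->
  in_top p m s (up_value k) /\ in_top p m s (down_value k).
Proof.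
rewrite /in_top /up_value /down_value /wall /base_left /base_right => le_k.
have := divn_eq (m - s) p; have := ltn_pmod (m - s) p_gt0.
move: (m - s)%N ((m - s) %/ p)%N ((m - s) %% p)%N => T q t lt_t ET.
have {}ET : T%:Z = q%:Z * p%:Z + t%:Z by rewrite ET PoszD PoszM.
have Eq1 : q.+1%:Z * p%:Z = q%:Z * p%:Z + p%:Z by lia.
have := p_half; move: (p./2) le_k => h le_k Ep.
have lt_k : (k < minn t.+1 (p - t))%N = (k <= t)%N && (k < p - t)%N by rewrite leq_min.
rewrite lt_k; case: ifP => [/andP[k1 k2]|kn]; rewrite ?Eq1.
  by move: (q%:Z * p%:Z) ET => M ET; split; lia.
case: ifP => lt_h; rewrite ?Eq1; move: (q%:Z * p%:Z) ET => M ET; split; lia.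
Qed.

Lemma residue_up_value k : (k <= p./2)%N -> residue p (up_value k) = k.
Proof.
move=> le_k; have lt_k : (k < p)%N by have := p_half; lia.
by rewrite /up_value /base_left /base_right; case: ifP => _; rewrite residue_mulD.
Qed.

Definition nres (r : nat) : nat := if r == 0%N then 0%N else (p - r)%N.

Lemma residue_opp (l z : int) : residue p (l * p%:Z - z) = nres (residue p z).
Proof.
have [q ->] := residueE p_gt0 z; rewrite residue_mulD ?residue_lt //.
have := residue_lt p_gt0 z; move: (residue p z) => r lt_r; rewrite /nres.
have [->|r_neq0] := eqVneq r 0%N.
  by rewrite (_ : _ - _ = (l - q) * p%:Z + 0%:Z) ?residue_mulD //; lia.
rewrite (_ : _ - _ = (l - q - 1) * p%:Z + (p - r)%N%:Z) ?residue_mulD //; first by lia.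
rewrite -subzn; last by lia.
by lia.
Qed.

Lemma residue_down_value k : (k <= p./2)%N -> residue p (down_value k) = nres k.
Proof.
move=> le_k; have -> : down_value k = mirror_sum k - up_value k by rewrite -up_down_value; lia.
by have [l ->] := mirror_mulP k; rewrite residue_opp residue_up_value.
Qed.

Definition node (r : nat) : nat := if (r <= p./2)%N then r else (p - r)%N.

Lemma node_le r : (r < p)%N -> (node r <= p./2)%N.
Proof. by rewrite /node; case: ifP => // + lt_r; have := p_half; lia. Qed.

(** The sum is an even multiple of [p] left of the wall and an odd one right of it. *)
Lemma mirror_side x y : mirror_sum x = mirror_sum y -> (x < wall)%N = (y < wall)%N.
Proof.
rewrite /mirror_sum /base_left /base_right; case: (x < wall)%N; case: (y < wall)%N => //;
  have := p_half; move: (p./2) (if _ then _ else _) => h q; nia.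
Qed.

Lemma subseq2_iota x y c k :
  subseq [:: x; y] (iota c k) = (c <= x)%N && (x < y)%N && (y < c + k)%N.
Proof.
have -> : iota c k = [seq (c + t)%N | t <- iota 0 k] by rewrite -iotaDl addn0.
apply/idP/idP => [/subseq2_map_iota[i [j [lt_ij <- <-]]]|/andP[/andP[le_cx lt_xy] lt_y]].
  by move: lt_ij; clear; lia.
by apply/subseq2_map_iota; exists (x - c)%N, (y - c)%N; split; lia.
Qed.

Lemma Sp_sidesE : sides p (Sp m s) = (iota 0 wall, iota wall (p./2.+1 - wall)).
Proof.
by have Eh : p.+1./2 = p./2.+1 by [have := p_half; lia]; rewrite /sides -/wall Eh.
Qed.

Lemma Sp_legalE k x y : legal p (Sp m s) k (x, y) =
  [&& (x < y)%N, (y <= p./2)%N &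
   match k with
   | Cap => (x < wall)%N == (y < wall)%N
   | LeftCurl => (y < wall)%N
   | RightCurl => (wall <= x)%N
   end].
Proof.
have wall_le : (wall <= p./2.+1)%N.
  by rewrite /wall; have := ltn_pmod (m - s) p_gt0; have := p_half; lia.
rewrite /legal Sp_sidesE; case: k; rewrite !subseq2_iota /=;
  by move: wall_le; move: (wall) (p./2); clear; lia.
Qed.

End SpCoordinates.

(** * The effect of a reflection on diagrams for Sp_n *)

Section SpExchange.

Local Open Scope ring_scope.
Import Order.TTheory Num.Theory.

Variables p m s : nat.
Hypothesis Spvalid : valid p (Sp m s).
Implicit Types (v x y : 'rV[int]_m) (w : 'S_m) (i j t : 'I_m).

Let p_odd : odd p. Proof. by case/andP: Spvalid. Qed.
Let p_gt0 : (0 < p)%N. Proof. by case: p p_odd. Qed.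
Let p_half : p = (p./2 + p./2).+1. Proof. by rewrite -[LHS]odd_double_half p_odd addnn. Qed.

Local Notation res v t := (residue p (v 0 t)).

Lemma nresK r : (r < p)%N -> nres p (nres p r) = r.
Proof.
rewrite /nres; case: (eqVneq r 0%N) => [-> //|r0 lt_r].
by case: eqP; move: r0 lt_r; clear; lia.
Qed.

Lemma node_nres r : (r < p)%N -> node p (nres p r) = node p r.
Proof.
rewrite /node /nres; case: (eqVneq r 0%N) => [-> //|r0 lt_r].
by have := p_half; move: (p./2) => h Ep; do ?case: ifP; lia.
Qed.

Lemma node_eq r1 r2 : (r1 < p)%N -> (r2 < p)%N -> node p r1 = node p r2 ->
  r1 = r2 \/ r1 = nres p r2.
Proof.
rewrite /node /nres => lt1 lt2; have := p_half; move: (p./2) => h Ep.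
by case: (eqVneq r2 0%N) => [->|r0]; rewrite ?leq0n; do ?case: ifP; lia.
Qed.

Lemma node_id k : (k <= p./2)%N -> node p k = k.
Proof. by rewrite /node => ->. Qed.

Lemma node_sub k : (0 < k <= p./2)%N -> node p (p - k) = k.
Proof. by move=> k_bd; rewrite /node; have := p_half; move: (p./2) k_bd => h k_bd; case: ifP; lia. Qed.

Definition lab v r := [exists t : 'I_m, (t < s)%N && (res v t == r)].

Lemma labP v r : reflect (exists2 t : 'I_m, (t < s)%N & res v t = r) (lab v r).
Proof.
apply: (iffP existsP) => [[t /andP[lt_t /eqP Et]]|[t lt_t Et]]; exists t => //.
by rewrite lt_t Et eqxx.
Qed.

(** Entry [i] takes the other label of the node of [j] and conversely. No further entry sits at
    these two nodes, so each keeps exactly one arrow, reversed. *)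
Lemma Sp_exchange b v v' i j : (i < s)%N -> (j < s)%N -> i != j ->
    (forall t1 t2 : 'I_m, (t1 < s)%N -> (t2 < s)%N -> res v t1 = res v t2 -> t1 = t2) ->
    res v' i = nres p (res v j) -> res v' j = nres p (res v i) ->
    (forall t : 'I_m, t != i -> t != j -> v' 0 t = v 0 t) ->
    (forall t : 'I_m, (t < s)%N -> t != i -> res v t <> nres p (res v i)) ->
    (forall t : 'I_m, (t < s)%N -> t != j -> res v t <> nres p (res v j)) ->
  Sp_dia p s b v' = flip (Sp_dia p s b v) (node p (res v i), node p (res v j)).
Proof.
move=> lt_i lt_j neq_ij inj_v Ei Ej v'E no_i no_j.
have lt_res z := residue_lt p_gt0 z.
have not_i (t : 'I_m) : (t < s)%N -> t != i -> (node p (res v t) == node p (res v i)) = false.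
  move=> lt_t ti; apply/eqP => /(node_eq (lt_res (v 0 t)) (lt_res (v 0 i)))[E|]; last exact: no_i.
  by rewrite (inj_v _ _ lt_t lt_i E) eqxx in ti.
have not_j (t : 'I_m) : (t < s)%N -> t != j -> (node p (res v t) == node p (res v j)) = false.
  move=> lt_t tj; apply/eqP => /(node_eq (lt_res (v 0 t)) (lt_res (v 0 j)))[E|]; last exact: no_j.
  by rewrite (inj_v _ _ lt_t lt_j E) eqxx in tj.
(* A label [r] occurs in [v'] iff [tw r] occurs in [v]: labels at the two nodes are replaced by
   their opposites. *)
pose tw r := if (node p r == node p (res v i)) || (node p r == node p (res v j))
             then nres p r else r.
have labE r : (r < p)%N -> lab v' r = lab v (tw r).
  move=> lt_r; apply/labP/labP => -[t lt_t].
    have [->|ti] := eqVneq t i.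
      rewrite Ei => <-; exists j => //.
      by rewrite /tw node_nres // eqxx orbT nresK.
    have [->|tj] := eqVneq t j.
      rewrite Ej => <-; exists i => //.
      by rewrite /tw node_nres // eqxx nresK.
    by rewrite v'E // => Et; exists t => //; rewrite /tw -Et not_i // not_j.
  rewrite /tw; case: eqP => [/(node_eq lt_r (lt_res (v 0 i)))[]->|ni] /=.
  - have [->|ti] := eqVneq t i; last by move/(no_i t lt_t ti).
    by move=> E; exists j; rewrite // Ej -E.
  - by move=> _; exists j.
  case: eqP => [/(node_eq lt_r (lt_res (v 0 j)))[]->|nj].
  - have [->|tj] := eqVneq t j; last by move/(no_j t lt_t tj).
    by move=> E; exists i; rewrite // Ei -E.
  - by move=> _; exists i.
  move=> Et; exists t => //; rewrite v'E //.
    by apply/eqP => ti; case: ni; rewrite -Et ti.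
  by apply/eqP => tj; case: nj; rewrite -Et tj.
pose small r := (0 < r <= p./2)%N.
pose u := #|[set t : 'I_m | (t < s)%N && small (res v t)]|.
pose u' := #|[set t : 'I_m | (t < s)%N && small (res v' t)]|.
have cardE (Q : pred 'I_m) : #|[set t | Q t]| = (\sum_t Q t)%N.
  by rewrite -sum1_card big_mkcond; apply: eq_bigr => t _; rewrite inE; case: (Q t).
have small_nres r : (r < p)%N -> small (nres p r) = (r != 0%N) (+) small r.
  rewrite /small /nres => lt_r; have := p_half; move: (p./2) => h Ep.
  by case: (eqVneq r 0%N) => [->|r0] /=; lia.
(* Each reversal at a node other than 0 changes the parity of the ups there. If one of the two nodes
   is node 0, exactly one such change remains, and the parity convention reverses the arrow at node
   0; otherwise the changes cancel and it stays. *)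
have odd_u : odd u' = odd u (+) (res v i != 0%N) (+) (res v j != 0%N).
  have split_sum (Q : pred 'I_m) : (\sum_t Q t = Q i + (Q j + \sum_(t | (t != i) && (t != j)) Q t))%N.
    by rewrite (bigD1 i) //= (bigD1 j) //= eq_sym.
  rewrite /u /u' !cardE !split_sum lt_i lt_j Ei Ej !small_nres // !oddD !oddb.
  rewrite (eq_bigr (fun t : 'I_m => ((t < s)%N && small (res v t) : nat))); last first.
    by move=> t /andP[ti tj]; rewrite v'E.
  by rewrite /=; case: (_ != 0)%N; case: (_ != 0)%N; case: (small _); case: (small _);
     rewrite /= ?addbT ?addbF ?negbK.
have neq_node : node p (res v i) != node p (res v j).
  by rewrite not_j.
have node0 r : (r < p)%N -> (0%N == node p r) = (r == 0%N).
  rewrite /node => lt_r; have := p_half; move: (p./2) => h Ep.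
  by case: ifP; lia.
apply/funext => k; rewrite /flip /= /Sp_dia -!/(lab _ _).
rewrite -/(small _) -/u -/u'.
have [->|k_neq0] := eqVneq k 0%N.
  have -> : lab v' 0 = lab v 0.
    by rewrite labE // /tw /nres eqxx; case: ifP.
  rewrite odd_u !node0 // /opp_arrow /=.
  move: neq_node.
  case: (eqVneq (res v i) 0%N) => Ei0; case: (eqVneq (res v j) 0%N) => Ej0 /=;
    rewrite ?addbT ?addbF ?negbK //.
  - by rewrite Ei0 Ej0 eqxx.
  - by move=> _; case: (odd u); case: b; case: (lab v 0).
  - by move=> _; case: (odd u); case: b; case: (lab v 0).
case: leqP => [le_k|lt_k]; last by case: ifP.
have lt_k : (k < p)%N by have := p_half; move: (p./2) le_k; clear; lia.
have lt_pk : (p - k < p)%N by move: k_neq0 p_gt0; clear; lia.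
rewrite !labE // /tw node_id // node_sub ?lt0n ?k_neq0 //.
case: ifP => // _; rewrite /opp_arrow /=.
have -> : nres p k = (p - k)%N by rewrite /nres (negbTE k_neq0).
by have -> : nres p (p - k) = k by rewrite -{2}(nresK lt_k) /nres (negbTE k_neq0).
Qed.

End SpExchange.

(** * Permutations in the orbit group, and the entries behind single arrows, for Sp_n *)

Section SpMoves.

Local Open Scope ring_scope.
Import Order.TTheory Num.Theory.

Lemma perm_wtM m (w1 w2 : 'S_m) (v : 'rV[int]_m) :
  perm_wt (w1 * w2)%g v = perm_wt w2 (perm_wt w1 v).
Proof. by apply/rowP => i; rewrite !mxE invMg permM. Qed.

Lemma upd2C m (v : 'rV[int]_m) i a j c : i != j -> upd2 v i a j c = upd2 v j c i a.
Proof.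
move=> neq_ij; apply/rowP => k; rewrite !mxE.
by have [->|//] := eqVneq k i; rewrite (negbTE neq_ij).
Qed.

Lemma Sp_orbit_trans p m s (x y z : 'rV[int]_m) :
  Sp_orbit p s x y -> Sp_orbit p s y z -> Sp_orbit p s x z.
Proof.
by move=> xy; elim=> // {}z alpha l _ xz Da; apply: Sp_orbit_step.
Qed.

Lemma Sp_orbit_tperm p m s (x : 'rV[int]_m) (i j : 'I_m) :
  (i < s)%N -> (j < s)%N -> Sp_orbit p s x (dot (perm_wt (tperm i j)) x).
Proof.
wlog lt_ij : i j / (i < j)%N => [IH lt_i lt_j|lt_i lt_j].
  case: (ltngtP i j) => [/IH|/IH|/val_inj ->]; first exact.
    by rewrite tpermC; apply.
  have -> : dot (perm_wt (tperm j j)) x = x; last exact: Sp_orbit_refl.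
  rewrite /dot tperm1 [perm_wt _ _](_ : _ = x + rho m) ?addrK //.
  by apply/rowP => k; rewrite !mxE invg1 perm1.
have neq_ij : i != j by apply/eqP => Eij; rewrite Eij ltnn in lt_ij.
have -> : dot (perm_wt (tperm i j)) x = dot (refl p (eps i - eps j) 0) x.
  rewrite /dot refl_sub // mul0r addr0 subr0; congr (_ - _); apply/rowP => k.
  rewrite mxE [RHS]mxE tpermV; have [->|ki] := eqVneq k i; first by rewrite tpermL.
  have [->|kj] := eqVneq k j; first by rewrite tpermR.
  by rewrite tpermD 1?eq_sym.
apply: Sp_orbit_step; first exact: Sp_orbit_refl.
by exists i, j; rewrite lt_ij lt_j; split=> //; right.
Qed.

(** Transpositions are the reflections for [eps_i - eps_j] with [l = 0]. Induction on the number of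
    moved points: composing with [tperm k (w k)] makes [k] fixed and keeps all fixed points. *)
Lemma Sp_orbit_perm p m s (w : 'S_m) (x : 'rV[int]_m) :
  (forall k : 'I_m, (s <= k)%N -> w k = k) -> Sp_orbit p s x (dot (perm_wt w) x).
Proof.
have [c] := ubnP #|[set k | w k != k]|; elim: c w x => // c IH w x lt_c fix_w.
have [k wk|all_fix] := pickP (fun k => w k != k); last first.
  have -> : w = 1%g by apply/permP => k; rewrite perm1; apply/eqP/negbFE/all_fix.
  rewrite /dot [perm_wt _ _](_ : _ = x + rho m) ?addrK; first exact: Sp_orbit_refl.
  by apply/rowP => k; rewrite !mxE invg1 perm1.
have lt_k : (k < s)%N by rewrite ltnNge; apply: contra wk => /fix_w ->.
have lt_wk : (w k < s)%N.
  by rewrite ltnNge; apply: contra wk => /fix_w /perm_inj ->.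
pose w' := (w * tperm k (w k))%g.
have w'_fix t : w t = t -> w' t = t.
  move=> wt; have kt : k != t by apply/eqP => kt; rewrite kt wt eqxx in wk.
  rewrite /w' permM wt tpermD //; apply: contra_neq kt => E.
  by apply: (@perm_inj _ w); rewrite E.
have w'k : w' k = k by rewrite /w' permM tpermR.
have -> : w = (w' * tperm k (w k))%g by rewrite /w' -mulgA tperm2 mulg1.
have -> : dot (perm_wt (w' * tperm k (w k))) x =
    dot (perm_wt (tperm k (w k))) (dot (perm_wt w') x).
  by rewrite /dot perm_wtM subrK.
apply: (@Sp_orbit_trans _ _ _ _ (dot (perm_wt w') x)); last exact: Sp_orbit_tperm.
apply: IH => [|t le_t]; last by apply: w'_fix; apply: fix_w.
rewrite -ltnS (leq_trans _ lt_c) // ltnS; apply: proper_card; apply/properP; split.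
  by apply/subsetP => t; rewrite !inE; apply: contra => /eqP /w'_fix ->.
by exists k; rewrite !inE ?w'k ?eqxx.
Qed.

Variables p m s : nat.
Hypothesis Spvalid : valid p (Sp m s).
Implicit Types (x y v : 'rV[int]_m) (w : 'S_m) (i j : 'I_m).

Let p_odd : odd p. Proof. by case/andP: Spvalid. Qed.
Let s_bd : (0 < s <= minn m p)%N. Proof. by case/andP: Spvalid. Qed.
Let le_sm : (s <= m)%N. Proof. by move: s_bd; clear; lia. Qed.
Let le_s0m : (s + 0 <= m)%N. Proof. by rewrite addn0. Qed.
Let p_gt0 : (0 < p)%N. Proof. by case: p p_odd. Qed.
Let p_half : p = (p./2 + p./2).+1. Proof. by rewrite -[LHS]odd_double_half p_odd addnn. Qed.

Local Notation in_top := (in_top p m s).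
Local Notation inL x := (@in_Lambda p (Sp m s) x).
Local Notation dia b x := (Sp_diagram p s b x).
Local Notation res v t := (residue p (v 0 t)).
Local Notation uval := (up_value p m s).
Local Notation dval := (down_value p m s).
Local Notation mirror := (mirror_sum p m s).
Local Notation wall := (wall p m s).

Lemma Sp_res_inj v : injective (v 0) -> windowed p s 0 v ->
  forall i j, (i < s)%N -> (j < s)%N -> res v i = res v j -> i = j.
Proof.
move=> inj_v win i j lt_i lt_j Er; apply: inj_v.
exact: (residue_in_top p_gt0 (windowed_top win lt_i) (windowed_top win lt_j)).
Qed.

(** The node of entry [i] carries a single arrow and not a cross. *)
Definition mirror_free v i : Prop :=
  forall t : 'I_m, (t < s)%N -> t != i -> res v t <> nres p (res v i).

Lemma Sp_dia_arrow b v k : injective (v 0) -> windowed p s 0 v ->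
    single (Sp_dia p s b v k) ->
  (k <= p./2)%N /\ exists i, [/\ (i < s)%N, node p (res v i) = k, mirror_free v i
    & v 0 i = if Sp_dia p s b v k == up then uval k else dval k].
Proof.
move=> inj_v win; have inj_r := Sp_res_inj inj_v win; rewrite {1}/Sp_dia -!/(lab _ _ _ _).
have [->|k_neq0] := eqVneq k 0%N.
  move=> sgl; split=> //; have /labP[i lt_i Ei] : lab p s v 0.
    by move: sgl; case: (lab p s v 0).
  exists i; split=> //; first by rewrite Ei.
    by move=> t lt_t ti; rewrite Ei => /= Et; case/eqP: ti; apply: inj_r; rewrite ?Ei.
  (* At node 0 the two representatives coincide, so either direction of the arrow stands for the
     same entry. *)
  rewrite -(value_node0 Spvalid) if_same; apply: (residue_in_top p_gt0 (windowed_top win lt_i)).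
    by case: (value_window Spvalid (leq0n p./2)).
  by rewrite Ei residue_up_value.
case: ifP => // le_k sgl; split=> //; have [u_top d_top] := value_window Spvalid le_k.
have lt_kp : (k < p)%N by move: le_k p_half; clear; lia.
have Nk : nres p k = (p - k)%N by rewrite /nres (negbTE k_neq0).
have Dk : Sp_dia p s b v k = (lab p s v k, lab p s v (p - k)%N).
  by rewrite /Sp_dia (negbTE k_neq0) le_k.
rewrite Dk; case Lk: (lab p s v k) sgl; case Lpk: (lab p s v (p - k)%N) => //= _.
  have /labP[i lt_i Ei] := Lk; exists i; split=> //; first by rewrite Ei node_id.
    move=> t lt_t _; rewrite Ei Nk => Et; suff: lab p s v (p - k)%N by rewrite Lpk.
    by apply/labP; exists t.
  by apply: (residue_in_top p_gt0 (windowed_top win lt_i) u_top); rewrite Ei residue_up_value.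
have /labP[i lt_i Ei] := Lpk; exists i; split=> //.
  by rewrite Ei (node_sub Spvalid) // lt0n k_neq0.
  move=> t lt_t _; rewrite Ei -Nk nresK // => Et; suff: lab p s v k by rewrite Lk.
  by apply/labP; exists t.
by apply: (residue_in_top p_gt0 (windowed_top win lt_i) d_top); rewrite Ei residue_down_value.
Qed.

Lemma Sp_dia_content b v i : injective (v 0) -> windowed p s 0 v -> (i < s)%N ->
    mirror_free v i -> let k := node p (res v i) in
  Sp_dia p s b v k = up /\ v 0 i = uval k \/ Sp_dia p s b v k = down /\ v 0 i = dval k.
Proof.
move=> inj_v win lt_i free k; have lt_r := residue_lt p_gt0 (v 0 i).
have le_k : (k <= p./2)%N := node_le Spvalid lt_r.
have [u_top d_top] := value_window Spvalid le_k.
have sgl : single (Sp_dia p s b v k).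
  rewrite /Sp_dia -!/(lab _ _ _ _) le_k; case: (eqVneq k 0%N) => [k0|k_neq0].
    have -> : lab p s v 0.
      apply/labP; exists i => //; move: k0; rewrite /k /node.
      by case: ifP => // _; move: lt_r; clear; lia.
    by case: (odd _); case: (b).
  have lab_i : lab p s v (res v i) by apply/labP; exists i.
  have nres_neq : nres p (res v i) <> res v i.
    rewrite /nres; move: k_neq0 lt_r p_half; rewrite /k /node.
    by move: (res v i) (p./2) => r h; clear; do ?case: ifP; lia.
  have lab_n : lab p s v (nres p (res v i)) = false.
    apply/labP => -[t lt_t Et]; have [ti|ti] := eqVneq t i.
      by apply: nres_neq; rewrite -Et ti.
    exact: (free t lt_t ti Et).
  move: k_neq0 lab_i lab_n; rewrite /k /node /nres; move: (res v i) lt_r => r lt_r.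
  case: ifP => le_r r0; first by rewrite (negbTE r0) => -> ->.
  case: ifP => [/eqP E|_]; first by rewrite E in le_r.
  by rewrite subKn 1?ltnW // => -> ->.
have [_ [j [lt_j Ej _ Ev]]] := Sp_dia_arrow inj_v win sgl.
have -> : i = j.
  case: (node_eq Spvalid (residue_lt p_gt0 (v 0 j)) lt_r Ej) => E.
    by apply: (Sp_res_inj inj_v win) => //; rewrite E.
  by apply/eqP/negPn/negP => neq_ij; apply: (free j lt_j _ E); rewrite eq_sym.
by move: sgl Ev => /singleP[] -> ->; auto.
Qed.

Lemma Sp_diagram_inj b x y : inL x -> inL y -> dia b x = dia b y -> x = y.
Proof.
move=> xL yL; rewrite !Sp_diagramE // => eqD.
have [dx wx] := (Sp_in_LambdaP p_gt0 x Spvalid).1 xL.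
have [dy wy] := (Sp_in_LambdaP p_gt0 y Spvalid).1 yL.
apply: (addIr (rho m)) => /=.
apply: (GL_dia_inj p_gt0 le_s0m dx dy wx wy) => r lt_r; rewrite /GL_dia.
have none v k : [exists i : 'I_m, (m - 0 <= i)%N && (residue p (v 0 i) == k)] = false.
  by apply/existsP => -[i]; rewrite subn0 leqNgt ltn_ord.
rewrite !none -!/(lab _ _ _ _); congr (_, _).
have [le_r|lt_r2] := leqP r p./2; have := congr1 (fun D => D (node p r)) eqD;
  rewrite /Sp_dia -!/(lab _ _ _ _) /node.
  rewrite le_r; have [-> []|_] := eqVneq r 0%N; last by rewrite le_r => -[].
  by case: (lab p s (x + _) 0); case: (lab p s (y + _) 0) => //;
     case: (odd _); case: (odd _); case: (b).
rewrite (leqNgt r) lt_r2 /=; have -> : (p - r == 0)%N = false by move: lt_r; clear; lia.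
have -> : (p - r <= p./2)%N by move: lt_r2 p_half; clear; lia.
by rewrite subKn 1?ltnW // => -[].
Qed.

End SpMoves.

(** * Reversals of pairs are realized by weights of Sp_n *)

Section SpFlips.

Local Open Scope ring_scope.
Import Order.TTheory Num.Theory.

Variables p m s : nat.
Hypothesis Spvalid : valid p (Sp m s).
Implicit Types (x y v : 'rV[int]_m) (w : 'S_m) (i j : 'I_m).

Let p_odd : odd p. Proof. by case/andP: Spvalid. Qed.
Let s_bd : (0 < s <= minn m p)%N. Proof. by case/andP: Spvalid. Qed.
Let le_sm : (s <= m)%N. Proof. by move: s_bd; clear; lia. Qed.
Let le_s0m : (s + 0 <= m)%N. Proof. by rewrite addn0. Qed.
Let p_gt0 : (0 < p)%N. Proof. by case: p p_odd. Qed.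
Let p_half : p = (p./2 + p./2).+1. Proof. by rewrite -[LHS]odd_double_half p_odd addnn. Qed.

Local Notation in_top := (in_top p m s).
Local Notation inL x := (@in_Lambda p (Sp m s) x).
Local Notation dia b x := (Sp_diagram p s b x).
Local Notation res v t := (residue p (v 0 t)).
Local Notation uval := (up_value p m s).
Local Notation dval := (down_value p m s).
Local Notation mirror := (mirror_sum p m s).
Local Notation wall := (wall p m s).

(** That [l p - v_i] and [l p - v_j] lie in the window is how being on one side of the wall enters:
    they must then be the other representatives at the two nodes, and [l p] is the common mirror
    sum. *)
Lemma Sp_place b x i j (l : int) w : let v := x + rho m in
    let v' := upd2 v i (l * p%:Z - v 0 j) j (l * p%:Z - v 0 i) in
    inL x -> (i < s)%N -> (j < s)%N -> i != j ->
    in_top (l * p%:Z - v 0 i) -> in_top (l * p%:Z - v 0 j) ->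
    mirror_free p s v i -> mirror_free p s v j ->
  [/\ injective (v' 0), windowed p s 0 v' & sdec (perm_wt w v') ->
  [/\ inL (perm_wt w v' - rho m), Sp_orbit p s x (perm_wt w v' - rho m) &
      dia b (perm_wt w v' - rho m) =
      flip (dia b x) (node p (res v i), node p (res v j))]].
Proof.
move=> v v' xL lt_i lt_j neq_ij top_i top_j free_i free_j.
have [dec win] := (Sp_in_LambdaP p_gt0 x Spvalid).1 xL; rewrite -/v in dec win.
have inj_r := Sp_res_inj Spvalid (sdec_inj dec) win.
have v'i : v' 0 i = l * p%:Z - v 0 j by rewrite mxE eqxx.
have v'j : v' 0 j = l * p%:Z - v 0 i by rewrite mxE eq_sym (negbTE neq_ij) eqxx.
have v'k (k : 'I_m) : k != i -> k != j -> v' 0 k = v 0 k.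
  by move=> /negbTE ki /negbTE kj; rewrite mxE ki kj.
have r'i : res v' i = nres p (res v j) by rewrite v'i (residue_opp Spvalid).
have r'j : res v' j = nres p (res v i) by rewrite v'j (residue_opp Spvalid).
have top' (k : 'I_m) : (k < s)%N -> in_top (v' 0 k).
  move=> lt_k; have [->|ki] := eqVneq k i; first by rewrite v'i.
  have [->|kj] := eqVneq k j; first by rewrite v'j.
  by rewrite v'k //; apply: (windowed_top win).
have mid' (k : 'I_m) : (s <= k)%N -> v' 0 k = (m - k)%N%:Z.
  move=> le_k; rewrite v'k; first by apply: (windowed_mid win); rewrite le_k subn0 /=.
    by apply/eqP => ki; move: le_k; rewrite ki leqNgt lt_i.
  by apply/eqP => kj; move: le_k; rewrite kj leqNgt lt_j.
have win' : windowed p s 0 v'.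
  split; first split.
  - by move=> k /top'/andP[].
  - by move=> k /andP[le_k _]; apply: mid'.
  - by move=> k; rewrite subn0 leqNgt ltn_ord.
  - by move=> k /top'/andP[_]; rewrite PoszD.
  - by move=> k; rewrite subn0 leqNgt ltn_ord.
have inj_v' : injective (v' 0).
  have tops (k1 k2 : 'I_m) : (k1 < s)%N -> (k2 < s)%N -> v' 0 k1 = v' 0 k2 -> k1 = k2.
    move=> lt1 lt2; have [->|k1i] := eqVneq k1 i.
      have [->//|k2i] := eqVneq k2 i; have [->|k2j] := eqVneq k2 j.
        rewrite v'i v'j => E; apply: (sdec_inj dec); move: E.
        by move: (v 0 i) (v 0 j); clear; lia.
      rewrite (v'k k2) // => E; case: (free_j k2 lt2 k2j).
      by rewrite -(residue_opp Spvalid l) -E v'i.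
    have [->|k1j] := eqVneq k1 j.
      have [->//|k2j] := eqVneq k2 j; have [->|k2i] := eqVneq k2 i.
        rewrite v'i v'j => E; apply: (sdec_inj dec); move: E.
        by move: (v 0 i) (v 0 j); clear; lia.
      rewrite (v'k k2) // => E; case: (free_i k2 lt2 k2i).
      by rewrite -(residue_opp Spvalid l) -E v'j.
    rewrite (v'k k1) //; have [->|k2i] := eqVneq k2 i.
      rewrite v'i => E; case: (free_j k1 lt1 k1j).
      by rewrite -(residue_opp Spvalid l) E.
    have [->|k2j] := eqVneq k2 j.
      rewrite v'j => E; case: (free_i k1 lt1 k1i).
      by rewrite -(residue_opp Spvalid l) E.
    by rewrite v'k // => /(sdec_inj dec).
  move=> k1 k2; have [lt1|le1] := ltnP k1 s; have [lt2|le2] := ltnP k2 s.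
  - exact: tops.
  - rewrite (mid' k2) // => E; have := top' k1 lt1; rewrite E /in_top.
    by move: le2 le_sm; clear; lia.
  - rewrite (mid' k1) // => E; have := top' k2 lt2; rewrite -E /in_top.
    by move: le1 le_sm; clear; lia.
  - rewrite !mid' // => -[E]; apply/val_inj; move: E (ltn_ord k1) (ltn_ord k2) => /=.
    by clear; lia.
split=> // dec'; have win'' := windowed_sort le_s0m win' dec'.
have [bl' _ _] := win'; have [zw fixw] := block_sort le_s0m bl' dec'.
have yL : inL (perm_wt w v' - rho m).
  by apply/(Sp_in_LambdaP p_gt0 _ Spvalid); rewrite subrK.
split=> //; last first.
  rewrite !Sp_diagramE // subrK (Sp_dia_perm _ _ _ zw).
  exact: (Sp_exchange Spvalid b lt_i lt_j neq_ij inj_r r'i r'j v'k free_i free_j).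
have xv' : Sp_orbit p s x (v' - rho m).
  have -> : v' - rho m = dot (refl p (eps i + eps j) l) x by rewrite /dot refl_add.
  apply: Sp_orbit_step; first exact: Sp_orbit_refl.
  have [lt_ij|lt_ji|/val_inj E] := ltngtP i j; last by rewrite E eqxx in neq_ij.
    by exists i, j; rewrite lt_ij lt_j; split=> //; left.
  by exists j, i; rewrite lt_ji lt_i addrC; split=> //; left.
apply: (Sp_orbit_trans xv'); have -> : perm_wt w v' - rho m = dot (perm_wt w) (v' - rho m).
  by rewrite /dot subrK.
by apply: Sp_orbit_perm => k le_k; apply: fixw; rewrite le_k subn0 /=.
Qed.

Lemma mirror_same_side (x0 y0 : nat) : (x0 < wall)%N = (y0 < wall)%N -> mirror x0 = mirror y0.
Proof. by rewrite /mirror_sum => ->. Qed.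

(** With [l p] the common mirror sum of the two nodes, reflecting an entry gives the other
    representative at its node, so the window is not left. The directions of the arrows decide only
    whether the reflection goes up or down. *)
Lemma Sp_flip b x (x0 y0 : nat) : inL x -> x0 != y0 -> (x0 < wall)%N = (y0 < wall)%N ->
    single (dia b x x0) -> single (dia b x y0) ->
  exists i j (l : int) w, let v := x + rho m in
    let v' := upd2 v i (l * p%:Z - v 0 j) j (l * p%:Z - v 0 i) in
  [/\ [/\ (i < s)%N, (j < s)%N, i != j & mirror x0 = l * p%:Z],
      mirror_free p s v i /\ mirror_free p s v j,
      v 0 i = (if dia b x x0 == up then uval x0 else dval x0) /\
      v 0 j = (if dia b x y0 == up then uval y0 else dval y0),
      [/\ injective (v' 0), windowed p s 0 v' & sdec (perm_wt w v')]
    & [/\ inL (perm_wt w v' - rho m), Sp_orbit p s x (perm_wt w v' - rho m) &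
      dia b (perm_wt w v' - rho m) = flip (dia b x) (x0, y0)]].
Proof.
move=> xL neq_xy side; have [dec win] := (Sp_in_LambdaP p_gt0 x Spvalid).1 xL.
have Edia : dia b x = Sp_dia p s b (x + rho m) by rewrite Sp_diagramE.
rewrite {1 2}Edia => /(Sp_dia_arrow Spvalid (sdec_inj dec) win)[le_x [i [lt_i Ni free_i Ei]]].
move=> /(Sp_dia_arrow Spvalid (sdec_inj dec) win)[le_y [j [lt_j Nj free_j Ej]]].
have neq_ij : i != j by apply/eqP => E; move: neq_xy; rewrite -Ni -Nj E eqxx.
have [l El] := mirror_mulP p m s x0; have El' := El; rewrite (mirror_same_side side) in El'.
have [ux dx] := value_window Spvalid le_x; have [uy dy] := value_window Spvalid le_y.
have top_i : in_top (l * p%:Z - (x + rho m) 0 i).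
  rewrite Ei -El -up_down_value; case: ifP => _; first by rewrite addrC addKr.
  by rewrite addrK.
have top_j : in_top (l * p%:Z - (x + rho m) 0 j).
  rewrite Ej -El' -up_down_value; case: ifP => _; first by rewrite addrC addKr.
  by rewrite addrK.
have [inj_v' win' _] := Sp_place b 1%g xL lt_i lt_j neq_ij top_i top_j free_i free_j.
have [w dec'] := sort_exists inj_v'.
have [_ _ /(_ dec')] := Sp_place b w xL lt_i lt_j neq_ij top_i top_j free_i free_j.
rewrite Ni Nj => res_y.
by exists i, j, l, w; rewrite -Edia in Ei Ej; split.
Qed.

Lemma legal_same_side k (x0 y0 : nat) : legal p (Sp m s) k (x0, y0) ->
  x0 != y0 /\ (x0 < wall)%N = (y0 < wall)%N.
Proof.
rewrite (Sp_legalE Spvalid) => /and3P[lt_xy _ side]; split; first by rewrite neq_ltn lt_xy.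
by move: lt_xy side; move: wall => a; clear; case: k; lia.
Qed.

Lemma Sp_up b x k e : inL x -> legal p (Sp m s) k e ->
    carries (dia b x) (clockwise k) e ->
  exists y, [/\ inL y, Sp_orbit p s x y & dia b y = flip (dia b x) e].
Proof.
case: e => x0 y0 xL leg; rewrite -carries_opp_acw => /carries_single[/=].
rewrite !single_opp => sx sy; have [neq_xy side] := legal_same_side leg.
have [i [j [l [w [_ _ _ _ [yL orb Ey]]]]]] := Sp_flip xL neq_xy side sx sy.
by eexists; split; [exact: yL | exact: orb | exact: Ey].
Qed.

(** Since [l p] is the mirror sum, this is the condition that the pairing minus [l p] is at least 1:
    anti-clockwise pairs are those whose reflection goes down. *)
Lemma Sp_acw_gt k (D : diagram) (x0 y0 : nat) : legal p (Sp m s) k (x0, y0) ->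
    carries D (anticlockwise k) (x0, y0) ->
  mirror x0 < (if D x0 == up then uval x0 else dval x0)
    + (if D y0 == up then uval y0 else dval y0).
Proof.
rewrite (Sp_legalE Spvalid) => /and3P[lt_xy le_y leg] /carriesP[/= -> ->].
rewrite /mirror_sum /up_value /down_value.
move: lt_xy le_y p_half leg; move: (p./2) wall (base_left _ _ _) (base_right _ _ _).
by clear; case: k => h a c d lt_xy le_y Ep /=; do ?case: ifP; lia.
Qed.

Lemma Sp_down b x k e : inL x -> legal p (Sp m s) k e ->
    carries (dia b x) (anticlockwise k) e ->
  exists y, [/\ inL y, Sp_orbit p s x y, Sp_step p x y & dia b y = flip (dia b x) e].
Proof.
case: e => x0 y0 xL leg acw; have [/= sx sy] := carries_single acw.
have [neq_xy side] := legal_same_side leg.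
have [i [j [l [w [[lt_i lt_j neq_ij El] [free_i free_j] [Ei Ej]]]]]] :=
  Sp_flip xL neq_xy side sx sy.
have := Sp_acw_gt leg acw; rewrite -Ei -Ej El => {Ei Ej El}.
move=> gap [inj_v' win' dec'] [yL orb Ey].
exists (perm_wt w (upd2 (x + rho m) i (l * p%:Z - (x + rho m) 0 j) j
  (l * p%:Z - (x + rho m) 0 i)) - rho m); split=> // {Ey orb yL}.
have [dec win] := (Sp_in_LambdaP p_gt0 x Spvalid).1 xL.
(* The root is symmetric in [i] and [j], but a step requires [i < j], that is, the larger entry at
   [i]. *)
wlog lt_v : i j lt_i lt_j neq_ij free_i free_j gap inj_v' win' dec' / (x + rho m) 0 j < (x + rho m) 0 i.
  move=> IH; have [lt_v|lt_v|/(sdec_inj dec) E] := ltgtP ((x + rho m) 0 j) ((x + rho m) 0 i).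
  - exact: IH.
  - rewrite upd2C // in inj_v' win' dec' *; apply: IH => //; first by rewrite eq_sym.
    by rewrite addrC.
  - by rewrite E eqxx in neq_ij.
have lt_ij : (i < j)%N by rewrite ltnNge -(sdec_le _ _ dec) -ltNge.
have /and3P[/andP[dec_x /forallP x_ge0] lenx _] := xL; rewrite /= in lenx dec_x x_ge0.
have pos (t : 'I_m) := len_part1 t dec_x; rewrite (len_nonneg x_ge0) in pos.
have low (t : 'I_m) : (t < s)%N -> (len x <= t)%N -> (x + rho m) 0 t = (m - t)%N%:Z.
  move=> _ le_t; rewrite rhoE; have := pos t; have := x_ge0 t; move: le_t.
  by move: (x 0 t) (len x); clear; lia.
set v := x + rho m in gap win dec lt_v low free_i free_j inj_v' win' dec' *.
set v' := upd2 _ _ _ _ _ in inj_v' win' dec' *.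
have v'i : v' 0 i = l * p%:Z - v 0 j by rewrite mxE eqxx.
have v'j : v' 0 j = l * p%:Z - v 0 i by rewrite mxE eq_sym (negbTE neq_ij) eqxx.
have v'k (k0 : 'I_m) : k0 != i -> k0 != j -> v' 0 k0 = v 0 k0.
  by move=> /negbTE ki /negbTE kj; rewrite mxE ki kj.
have top_j := windowed_top win' lt_j; rewrite v'j in top_j.
(* Otherwise this smaller new value is the entry of [rho] at a place from [len x] up to [s - 1],
   where [x] vanishes, and the label opposite to that of entry [i] would already occur. *)
have c_gt : (m - len x)%N%:Z < l * p%:Z - v 0 i.
  rewrite ltNge; apply/negP => le_c.
  have [c Ec] : exists c : nat, l * p%:Z - v 0 i = c%:Z.
    by exists (absz (l * p%:Z - v 0 i)%R); move: top_j; rewrite /in_top; move: (_ - _); clear; lia.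
  have lt_m : (m - c < m)%N by move: top_j (ltn_ord i); rewrite Ec /in_top; clear; lia.
  have t_s : (Ordinal lt_m < s)%N.
    by move: lt_i top_j le_sm; rewrite Ec /in_top /=; clear; lia.
  have t_len : (len x <= Ordinal lt_m)%N.
    by move: le_c lenx le_sm; rewrite Ec /=; move: (len x); clear; lia.
  have Ev : v 0 (Ordinal lt_m) = l * p%:Z - v 0 i.
    rewrite low // Ec; congr Posz; rewrite /= subKn //.
    by move: le_c; rewrite Ec; move: (len x); clear; lia.
  have t_neq : Ordinal lt_m != i.
    apply/eqP => E; move: Ev gap lt_v; rewrite E; move: (v 0 i) (v 0 j) (l * _).
    by clear; lia.
  by apply: (free_i _ t_s t_neq); rewrite Ev (residue_opp Spvalid).
have lt_jl : (j < len x)%N.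
  rewrite ltnNge; apply/negP => le_j; have := low j lt_j le_j.
  move: c_gt gap le_j (ltn_ord j); move: (v 0 i) (v 0 j) (l * _) (len x) => a c d ln.
  by clear; lia.
have lt_il : (i < len x)%N := ltn_trans lt_ij lt_jl.
have len0m : (len x + 0 <= m)%N.
  by rewrite addn0; apply: leq_trans lenx le_sm.
have refl_v : refl p (eps i + eps j) l v = v' by rewrite refl_add.
exists w, i, j, l => /=; rewrite -/v /dot -/v refl_v; split=> //.
- have -> : [set k0 : 'I_m | (k0 < len x)%N] =
      [set k0 : 'I_m | (k0 < len x) || (m - 0 <= k0)]%N.
    by apply/setP => k0; rewrite !inE subn0 (leqNgt m) ltn_ord orbF.
  apply: (block_sort_on len0m _ dec'); split=> k0.
  + have [->|ki] := eqVneq k0 i.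
      by rewrite v'i => _; move: c_gt lt_v; move: (v 0 i) (v 0 j) (l * _) (len x); clear; lia.
    have [->|kj] := eqVneq k0 j; first by rewrite v'j.
    move=> lt_k; rewrite v'k // /v rhoE; have := pos k0; rewrite lt_k.
    by move: (x 0 k0) (len x) lt_k (ltn_ord k0); clear; lia.
  + rewrite subn0 => /andP[le_k _]; rewrite v'k.
    * have [lt_k|le_k2] := ltnP k0 s; first exact: low.
      by apply: (windowed_mid win); rewrite le_k2 subn0 /=.
    * by apply/eqP => E; move: le_k; rewrite E leqNgt lt_il.
    * by apply/eqP => E; move: le_k; rewrite E leqNgt lt_jl.
  + by rewrite subn0 leqNgt ltn_ord.
- by rewrite lt_ij.
- rewrite pairing_add; split; last first.
    by move: gap; move: (v 0 i) (v 0 j) (l * _); clear; lia.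
  rewrite -gtz0_ge1 -(pmulr_lgt0 _ (_ : 0 < p%:Z)) //.
  have := windowed_top win lt_i; move: top_j; rewrite /in_top.
  by move: (v 0 i) (l * _); clear; lia.
split=> // k0; have [lt_k|le_k] := ltnP k0 s.
  by have := windowed_top win' lt_k; rewrite /in_top; move: (v' 0 k0); clear; lia.
rewrite (windowed_mid win') ?le_k ?subn0 ?ltn_ord //.
by have := ltn_ord k0; clear; lia.
Qed.

End SpFlips.

(** * Steps for Sp_n are reversals of pairs *)

Section SpStep.

Local Open Scope ring_scope.
Import Order.TTheory Num.Theory.

Variables p m s : nat.
Hypothesis Spvalid : valid p (Sp m s).
Implicit Types (x y v : 'rV[int]_m) (w : 'S_m) (i j : 'I_m).

Let p_odd : odd p. Proof. by case/andP: Spvalid. Qed.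
Let s_bd : (0 < s <= minn m p)%N. Proof. by case/andP: Spvalid. Qed.
Let le_sm : (s <= m)%N. Proof. by move: s_bd; clear; lia. Qed.
Let p_gt0 : (0 < p)%N. Proof. by case: p p_odd. Qed.
Let p_half : p = (p./2 + p./2).+1. Proof. by rewrite -[LHS]odd_double_half p_odd addnn. Qed.

Local Notation in_top := (in_top p m s).
Local Notation inL x := (@in_Lambda p (Sp m s) x).
Local Notation dia b x := (Sp_diagram p s b x).
Local Notation res v t := (residue p (v 0 t)).
Local Notation uval := (up_value p m s).
Local Notation dval := (down_value p m s).
Local Notation mirror := (mirror_sum p m s).
Local Notation wall := (wall p m s).

(** Converse to [Sp_acw_gt]. Left of the wall an up at [k] contributes [k] and a down [-k] to the
    excess, which is positive iff [y0] carries an up. Right of it, since [x0 + y0 < p], the excess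
    is positive iff [x0] carries a down. These are the anti-clockwise caps and curls. *)
Lemma Sp_gt_legal (D : diagram) (x0 y0 : nat) : (x0 < y0)%N -> (y0 <= p./2)%N ->
    mirror x0 = mirror y0 -> single (D x0) -> single (D y0) ->
    mirror x0 < (if D x0 == up then uval x0 else dval x0)
      + (if D y0 == up then uval y0 else dval y0) ->
  exists k, legal p (Sp m s) k (x0, y0) /\ carries D (anticlockwise k) (x0, y0).
Proof.
move=> lt_xy le_y /(mirror_side Spvalid) side /singleP sx /singleP sy.
have lt_p : x0%:Z + y0%:Z < p%:Z by move: lt_xy le_y p_half; move: (p./2); clear; lia.
have leg k : legal p (Sp m s) k (x0, y0) = _ := Sp_legalE Spvalid k x0 y0.
rewrite lt_xy le_y /= side in leg.
rewrite /mirror_sum /up_value /down_value side /carries /=.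
case: sx => ->; case: sy => -> /=; have [y_left|y_right] := boolP (y0 < wall)%N => gap.
- by exists LeftCurl; rewrite leg.
- by move: gap lt_p; move: (base_right _ _ _); clear; lia.
- by move: gap lt_xy; move: (base_left _ _ _); clear; lia.
- by move: gap lt_xy; move: (base_right _ _ _); clear; lia.
- by exists Cap; rewrite leg.
- by exists Cap; rewrite leg.
- by move: gap; move: (base_left _ _ _); clear; lia.
- by exists RightCurl; rewrite leg leqNgt side y_right.
Qed.

Lemma Sp_step_move b x y : inL x -> decreasing y -> Sp_step p x y ->
  inL y /\ move p (Sp m s) (dia b x) (dia b y).
Proof.
move=> xL dec_y [w [i [j [l]]]] /= [_ /andP[lt_ij lt_jl] [_]].
have [dec win] := (Sp_in_LambdaP p_gt0 x Spvalid).1 xL.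
have /and3P[_ lenx _] := xL; rewrite /= in lenx.
set v := x + rho m in dec win *.
have lt_j : (j < s)%N by apply: leq_trans lt_jl lenx.
have lt_i : (i < s)%N := ltn_trans lt_ij lt_j.
have neq_ij : i != j by apply/eqP => E; rewrite E ltnn in lt_ij.
rewrite pairing_add refl_add // => gap [inj_v' pos_v'] Ey.
set v' := upd2 _ _ _ _ _ in inj_v' pos_v'.
have v'i : v' 0 i = l * p%:Z - v 0 j by rewrite mxE eqxx.
have v'j : v' 0 j = l * p%:Z - v 0 i by rewrite mxE eq_sym (negbTE neq_ij) eqxx.
have v'k (k : 'I_m) : k != i -> k != j -> v' 0 k = v 0 k.
  by move=> /negbTE ki /negbTE kj; rewrite mxE ki kj.
have vi := windowed_top win lt_i; have vj := windowed_top win lt_j.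
have lt_v := dec _ _ lt_ij.
(* The entries beyond the first [s] are [m - s, ..., 1], so a positive value repeating none of them
   exceeds [m - s]. *)
have out (k : 'I_m) : k = i \/ k = j -> (m - s)%N%:Z < v' 0 k.
  move=> Ek; rewrite ltNge; apply/negP => le_a; have a_gt0 := pos_v' k.
  have [a Ea] : exists a : nat, v' 0 k = a%:Z.
    by exists (absz (v' 0 k)); move: a_gt0; move: (v' 0 k); clear; lia.
  rewrite Ea in le_a a_gt0; have lt_m : (m - a < m)%N by move: a_gt0 (ltn_ord i); clear; lia.
  have t_s : (s <= Ordinal lt_m)%N by move: le_a le_sm; rewrite /=; clear; lia.
  have ti : Ordinal lt_m != i by apply/eqP => E; move: t_s; rewrite E leqNgt lt_i.
  have tj : Ordinal lt_m != j by apply/eqP => E; move: t_s; rewrite E leqNgt lt_j.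
  have : v' 0 (Ordinal lt_m) = v' 0 k.
    rewrite v'k // (windowed_mid win) ?subn0 ?t_s ?ltn_ord // Ea; congr Posz.
    by rewrite /= subKn //; move: le_a; clear; lia.
  by move/inj_v' => E; case: Ek ti tj => <-; rewrite E eqxx.
have top_i : in_top (l * p%:Z - v 0 i).
  have := out j (or_intror erefl); rewrite v'j; move: vj gap; rewrite /in_top.
  by move: (v 0 i) (v 0 j) (l * _); clear; lia.
have top_j : in_top (l * p%:Z - v 0 j).
  have := out i (or_introl erefl); rewrite v'i; move: vi gap; rewrite /in_top.
  by move: (v 0 i) (v 0 j) (l * _); clear; lia.
have free_i : mirror_free p s v i.
  move=> t lt_t ti; rewrite -(residue_opp Spvalid l).
  move=> /(residue_in_top p_gt0 (windowed_top win lt_t) top_i) Et.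
  have [tj|tj] := eqVneq t j.
    by move: Et gap; rewrite tj; move: (v 0 i) (v 0 j) (l * _); clear; lia.
  by move: Et; rewrite -v'j -v'k // => /inj_v'/eqP; rewrite (negbTE tj).
have free_j : mirror_free p s v j.
  move=> t lt_t tj; rewrite -(residue_opp Spvalid l).
  move=> /(residue_in_top p_gt0 (windowed_top win lt_t) top_j) Et.
  have [ti|ti] := eqVneq t i.
    by move: Et gap; rewrite ti; move: (v 0 i) (v 0 j) (l * _); clear; lia.
  by move: Et; rewrite -v'i -v'k // => /inj_v'/eqP; rewrite (negbTE ti).
have {}Ey : y = perm_wt w v' - rho m by rewrite Ey /dot -/v refl_add.
have dec' : sdec (perm_wt w v').
  by rewrite -[perm_wt _ _](subrK (rho m)) -Ey; apply/decreasingP.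
have [_ _ /(_ dec')] := Sp_place Spvalid b w xL lt_i lt_j neq_ij top_i top_j free_i free_j.
rewrite -/v -/v' -Ey => -[yL _ Edia]; split=> //.
have Dv : dia b x = Sp_dia p s b v by rewrite Sp_diagramE.
(* In the window [l p - v_t] can only be the other representative at the node of [v_t], so [l p] is
   the mirror sum there. Having the same mirror sum, the two nodes lie on one side. *)
have arrow (t : 'I_m) : (t < s)%N -> mirror_free p s v t ->
    in_top (l * p%:Z - v 0 t) -> let k := node p (res v t) in
    [/\ (k <= p./2)%N, single (dia b x k), mirror k = l * p%:Z
      & v 0 t = if dia b x k == up then uval k else dval k].
  move=> lt_t free top k.
  have le_k : (k <= p./2)%N := node_le Spvalid (residue_lt p_gt0 (v 0 t)).
  have [uk dk] := value_window Spvalid le_k.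
  have res_opp : res v t = nres p (residue p (l * p%:Z - v 0 t)).
    by rewrite (residue_opp Spvalid) nresK ?residue_lt.
  rewrite Dv; case: (Sp_dia_content Spvalid b (sdec_inj dec) win lt_t free) => -[-> Ev];
    split=> //; rewrite -up_down_value.
    suff -> : dval k = l * p%:Z - v 0 t by rewrite {}Ev -/k addrC subrK.
    apply: (residue_in_top p_gt0 dk top).
    by rewrite (residue_down_value Spvalid) // (residue_opp Spvalid) Ev (residue_up_value Spvalid).
  suff -> : uval k = l * p%:Z - v 0 t by rewrite {}Ev -/k subrK.
  apply: (residue_in_top p_gt0 uk top).
  rewrite (residue_up_value Spvalid) // (residue_opp Spvalid) Ev (residue_down_value Spvalid) //.
  rewrite nresK //; apply: leq_ltn_trans le_k _.
  by move: p_half; move: (p./2); clear; lia.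
have [le_ki sk_i mir_i Ei] := arrow i lt_i free_i top_i.
have [le_kj sk_j mir_j Ej] := arrow j lt_j free_j top_j.
have neq_k : node p (res v i) <> node p (res v j).
  case/(node_eq Spvalid (residue_lt p_gt0 _) (residue_lt p_gt0 _)) => [|/(free_j i lt_i neq_ij)//].
  by move/(Sp_res_inj Spvalid (sdec_inj dec) win lt_i lt_j)/eqP; rewrite (negbTE neq_ij).
(* The order of the nodes need not be that of the entries. *)
have [lt_k|lt_k|//] := ltngtP (node p (res v i)) (node p (res v j)).
- have [||k [leg acw]] := @Sp_gt_legal (dia b x) _ _ lt_k le_kj _ sk_i sk_j.
  + by rewrite mir_i mir_j.
  + by rewrite -Ei -Ej mir_i; move: gap; move: (v 0 i) (v 0 j) (l * _); clear; lia.
  by exists k, (node p (res v i), node p (res v j)).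
- have [||k [leg acw]] := @Sp_gt_legal (dia b x) _ _ lt_k le_ki _ sk_j sk_i.
  + by rewrite mir_i mir_j.
  + by rewrite -Ei -Ej mir_j; move: gap; move: (v 0 i) (v 0 j) (l * _); clear; lia.
  by exists k, (node p (res v j), node p (res v i)); rewrite flip_sym.
Qed.

End SpStep.

(** * Comparison of the polynomials *)

Section OrbitInvariance.

Local Open Scope ring_scope.
Import Order.TTheory Num.Theory.

Lemma valid_p_gt0 p G : valid p G -> (0 < p)%N.
Proof. by case: G => [n s1 s2 /and3P[]|m s /andP[p_odd _]]; [lia | case: p p_odd]. Qed.

Lemma uniq_sides p G : valid p G -> uniq ((sides p G).1 ++ (sides p G).2).
Proof.
move=> Gvalid; have p_gt0 := valid_p_gt0 Gvalid; case: G Gvalid => [n s1 s2|m s] Gvalid.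
  have [_ _ le_n] := and3P Gvalid; rewrite /sides.
  set l := ((n - s1 - s2) %% p)%N; have lt_l : (l < p)%N by rewrite ltn_pmod.
  (* As [n - s1 + 1] is congruent to [s2 + 1 + l], the second side goes on where the first ends. *)
  have -> : [seq ((n - s1 + 1 + t) %% p)%N | t <- iota 0 (p - l)] =
      [seq ((s2 + 1 + t) %% p)%N | t <- iota l (p - l)].
    have -> : iota l (p - l) = [seq (l + t)%N | t <- iota 0 (p - l)].
      by rewrite -iotaDl addn0.
    rewrite -map_comp; apply: eq_map => t /=.
    have -> : (n - s1 + 1 + t = (n - s1 - s2) %/ p * p + (s2 + 1 + (l + t)))%N.
      have := divn_eq (n - s1 - s2) p; rewrite -/l; move: le_n.
      by move: (_ %/ _ * _)%N l {lt_l} => M l; clear; lia.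
    by rewrite modnMDl.
  rewrite -map_cat; have -> : iota 0 l ++ iota l (p - l) = iota 0 p.
    by have := iotaD 0 l (p - l); rewrite add0n subnKC // ltnW.
  rewrite map_inj_in_uniq ?iota_uniq // => t1 t2; rewrite !mem_iota !add0n /= => lt1 lt2.
  by move/eqP; rewrite eqn_modDl !modn_small // => /eqP.
rewrite (Sp_sidesE Gvalid) /=.
by have := iotaD 0 (wall p m s) (p./2.+1 - wall p m s); rewrite add0n => <-; apply: iota_uniq.
Qed.

Lemma exists_card n (P : pred 'I_n) : (forall i j, P i -> P j -> i = j) ->
  ([exists i, P i] : nat) = #|[set i | P i]|.
Proof.
move=> P1; have [/existsP[i Pi]|/existsP noP] := boolP [exists i, P i].
  suff -> : [set i | P i] = [set i] by rewrite cards1.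
  by apply/setP => j; rewrite !inE; apply/idP/eqP => [Pj|->//]; apply: P1.
suff -> : [set i | P i] = set0 by rewrite cards0.
by apply/setP => j; rewrite !inE; apply/negP => Pj; apply: noP; exists j.
Qed.

Lemma card_pred_sum n (Q : pred 'I_n) : #|[set t | Q t]| = (\sum_t Q t)%N.
Proof. by rewrite -sum1_card big_mkcond; apply: eq_bigr => t _; rewrite inE; case: (Q t). Qed.

Lemma GL_orbit_count p n (x y : 'rV[int]_n) k : (0 < p)%N -> GL_orbit p x y ->
  #|[set i | residue p ((y + rho n) 0 i) == k]| =
  #|[set i | residue p ((x + rho n) 0 i) == k]|.
Proof.
move=> p_gt0 [w [z [_ ->]]]; rewrite /dot subrK -[RHS](card_imset _ (@perm_inj _ w)).
apply: eq_card => i; have Er (j : 'I_n) :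
    residue p ((perm_wt w (x + rho n) + p%:Z *: z) 0 (w j)) = residue p ((x + rho n) 0 j).
  by rewrite mxE perm_wtE [X in _ + X]mxE mulrC residue_addM.
apply/idP/imsetP => [|[j + ->]]; rewrite !inE.
  by exists (w^-1 i)%g; rewrite ?permKV // inE -Er permKV.
by rewrite Er.
Qed.

Lemma single_pair (b1 b2 : bool) : single (b1, b2) = (b1 + b2 == 1)%N.
Proof. by case: b1; case: b2. Qed.

(** The middle entries are those of [rho] for every weight of [Lambda(s)]. So the number of entries
    with a given residue, an orbit invariant, determines the number of arrows at the node. *)
Lemma GL_single_card p n s1 s2 (x : 'rV[int]_n) k : valid p (GL n s1 s2) ->
  @in_Lambda p (GL n s1 s2) x ->
  single (GL_diagram p s1 s2 x k) =
  (#|[set i | residue p ((x + rho n) 0 i) == k]| ==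
   (#|[set i : 'I_n | (s1 <= i < n - s2)%N && (residue p (n - i)%N%:Z == k)]|).+1).
Proof.
move=> Gvalid xL; have p_gt0 := valid_p_gt0 Gvalid; have [_ _ le_n] := and3P Gvalid.
have [dec win] := (GL_in_LambdaP p_gt0 x Gvalid).1 xL.
rewrite GL_diagramE //; set v := x + rho n in dec win *.
have Ecard : #|[set i | residue p (v 0 i) == k]| =
   ([exists i : 'I_n, (i < s1)%N && (residue p (v 0%R i) == k)]
    + [exists i : 'I_n, (n - s2 <= i)%N && (residue p (v 0%R i) == k)]
    + #|[set i : 'I_n | (s1 <= i < n - s2)%N && (residue p (n - i)%N%:Z == k)]|)%N.
  rewrite !exists_card.
  - rewrite !card_pred_sum -!big_split /=; apply: eq_bigr => i _.
    have [lt_i|le_i] := ltnP i s1.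
      by rewrite leqNgt (_ : (i < n - s2)%N) ?addn0 //=; move: lt_i le_n; clear; lia.
    have [le_i2|lt_i] := leqP (n - s2) i; first by rewrite /= addn0.
    by rewrite /= -(windowed_mid win) // le_i lt_i.
  - move=> i j /andP[le_i /eqP Ei] /andP[le_j /eqP Ej]; apply: (sdec_inj dec).
    by apply: (residue_in_bot p_gt0 (windowed_bot win le_i) (windowed_bot win le_j)); rewrite Ei Ej.
  - move=> i j /andP[le_i /eqP Ei] /andP[le_j /eqP Ej]; apply: (sdec_inj dec).
    by apply: (residue_in_top p_gt0 (windowed_top win le_i) (windowed_top win le_j)); rewrite Ei Ej.
by rewrite Ecard -(add1n #|_|) eqn_add2r single_pair.
Qed.

(** The generating reflections permute the first [s] entries up to signs and multiples of [p], and
    the node of an entry ignores both. *)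
Lemma Sp_orbit_count p m s (x y : 'rV[int]_m) k : valid p (Sp m s) -> Sp_orbit p s x y ->
  #|[set i : 'I_m | (i < s)%N && (node p (residue p ((y + rho m) 0 i)) == k)]| =
  #|[set i : 'I_m | (i < s)%N && (node p (residue p ((x + rho m) 0 i)) == k)]|.
Proof.
move=> Gvalid; have p_gt0 := valid_p_gt0 Gvalid.
elim=> // {}y alpha l _ <- [i [j [/andP[lt_ij lt_j] Ealpha]]].
have lt_i := ltn_trans lt_ij lt_j.
have neq_ij : i != j by apply/eqP => E; rewrite E ltnn in lt_ij.
rewrite /dot subrK; set v := y + rho m.
have Er (t : 'I_m) : node p (residue p (refl p alpha l v 0 t)) =
    node p (residue p (v 0 (tperm i j t))).
  case: Ealpha => ->.
    rewrite refl_add // mxE; have [->|ti] := eqVneq t i.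
      by rewrite tpermL (residue_opp Gvalid) (node_nres Gvalid) ?residue_lt.
    have [->|tj] := eqVneq t j; last by rewrite tpermD 1?eq_sym.
    by rewrite tpermR (residue_opp Gvalid) (node_nres Gvalid) ?residue_lt.
  rewrite refl_sub // mxE; have [->|ti] := eqVneq t i.
    by rewrite tpermL residue_addM.
  have [->|tj] := eqVneq t j; last by rewrite tpermD 1?eq_sym.
  by rewrite tpermR -mulNr residue_addM.
have Es (t : 'I_m) : (tperm i j t < s)%N = (t < s)%N.
  by case: tpermP => [->|->|//]; rewrite lt_i lt_j.
rewrite -[RHS](card_imset _ (@perm_inj _ (tperm i j))); apply: eq_card => t.
rewrite !inE Er -Es; apply/idP/imsetP => [H|[t' + ->]]; last by rewrite tpermK inE.
by exists (tperm i j t); rewrite ?tpermK // inE.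
Qed.

Lemma Sp_single_card p m s b (x : 'rV[int]_m) k : valid p (Sp m s) ->
  @in_Lambda p (Sp m s) x ->
  single (Sp_diagram p s b x k) =
  (#|[set i : 'I_m | (i < s)%N && (node p (residue p ((x + rho m) 0 i)) == k)]| == 1%N).
Proof.
move=> Gvalid xL; have p_gt0 := valid_p_gt0 Gvalid; have [p_odd s_bd] := andP Gvalid.
have p_half : p = (p./2 + p./2).+1 by rewrite -[LHS]odd_double_half p_odd addnn.
have [dec win] := (Sp_in_LambdaP p_gt0 x Gvalid).1 xL.
rewrite Sp_diagramE //; last by move: s_bd; clear; lia.
set v := x + rho m in dec win *; rewrite /Sp_dia -!/(lab _ _ _ _).
have labE r : (lab p s v r : nat) = #|[set i : 'I_m | (i < s)%N && (residue p (v 0 i) == r)]|.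
  apply: exists_card => i j /andP[lt_i /eqP Ei] /andP[lt_j /eqP Ej].
  by apply: (Sp_res_inj Gvalid (sdec_inj dec) win lt_i lt_j); rewrite Ei Ej.
have lt_r (i : 'I_m) := residue_lt p_gt0 (v 0 i).
have [->|k_neq0] := eqVneq k 0%N.
  have -> : [set i : 'I_m | (i < s)%N && (node p (residue p (v 0 i)) == 0%N)] =
      [set i : 'I_m | (i < s)%N && (residue p (v 0 i) == 0%N)].
    apply/setP => i; rewrite !inE; congr (_ && _); have := lt_r i; rewrite /node.
    by move: (residue _ _) (p./2); clear => r h; case: ifP; lia.
  by rewrite -labE; case: (lab p s v 0); case: (odd _); case: b.
case: leqP => [le_k|lt_k].
  have -> : #|[set i : 'I_m | (i < s)%N && (node p (residue p (v 0 i)) == k)]| =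
      (lab p s v k + lab p s v (p - k)%N)%N.
    rewrite !labE !card_pred_sum -big_split; apply: eq_bigr => i _ /=.
    case: (i < s)%N => //=; have := lt_r i; rewrite /node.
    move: (residue _ _) (p./2) k_neq0 le_k p_half; clear => r h.
    by case: ifP; lia.
  by case: (lab p s v k); case: (lab p s v _).
symmetry; apply/negP => /eqP E.
have /card_gt0P[i] : (0 < #|[set i : 'I_m | (i < s)%N && (node p (residue p (v 0%R i)) == k)]|)%N.
  by rewrite E.
rewrite inE => /andP[_ /eqP Ek]; have := node_le Gvalid (lt_r i).
by rewrite Ek leqNgt lt_k.
Qed.

(** Equivalence situations impose conditions on the diagram of [kappa] alone; this extends them to
    all weights of [Lambda]. *)
Lemma single_orbit p G b (x y : weight G) k : valid p G -> in_Lambda p x ->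
  in_Lambda p y -> H_orbit p x y -> single (diag p b y k) = single (diag p b x k).
Proof.
case: G x y => [n s1 s2|m s] x y Gvalid xL yL orb.
  by rewrite /diag !GL_single_card // (GL_orbit_count k (valid_p_gt0 Gvalid) orb).
by rewrite /diag !Sp_single_card // (Sp_orbit_count k Gvalid orb).
Qed.

End OrbitInvariance.

(** * Uniform statements for both groups *)

Section Interface.

Local Open Scope ring_scope.

Variables (p : nat) (G : group_data).
Hypothesis Gvalid : valid p G.
Implicit Types (x y z : weight G) (D E : diagram) (e : nat * nat).

Let p_gt0 := valid_p_gt0 Gvalid.
Let sides_uniq := uniq_sides Gvalid.

Lemma in_Lambda_dominant x : in_Lambda p x -> dominant x.
Proof. by move: x; case: G => [n s1 s2|m s] x; [case/and4P | case/and3P]. Qed.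

Lemma diag_inj b x y : in_Lambda p x -> in_Lambda p y ->
  diag p b x = diag p b y -> x = y.
Proof.
move: Gvalid x y; case: G => [n s1 s2|m s] GV x y.
  exact: (GL_diagram_inj (valid_p_gt0 GV) GV).
exact: (Sp_diagram_inj GV).
Qed.

Lemma step_move b x y : in_Lambda p x -> dominant y -> step p x y ->
  in_Lambda p y /\ move p G (diag p b x) (diag p b y).
Proof.
move: Gvalid x y; case: G => [n s1 s2|m s] GV x y xL.
  by move=> dom_y; apply: (GL_step_move (valid_p_gt0 GV) GV).
by case/andP=> dec_y _; apply: Sp_step_move.
Qed.

Lemma flip_up_orbit b x k e : in_Lambda p x -> legal p G k e ->
    carries (diag p b x) (clockwise k) e ->
  exists y, [/\ in_Lambda p y, H_orbit p x y & diag p b y = flip (diag p b x) e].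
Proof.
move: Gvalid x; case: G => [n s1 s2|m s] GV x xL; last exact: Sp_up.
by case: k => // leg cw; apply: (GL_up (valid_p_gt0 GV) GV).
Qed.

Lemma flip_down b x k e : in_Lambda p x -> legal p G k e ->
    carries (diag p b x) (anticlockwise k) e ->
  exists y, [/\ in_Lambda p y, H_orbit p x y, step p x y
              & diag p b y = flip (diag p b x) e].
Proof.
move: Gvalid x; case: G => [n s1 s2|m s] GV x xL; last exact: Sp_down.
by case: k => // leg acw; apply: (GL_down (valid_p_gt0 GV) GV).
Qed.

Lemma carries_flip D k e : carries (flip D e) (anticlockwise k) e =
  carries D (clockwise k) e.
Proof.
rewrite /carries /flip !eqxx orbT /=.
by case: k; case: (D e.1) => -[] []; case: (D e.2) => -[] [].
Qed.

(** Reversing the pair back is an anti-clockwise reversal, hence a step from [y] to a weight with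
    the diagram of [x]. Diagrams determine weights, so this is [x]. *)
Lemma flip_up b x k e : in_Lambda p x -> legal p G k e ->
    carries (diag p b x) (clockwise k) e ->
  exists y, [/\ in_Lambda p y, H_orbit p x y, step p y x
              & diag p b y = flip (diag p b x) e].
Proof.
move=> xL leg cw; have [y [yL orb Ey]] := flip_up_orbit xL leg cw.
have [|z [zL _ yz Ez]] := flip_down yL leg (b := b); first by rewrite Ey carries_flip.
exists y; split=> //; suff <- : z = x by [].
by apply: (diag_inj (b := b)) => //; rewrite Ez Ey flipK.
Qed.

Lemma H_orbit_trans x y z : H_orbit p x y -> H_orbit p y z -> H_orbit p x z.
Proof.
move: x y z; case: G => [n s1 s2|m s] x y z; last exact: Sp_orbit_trans.
case=> [w1 [z1 [sum1 ->]]] [w2 [z2 [sum2 ->]]].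
exists (w1 * w2)%g, (perm_wt w2 z1 + z2); split.
  under eq_bigr => i _ do rewrite mxE.
  rewrite big_split /= sum2 addr0 (reindex_inj (@perm_inj _ w2)) /= -[RHS]sum1.
  by apply: eq_bigr => i _; rewrite perm_wtE.
rewrite /dot subrK; congr (_ - _); apply/rowP => i.
by rewrite perm_wtM !mxE mulrDr addrA.
Qed.

Lemma chain_trans x y z : chain p x y -> chain p y z -> chain p x z.
Proof.
by move=> xy; elim=> [//|u v _ xu dom_v uv]; apply: chain_step uv.
Qed.

Lemma chain_one x y : in_Lambda p x -> in_Lambda p y -> step p x y -> chain p x y.
Proof.
move=> xL yL xy; apply: chain_step (in_Lambda_dominant yL) xy.
exact/chain_refl/in_Lambda_dominant.
Qed.

(** The chains defining the order run through arbitrary dominant weights; that they never leave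
    [Lambda(s)] is part of the induction. *)
Lemma preceq_reach b x y : in_Lambda p x -> preceq p y x ->
  in_Lambda p y /\ reach p G (diag p b x) (diag p b y).
Proof.
move=> xL; elim=> [_|u v _ [uL reach_u] dom_v uv].
  by split=> //; apply: reach_refl.
by have [vL uv'] := step_move b uL dom_v uv; split=> //; apply: reach_step uv'.
Qed.

Definition edge_list (C : cc_diagram) : seq (kind * (nat * nat)) :=
  [seq (Cap, e) | e <- C Cap] ++ [seq (LeftCurl, e) | e <- C LeftCurl]
  ++ [seq (RightCurl, e) | e <- C RightCurl].

Definition edge_list_nodes (l : seq (kind * (nat * nat))) : seq nat :=
  nodes [seq ke.2 | ke <- l].

Lemma all_edge_list (a : pred (kind * (nat * nat))) C :
  (forall k e, e \in C k -> a (k, e)) -> all a (edge_list C).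
Proof.
by move=> aC; rewrite !all_cat !all_map; apply/and3P; split; apply/allP => e /aC.
Qed.

Lemma count_edge_list_nodes (a : pred nat) C :
  count a (edge_list_nodes (edge_list C)) =
  (count a (nodes (C Cap)) + count a (nodes (C LeftCurl)) + count a (nodes (C RightCurl)))%N.
Proof.
rewrite /edge_list_nodes /edge_list !map_cat -!map_comp !map_id /nodes.
rewrite /unzip1 /unzip2 !map_cat !count_cat.
by move: (count _ _) (count _ _) (count _ _) (count _ _) (count _ _) (count _ _); clear; lia.
Qed.

Lemma count_side_match D t f (a : pred nat) :
    (count a f <= count a (side_match D t).2)%N ->
  (count a (nodes (side_match D t).1) + count a (nodes (pair_up f)) <= count a t)%N.
Proof.
have [t' _ /seq.permP/(_ a)] := pair_up_nodes f.
have := seq.permP (match_nodes D [::] (singles D t)) a.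
have : (count a (singles D t) <= count a t)%N.
  by rewrite count_filter; apply: sub_count => k /andP[].
rewrite /= !count_cat -/(side_match D t); move: (count _ _) (count _ _) => c1 c2.
by move: (count _ _) (count _ _) (count _ _) (count _ _); clear; lia.
Qed.

(** Proved through an inequality of counts against the sides, which have no repetitions: it survives
    the filters, the reversal and the exchange of ends in the right curls, and a leftover node does
    no harm. *)
Lemma uniq_edge_nodes D : uniq (edge_list_nodes (edge_list (cap_diagram p G D))).
Proof.
suff le1 a : (count a (edge_list_nodes (edge_list (cap_diagram p G D))) <=
    count a ((sides p G).1 ++ (sides p G).2))%N.
  apply: count_mem_uniq => z; have := le1 (pred1 z); rewrite (count_uniq_mem z sides_uniq).
  rewrite -[X in _ = (nat_of_bool X)]has_pred1 has_count.
  by move: (count _ _) (z \in _ : bool) => c d; clear; case: d; lia.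
have filter_le (b : pred nat) t : (count a [seq k <- t | b k] <= count a t)%N.
  by rewrite count_filter; apply: sub_count => k /andP[].
have swapE q : count a (nodes [seq (e.2, e.1) | e <- q]) = count a (nodes q).
  by rewrite /nodes /unzip1 /unzip2 -!map_comp !count_cat addnC.
rewrite count_edge_list_nodes /= count_cat.
have L0 := @count_side_match D (sides p G).1 [::] a (leq0n _).
have R0 := @count_side_match D (sides p G).2 [::] a (leq0n _).
have L1 := count_side_match (filter_le (fun k => D k == up) (side_match D (sides p G).1).2).
have R1 : (count a (nodes (side_match D (sides p G).2).1) +
   count a (nodes (pair_up (rev [seq k <- (side_match D (sides p G).2).2 | D k == down])))
    <= count a (sides p G).2)%N.
  by apply: count_side_match; rewrite count_rev; apply: filter_le.
case: (is_Sp G); rewrite ?swapE; move: L0 R0 L1 R1;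
  rewrite /nodes /unzip1 /unzip2 !map_cat !count_cat /=;
  by do ![move: (count _ _)]; clear; lia.
Qed.

End Interface.

(** * The polynomials as functions of the arrow diagrams *)

Section Assembly.

Local Open Scope ring_scope.

Variables (p : nat) (G : group_data).
Hypothesis Gvalid : valid p G.
Implicit Types (x y z : weight G) (D E : diagram) (e : nat * nat).

Let sides_uniq := uniq_sides Gvalid.
Local Notation cap D := (cap_diagram p G D).

Lemma H_orbit_refl x : H_orbit p x x.
Proof.
move: x; case: G => [n s1 s2|m s] x; last exact: Sp_orbit_refl.
exists 1%g, 0; split; first by rewrite big1 // => i _; rewrite mxE.
rewrite /dot scaler0 addr0; apply/rowP => i.
by rewrite !mxE invg1 perm1 addrK.
Qed.

Lemma nodes_cons e l : perm_eq (nodes (e :: l)) (e.1 :: e.2 :: nodes l).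
Proof.
apply/seq.permP => a; rewrite /nodes /= !count_cat /= .
by move: (count _ _) (count _ _) (a e.1) (a e.2); clear; lia.
Qed.

Lemma carries_eq D E c e : carries D c e -> carries E c e ->
  E e.1 = D e.1 /\ E e.2 = D e.2.
Proof. by move=> /carriesP[-> ->] /carriesP[-> ->]. Qed.

(** Common to going down and going up: [c] is the direction of the edges on [x] and [R] what a
    reversal establishes. As no two edges share a node, reversing one leaves the others as they
    were, and each edge is reversed iff [E] differs there. *)
Lemma realize_flips b (R : weight G -> weight G -> Prop) (c : kind -> content * content) :
    (forall x, in_Lambda p x -> R x x) ->
    (forall x y z, R x y -> R y z -> R x z) ->
    (forall x k e, in_Lambda p x -> legal p G k e -> carries (diag p b x) (c k) e ->
       exists y, [/\ in_Lambda p y, R x y & diag p b y = flip (diag p b x) e]) ->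
    (forall D k e, edge_oriented D k e -> carries D (c k) e \/ carries (flip D e) (c k) e) ->
  forall l x E, in_Lambda p x -> uniq (edge_list_nodes l) ->
    all (fun ke => legal p G ke.1 ke.2) l ->
    all (fun ke => carries (diag p b x) (c ke.1) ke.2) l ->
    all (fun ke => edge_oriented E ke.1 ke.2) l ->
    (forall n, n \notin edge_list_nodes l -> E n = diag p b x n) ->
  exists y, [/\ in_Lambda p y, R x y & diag p b y = E].
Proof.
move=> Rrefl Rtrans one orient; elim=> [|[k e] l IH] x E xL.
  move=> _ _ _ _ off; exists x; split=> //; first exact: Rrefl.
  by apply/funext => n; rewrite off.
rewrite /edge_list_nodes map_cons (perm_uniq (nodes_cons _ _)) 2!cons_uniq.
move=> /and3P[e1_out e2_out uniq_l] /andP[leg leg_l] /andP[car car_l] /andP[or or_l] off.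
have off' n : n != e.1 -> n != e.2 -> n \notin edge_list_nodes l -> E n = diag p b x n.
  move=> n1 n2 n_l; apply: off; rewrite (perm_mem (nodes_cons _ _)) !inE.
  by rewrite (negbTE n1) (negbTE n2).
have [carE|carE] := orient _ _ _ or.
  apply: IH => // n n_l; have [E1 E2] := carries_eq car carE.
  have [->//|n1] := eqVneq n e.1; have [->//|n2] := eqVneq n e.2.
  exact: off'.
have [y [yL xy Ey]] := one x k e xL leg car.
have [|n n_l|z [zL yz Ez]] := IH y E yL uniq_l leg_l _ or_l.
- move: e1_out; rewrite inE negb_or => /andP[_ e1_out].
  elim: l car_l e1_out e2_out {IH uniq_l leg_l or_l off off'} => // f l IHl.
  rewrite map_cons !(perm_mem (nodes_cons _ _)) !inE !negb_or.
  case/andP=> car_f car_l /and3P[n11 n12 e1_out] /and3P[n21 n22 e2_out].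
  apply/andP; split; last exact: IHl.
  move: car_f; rewrite /carries Ey /flip !(eq_sym f.2.1) !(eq_sym f.2.2).
  by rewrite (negbTE n11) (negbTE n12) (negbTE n21) (negbTE n22).
- rewrite Ey; have [E1 E2] := carries_eq car carE; move: E1 E2; rewrite /flip !eqxx orbT /=.
  move=> E1 E2; have [->|n1] := eqVneq n e.1; first by rewrite /= -E1 opp_arrowK.
  have [->|n2] := eqVneq n e.2; first by rewrite /= -E2 opp_arrowK.
  exact: off'.
by exists z; split=> //; apply: Rtrans xy yz.
Qed.

Lemma end_nodes_edge_list (C : cc_diagram) n :
  n \in end_nodes C -> n \in edge_list_nodes (edge_list C).
Proof.
move=> n_in; rewrite -has_pred1 has_count count_edge_list_nodes.
move: n_in => /end_nodesP[k [e [e_in n_e]]].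
have : (0 < count (pred1 n) (nodes (C k)))%N.
  rewrite -has_count has_pred1 mem_cat.
  by case/orP: n_e => /eqP <-; rewrite map_f ?orbT.
by case: k e_in => _; move: (count _ _) (count _ _) (count _ _); clear; lia.
Qed.

Lemma realize_down b x E : in_Lambda p x -> compat p G (diag p b x) E ->
  exists y, [/\ in_Lambda p y, H_orbit p x y, preceq p y x & diag p b y = E].
Proof.
move=> xL [off orient]; pose R (u v : weight G) := H_orbit p u v /\ chain p u v.
have R_refl : forall u, in_Lambda p u -> R u u.
  by move=> u uL; split; [exact: H_orbit_refl | exact: chain_refl (in_Lambda_dominant uL)].
have R_trans : forall u v w, R u v -> R v w -> R u w.
  move=> u v w [uv uv'] [vw vw']; split; [exact: H_orbit_trans vw | exact: chain_trans vw'].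
have R_flip : forall u k e, in_Lambda p u -> legal p G k e -> carries (diag p b u) (anticlockwise k) e ->
    exists v, [/\ in_Lambda p v, R u v & diag p b v = flip (diag p b u) e].
  move=> u k e uL leg car; have [v [vL orb uv Ev]] := flip_down Gvalid uL leg car.
  by exists v; split=> //; split=> //; apply: chain_one.
have orient_flip : forall D k e, edge_oriented D k e ->
    carries D (anticlockwise k) e \/ carries (flip D e) (anticlockwise k) e.
  move=> D k e /orP[cw|acw]; [right; by rewrite carries_flip | by left].
have [||||y [yL [orb xy] Ey]] := realize_flips R_refl R_trans R_flip orient_flip
    xL (uniq_edge_nodes Gvalid (diag p b x)) (E := E).
- by apply: all_edge_list => k e /cap_diagram_edge[].
- by apply: all_edge_list => k e /cap_diagram_edge[].
- by apply: all_edge_list => k e e_in; apply: ((orientedP _ _).1 orient).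
- move=> n n_out; apply: off; apply: contra n_out; apply: end_nodes_edge_list.
by exists y.
Qed.

(** The edges of the codiagram of [x] are clockwise on [x], so reversing those at which [E] differs
    leads up. *)
Lemma realize_up b x E : in_Lambda p x ->
    compat p G (opp_diagram (diag p b x)) (opp_diagram E) ->
  exists y, [/\ in_Lambda p y, H_orbit p x y, preceq p x y & diag p b y = E].
Proof.
move=> xL [off orient]; pose R (u v : weight G) := H_orbit p u v /\ chain p v u.
have R_refl : forall u, in_Lambda p u -> R u u.
  by move=> u uL; split; [exact: H_orbit_refl | exact: chain_refl (in_Lambda_dominant uL)].
have R_trans : forall u v w, R u v -> R v w -> R u w.
  move=> u v w [uv uv'] [vw vw']; split; first exact: H_orbit_trans vw.
  exact: chain_trans uv'.
have R_flip : forall u k e, in_Lambda p u -> legal p G k e -> carries (diag p b u) (clockwise k) e ->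
    exists v, [/\ in_Lambda p v, R u v & diag p b v = flip (diag p b u) e].
  move=> u k e uL leg car; have [v [vL orb uv Ev]] := flip_up Gvalid uL leg car.
  by exists v; split=> //; split=> //; apply: chain_one.
have orient_flip : forall D k e, edge_oriented D k e ->
    carries D (clockwise k) e \/ carries (flip D e) (clockwise k) e.
  move=> D k e /orP[cw|acw]; [by left | right].
  by rewrite -carries_opp_acw opp_flip carries_flip carries_opp_cw.
have [||||y [yL [orb xy] Ey]] := realize_flips R_refl R_trans R_flip orient_flip
    xL (uniq_edge_nodes Gvalid (opp_diagram (diag p b x))) (E := E).
- by apply: all_edge_list => k e /cap_diagram_edge[].
- by apply: all_edge_list => k e /cap_diagram_edge[_]; rewrite carries_opp_acw.
- apply: all_edge_list => k e e_in; rewrite -edge_oriented_opp.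
  exact: ((orientedP _ _).1 orient).
- move=> n n_out; apply: (inv_inj opp_arrowK); apply: off; apply: contra n_out.
  exact: end_nodes_edge_list.
by exists y.
Qed.

(** Reversing all arrows exchanges clockwise and anti-clockwise and thus turns the order upside
    down. This makes the agreement lemma for cap diagrams available for codiagrams. *)
Lemma reach_opp D E : reach p G D E -> reach p G (opp_diagram E) (opp_diagram D).
Proof.
have trans D1 D2 D3 : reach p G D1 D2 -> reach p G D2 D3 -> reach p G D1 D3.
  by move=> r12; elim=> // F1 F2 _ r1 m; apply: reach_step m.
elim=> [|E1 E2 _ IH [k [e [leg acw ->]]]]; first exact: reach_refl.
apply: trans IH; apply: (reach_step (reach_refl _ _ _)); exists k, e; split=> //.
  by rewrite carries_opp_acw -carries_opp_acw opp_flip carries_flip carries_opp_cw.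
by rewrite -opp_flip flipK.
Qed.

Lemma dpolyE b x y : in_Lambda p x -> in_Lambda p y ->
  dpoly p b x y = dcoef p G (diag p b x) (diag p b y).
Proof.
move=> xL yL; rewrite /dpoly /dcoef.
suff E : `[< preceq p y x >] && oriented (cap (diag p b x)) (diag p b y) =
    `[< compat p G (diag p b x) (diag p b y) >] by rewrite E.
apply/andP/asboolP => [[/asboolP xy orient]|comp].
  split=> // n n_out; have [_ reach_xy] := preceq_reach Gvalid b xL xy.
  exact: (reach_agree sides_uniq reach_xy).
have [z [zL _ xz Ez]] := realize_down xL comp.
have <- : z = y by apply: (diag_inj Gvalid (b := b)).
by split; [apply/asboolP | rewrite Ez; case: comp].
Qed.

Lemma epolyE b x y : in_Lambda p x -> in_Lambda p y ->
  epoly p b x y = dcoef p G (opp_diagram (diag p b y)) (opp_diagram (diag p b x)).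
Proof.
move=> xL yL; rewrite /epoly /dcoef -/(opp_diagram (diag p b y)) -/(cap _).
have orE : oriented (cap (opp_diagram (diag p b y))) (opp_diagram (diag p b x)) =
    oriented (cap (opp_diagram (diag p b y))) (diag p b x).
  by apply/idP/idP => /orientedP h; apply/orientedP => k e /h; rewrite edge_oriented_opp.
have nbE : nb_clockwise (cap (opp_diagram (diag p b y))) (opp_diagram (diag p b x)) =
    nb_anticlockwise (cap (opp_diagram (diag p b y))) (diag p b x).
  apply: eq_bigr => k _; apply: eq_count => e; exact: carries_opp_cw.
suff E : `[< preceq p y x >] && oriented (cap (opp_diagram (diag p b y))) (diag p b x) =
    `[< compat p G (opp_diagram (diag p b y)) (opp_diagram (diag p b x)) >].
  by rewrite nbE -E.
apply/andP/asboolP => [[/asboolP xy orient]|comp].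
  split=> [n n_out|]; last by rewrite orE.
  have [_ /reach_opp reach_xy] := preceq_reach Gvalid b xL xy.
  by apply: (reach_agree sides_uniq reach_xy); rewrite ?orE.
have [z [zL _ xz Ez]] := realize_up yL comp.
have <- : z = x by apply: (diag_inj Gvalid (b := b)).
by split; [apply/asboolP | rewrite Ez -orE; case: comp].
Qed.

End Assembly.

(** * Equivalence and projection situations *)

Section Conclusion.

Local Open Scope ring_scope.

Variables (p : nat) (G : group_data).
Hypothesis Gvalid : valid p G.
Variables (kappa kappa' : weight G) (b b' : bool).
Implicit Types (x y : nat) (D E : diagram) (lam mu nu : weight G).

Let sides_uniq := uniq_sides Gvalid.
Local Notation cap D := (cap_diagram p G D).
Local Notation dia nu := (diag p b nu).
Local Notation dia' nu := (diag p b' nu).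

Lemma end_nodes_single D n : n \in end_nodes (cap D) -> single (D n).
Proof.
by case/end_nodesP => k [e [/cap_diagram_edge[_ /carries_single[e1 e2]] /orP[]/eqP <-]].
Qed.

Lemma cocap_end_nodes_single D n : n \in end_nodes (cocap_diagram p G D) -> single (D n).
Proof. by move=> n_in; rewrite -single_opp; apply: end_nodes_single n_in. Qed.

Lemma curls_end_nodes (C : cc_diagram) e : e \in curls C ->
  e.1 \in end_nodes C /\ e.2 \in end_nodes C.
Proof.
rewrite mem_cat => e_in.
by case/orP: e_in => e_in; split; apply/end_nodesP; [exists LeftCurl, e | exists LeftCurl, e
  | exists RightCurl, e | exists RightCurl, e]; rewrite eqxx ?orbT.
Qed.

Lemma single_Lambda nu n : in_Lambda p kappa -> Lambda p kappa nu ->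
  single (dia nu n) = single (dia kappa n).
Proof. by move=> kL [nuL orb]; apply: single_orbit. Qed.

Lemma equivalence_coef f : equivalence p kappa kappa' b b' f ->
  forall lam mu, Lambda p kappa lam -> Lambda p kappa mu ->
  dcoef p G (dia' (f lam)) (dia' (f mu)) = dcoef p G (dia lam) (dia mu) /\
  dcoef p G (opp_diagram (dia' (f mu))) (opp_diagram (dia' (f lam))) =
  dcoef p G (opp_diagram (dia mu)) (opp_diagram (dia lam)).
Proof.
case=> kL _ _ _ kinds lam mu lamL muL.
case: kinds => [[x [y [x_end nb y_cont diaE]]]|[Sp [y y_curl] diaE]|[Sp [x x_curl] diaE]].
- have E nu : Lambda p kappa nu -> dia' (f nu) = dia nu \o swap x y.
    move=> nuL; apply/funext => z; rewrite (diaE nu nuL) /= /swap.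
    by case: eqP => // _; case: eqP.
  have sx nu : Lambda p kappa nu -> single (dia nu x).
    by move=> nuL; rewrite single_Lambda //; apply: cocap_end_nodes_single.
  have sy nu : Lambda p kappa nu -> ~~ single (dia nu y).
    by move=> nuL; rewrite single_Lambda //; case/orP: y_cont => /eqP ->.
  rewrite !E //; split; first by apply: dcoef_swap; rewrite ?sx ?sy.
  have -> : opp_diagram (dia mu \o swap x y) = opp_diagram (dia mu) \o swap x y by [].
  have -> : opp_diagram (dia lam \o swap x y) = opp_diagram (dia lam) \o swap x y by [].
  by apply: dcoef_swap; rewrite // /opp_diagram single_opp ?sx ?sy.
- have E nu : Lambda p kappa nu -> dia' (f nu) = reverse_at 0 (dia nu).
    move=> nuL; have [-> Enu] := diaE nu nuL; apply/funext => z.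
    by rewrite Enu /= /reverse_at; case: eqP => // ->.
  have s0 nu : Lambda p kappa nu -> single (dia nu 0%N).
    move=> nuL; rewrite single_Lambda //; apply: cocap_end_nodes_single.
    by have [] := curls_end_nodes y_curl.
  have [t Et] : exists t, (sides p G).1 = 0%N :: t.
    move: Gvalid Sp; case: (G) => // m s GV _; rewrite (Sp_sidesE GV) /=.
    by have := wall_gt0 GV; case: (wall p m s) => // a _; exists (iota 1 a).
  have oppE D : opp_diagram (reverse_at 0 D) = reverse_at 0 (opp_diagram D).
    by apply/funext => z; rewrite /opp_diagram /reverse_at; case: ifP.
  rewrite !E // !oppE; split; first by apply: (dcoef_first _ _ Sp Et); rewrite ?s0.
  by apply: (dcoef_first _ _ Sp Et); rewrite // /opp_diagram single_opp s0.
- set N := last_node p in x_curl diaE.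
  have E nu : Lambda p kappa nu -> dia' (f nu) = reverse_at N (dia nu).
    move=> nuL; apply/funext => z.
    by rewrite (diaE nu nuL) /= /reverse_at; case: eqP => // ->.
  have sN nu : Lambda p kappa nu -> single (dia nu N).
    move=> nuL; rewrite single_Lambda //; apply: cocap_end_nodes_single.
    by apply/end_nodesP; exists RightCurl, (x, N); rewrite eqxx orbT.
  (* The right curl at the last node shows that the right side is not empty, so it ends with this
     node. *)
  have [t Et] : exists t, (sides p G).2 = rcons t N.
    have p_odd : odd p by move: Gvalid Sp; case: (G) => // m s /andP[].
    have EN : N = p./2 by rewrite /N /last_node /= uphalf_half p_odd.
    have [leg _] := cap_diagram_edge x_curl; rewrite EN in leg *.
    move: Gvalid leg; clear; case: (G) => [n s1 s2 _ //|m s GV].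
    rewrite (Sp_legalE GV) (Sp_sidesE GV) /= => /and3P[lt_x le_N wall_le].
    exists (iota (wall p m s) (p./2 - wall p m s)).
    have le_w : (wall p m s <= p./2)%N by apply: leq_trans wall_le (ltnW lt_x).
    by rewrite subSn // -addn1 iotaD subnKC // cats1.
  have oppE D : opp_diagram (reverse_at N D) = reverse_at N (opp_diagram D).
    by apply/funext => z; rewrite /opp_diagram /reverse_at; case: ifP.
  rewrite !E // !oppE; split; first by apply: (dcoef_last _ _ Sp Et); rewrite ?sN.
  by apply: (dcoef_last _ _ Sp Et); rewrite // /opp_diagram single_opp sN.
Qed.

Variables (k : kind) (x y : nat).
Hypothesis proj : projection p kappa kappa' b b' k x y.

Lemma subseq_adjacent t t1 t2 : uniq t -> t = t1 ++ [:: y; x] ++ t2 ->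
  subseq [:: x; y] t -> False.
Proof.
rewrite (_ : t1 ++ [:: y; x] ++ t2 = (t1 ++ [:: y]) ++ x :: t2); last by rewrite -catA.
move=> ut Et; rewrite {}Et in ut *.
have x_out : x \notin t1 ++ [:: y].
  by move: ut; rewrite cat_uniq => /and3P[_ /hasPn/(_ x (mem_head _ _))].
move/(subseq_notin_cat x_out); rewrite /= eqxx sub1seq => y_t2.
move: ut; rewrite cat_uniq => /and3P[_ /hasPn/(_ y) + _]; rewrite inE y_t2 orbT => /(_ isT).
by rewrite mem_cat inE eqxx orbT.
Qed.

(** The relation [neighbours] is symmetric and leaves the side open; that [x] comes right before [y]
    follows from [(x, y)] being an edge. The curl at nodes 0 and 1 is a left curl, as node 0 lies
    left of the wall. *)
Lemma proj_adjacent : adjacent_edge p G k x y.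
Proof.
have [uL uR] : uniq (sides p G).1 /\ uniq (sides p G).2.
  by move: sides_uniq; rewrite cat_uniq => /and3P[].
have [_ _ [[-> [xy_cap nb _]]|[-> [Sp [-> ->] xy_curl _]]]] := proj.
- have [leg _] := cap_diagram_edge xy_cap.
  have [neq_xy xy_side] := side_edge_mem sides_uniq leg; rewrite /= in neq_xy xy_side.
  case/orP: nb => /orP[] /adjacent_split[t1 [t2 Et]].
  + by exists t1, t2; left.
  + exfalso; have [|sub] := legal_sub leg; first exact: (subseq_adjacent uL Et).
    apply: (not_both_sides sides_uniq (z := x)).
      by rewrite Et !mem_cat !inE eqxx !orbT.
    by apply: (mem_subseq sub); rewrite inE eqxx.
  + by exists t1, t2; right.
  + exfalso; have [sub|] := legal_sub leg; last exact: (subseq_adjacent uR Et).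
    apply: (not_both_sides sides_uniq (z := x)).
      by apply: (mem_subseq sub); rewrite inE eqxx.
    by rewrite Et !mem_cat !inE eqxx !orbT.
split=> //; move: xy_curl; rewrite mem_cat.
case/orP=> /cap_diagram_edge[leg _]; move: leg Gvalid Sp; clear; case: (G) => // m s + GV _;
  rewrite (Sp_legalE GV) (Sp_sidesE GV) /=.
  by case/andP=> _; case: (wall p m s) => [|[|a]] // _; exists (iota 2 a).
by case/andP=> _; rewrite leqNgt (wall_gt0 GV).
Qed.

Definition left_target : content := diag p b' kappa' x.
Definition right_target : content := diag p b' kappa' y.

Lemma proj_contents : [/\ x != y, ~~ single left_target & ~~ single right_target].
Proof.
have [_ _ [[_ [xy_cap _ diaE]]|[_ [_ [Ex Ey] _ diaE]]]] := proj; last first.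
  by rewrite /left_target /right_target !diaE /= Ex Ey.
have [leg _] := cap_diagram_edge xy_cap.
have [/= neq_xy _] := side_edge_mem sides_uniq leg; split=> //.
  by rewrite /left_target; case: diaE => [|[_]] ->; rewrite /= eqxx.
by rewrite /right_target; case: diaE => [|[_]] ->; rewrite /= eq_sym (negbTE neq_xy) eqxx.
Qed.

Lemma projectsE nu nu' : projects p kappa kappa' b b' k x y nu nu' ->
  dia' nu' = replace2 x y left_target right_target (dia nu).
Proof. by case=> _ _ _ E; apply/funext => z; rewrite E. Qed.

Lemma opp_replace2 D :
  opp_diagram (replace2 x y left_target right_target D) =
  replace2 x y left_target right_target (opp_diagram D).
Proof.
have [_ n1 n2] := proj_contents; apply/funext => z; rewrite /opp_diagram /replace2.
by case: eqP => _; [apply: opp_nonsingle | case: eqP => _ //; apply: opp_nonsingle].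
Qed.

Lemma carries_acwN D e : carries D (anticlockwise k) e -> carries D (clockwise k) e = false.
Proof. by rewrite /carries => /eqP ->; case: (k). Qed.

(** The distinguished edge comes from the codiagram of [kappa]. As [lam] carries an anti-clockwise
    pair at these adjacent nodes, it is also an edge of the cap diagram of [lam] and can be removed
    there. *)
Lemma plus_dcoef lam lam' nu nu' :
    plus_lift p kappa kappa' b b' k x y lam lam' ->
    projects p kappa kappa' b b' k x y nu nu' ->
  dcoef p G (dia lam) (dia nu) =
  'X ^+ carries (dia nu) (clockwise k) (x, y) * dcoef p G (dia' lam') (dia' nu').
Proof.
case=> pr_lam acw pr_nu; have [_ n1 n2] := proj_contents.
rewrite (dcoef_remove sides_uniq _ proj_adjacent acw n1 n2).
have [_ _ -> _] := pr_nu.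
by rewrite -(projectsE pr_lam) -(projectsE pr_nu).
Qed.

Lemma minus_dcoef mu mu' nu nu' :
    minus_lift p kappa kappa' b b' k x y mu mu' ->
    projects p kappa kappa' b b' k x y nu nu' ->
  dcoef p G (opp_diagram (dia mu)) (opp_diagram (dia nu)) =
  'X ^+ carries (dia nu) (anticlockwise k) (x, y)
    * dcoef p G (opp_diagram (dia' mu')) (opp_diagram (dia' nu')).
Proof.
case=> pr_mu cw pr_nu; have [_ n1 n2] := proj_contents.
have acw : carries (opp_diagram (dia mu)) (anticlockwise k) (x, y).
  by rewrite carries_opp_acw.
rewrite (dcoef_remove sides_uniq _ proj_adjacent acw n1 n2) edge_oriented_opp.
have [_ _ -> _] := pr_nu.
by rewrite (projectsE pr_mu) (projectsE pr_nu) !opp_replace2 carries_opp_cw.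
Qed.

Lemma lift_of_realization nu nu' : Lambda p kappa nu -> Lambda p kappa' nu' ->
    edge_oriented (dia nu) k (x, y) -> dia' nu' = replace2 x y left_target right_target (dia nu) ->
  is_lift p kappa kappa' b b' k x y nu.
Proof.
move=> nuL nuL' or E; exists nu'.
have pr : projects p kappa kappa' b b' k x y nu nu' by split=> // z; rewrite E.
by case/orP: or => car; [right|left].
Qed.

Lemma plus_dcoef0 lam lam' mu : plus_lift p kappa kappa' b b' k x y lam lam' ->
    Lambda p kappa mu -> ~ is_lift p kappa kappa' b b' k x y mu ->
  dcoef p G (dia lam) (dia mu) = 0.
Proof.
case=> pr_lam acw muL not_lift; have [_ n1 n2] := proj_contents.
rewrite (dcoef_remove sides_uniq _ proj_adjacent acw n1 n2).
case: ifP => // or; rewrite /dcoef; case: asboolP => [comp|_]; last by rewrite mulr0.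
case: not_lift; have [_ [lamL' orb] _ _] := pr_lam.
rewrite -(projectsE pr_lam) in comp; have [nu [nuL orb' _ Enu]] := realize_down Gvalid lamL' comp.
apply: lift_of_realization Enu => //; split=> //; exact: H_orbit_trans orb orb'.
Qed.

Lemma minus_dcoef0 mu mu' lam : minus_lift p kappa kappa' b b' k x y mu mu' ->
    Lambda p kappa lam -> ~ is_lift p kappa kappa' b b' k x y lam ->
  dcoef p G (opp_diagram (dia mu)) (opp_diagram (dia lam)) = 0.
Proof.
case=> pr_mu cw lamL not_lift; have [_ n1 n2] := proj_contents.
have acw : carries (opp_diagram (dia mu)) (anticlockwise k) (x, y).
  by rewrite carries_opp_acw.
rewrite (dcoef_remove sides_uniq _ proj_adjacent acw n1 n2) edge_oriented_opp.
case: ifP => // or; rewrite /dcoef; case: asboolP => [comp|_]; last by rewrite mulr0.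
case: not_lift; have [_ [muL' orb] _ _] := pr_mu.
rewrite -!opp_replace2 -(projectsE pr_mu) in comp.
have [nu [nuL orb' _ Enu]] := realize_up Gvalid muL' comp.
apply: lift_of_realization Enu => //; split=> //; exact: H_orbit_trans orb orb'.
Qed.

End Conclusion.

Local Open Scope ring_scope.

Theorem lemma1 (p : nat) (G : group_data) (p_prime : prime p)
    (G_valid : valid p G) (kappa kappa' : weight G) (b b' : bool) :
  (forall f : weight G -> weight G,
     equivalence p kappa kappa' b b' f ->
     forall lam mu : weight G, Lambda p kappa lam -> Lambda p kappa mu ->
       dpoly p b lam mu = dpoly p b' (f lam) (f mu) /\
       epoly p b lam mu = epoly p b' (f lam) (f mu))
  /\
  (forall (k : kind) (x y : nat),
     projection p kappa kappa' b b' k x y ->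
     let plus := plus_lift p kappa kappa' b b' k x y in
     let minus := minus_lift p kappa kappa' b b' k x y in
     let lift := is_lift p kappa kappa' b b' k x y in
     (forall lam lam' : weight G, plus lam lam' ->
        [/\ forall mu mu' : weight G, plus mu mu' ->
              dpoly p b lam mu = dpoly p b' lam' mu',
            forall mu mu' : weight G, minus mu mu' ->
              dpoly p b lam mu = 'X * dpoly p b' lam' mu'
          & forall mu : weight G, Lambda p kappa mu -> ~ lift mu ->
              dpoly p b lam mu = 0])
     /\
     (forall mu mu' : weight G, minus mu mu' ->
        [/\ forall lam lam' : weight G, minus lam lam' ->
              epoly p b lam mu = epoly p b' lam' mu',
            forall lam lam' : weight G, plus lam lam' ->
              epoly p b lam mu = 'X * epoly p b' lam' mu'
          & forall lam : weight G, Lambda p kappa lam -> ~ lift lam ->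
              epoly p b lam mu = 0])).
Proof.
split=> [f equiv lam mu lamL muL|k x y proj plus minus lift].
  have [_ _ [f_in _ _] _ _] := equiv.
  have [d_eq e_eq] := equivalence_coef G_valid equiv lamL muL.
  have [[lamI _] [muI _]] := (lamL, muL).
  have [[lamI' _] [muI' _]] := (f_in lam lamL, f_in mu muL).
  by rewrite !dpolyE // !epolyE // d_eq e_eq.
have in_proj nu nu' : projects p kappa kappa' b b' k x y nu nu' ->
  in_Lambda p nu /\ in_Lambda p nu' by case=> [[? _] [? _]].
have acw_cw D e : carries D (anticlockwise k) e -> carries D (clockwise k) e = false.
  exact: carries_acwN.
have cw_acw D e : carries D (clockwise k) e -> carries D (anticlockwise k) e = false.
  by move=> cw; apply: contraTF cw => /acw_cw ->.
split=> [lam lam' lam_plus|mu mu' mu_minus].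
  have [lamI lamI'] := in_proj _ _ lam_plus.1; split=> [mu mu'|mu mu'|mu muL not_lift].
  - case=> pr acw; have [muI muI'] := in_proj _ _ pr.
    by rewrite !dpolyE // (plus_dcoef G_valid proj lam_plus pr) acw_cw // mul1r.
  - case=> pr cw; have [muI muI'] := in_proj _ _ pr.
    by rewrite !dpolyE // (plus_dcoef G_valid proj lam_plus pr) cw.
  - by rewrite dpolyE //; [exact: (plus_dcoef0 G_valid proj lam_plus) | case: muL].
have [muI muI'] := in_proj _ _ mu_minus.1; split=> [lam lam'|lam lam'|lam lamL not_lift].
- case=> pr cw; have [lamI lamI'] := in_proj _ _ pr.
  by rewrite !epolyE // (minus_dcoef G_valid proj mu_minus pr) cw_acw // mul1r.
- case=> pr acw; have [lamI lamI'] := in_proj _ _ pr.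
  by rewrite !epolyE // (minus_dcoef G_valid proj mu_minus pr) acw.
- by rewrite epolyE //; [exact: (minus_dcoef0 G_valid proj mu_minus) | case: lamL].
Qed.
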